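(* Consider a sequence of variable selection problems in logistic regression indexed by the sample size $n$: in the $n$-th problem, $(X_1,Y_1),\dots,(X_n,Y_n)$ are i.i.d. following the logistic regression model with $p_n$ covariates and true parameter $\beta_0(n)\in\mathbb{R}^{p_n}$ with support $J_0(n)$, and $q_n\ge 1$ is an integer bound on the size of the considered models. Let $\beta_{\min}(n)=\min_{j\in J_0(n)}|\beta_0(n)_j|$. Suppose that $p_n\to\infty$ as $n\to\infty$ with $p_n\le n^\kappa$ for some $\kappa\in(0,\infty]$ and $\log(p_n)\le n^\tau$ for some $0<\tau<1$. Suppose further that $q_n\le n^\psi$ for some $0\le\psi<\frac13(1-\tau)$, and that $\beta_{\min}(n)\ge n^{-\phi/2}$ for some $0\le\phi<1-\psi-\tau$. Assume that there are constants $a_0,a_1,a_2,a_3>0$, not depending on $n$, such that for every $n$: $\mathbb{E}[(X_1^\top u)^2]\ge a_1$ and $\mathbb{E}[|X_1^\top u|^3]\le a_2$ for every $2q_n$-sparse unit vector $u\in\mathbb{R}^{p_n}$; $|X_{1j}|\le a_3$ for each $j\in[p_n]$; $|J_0(n)|\le q_n$; and $\|\beta_0(n)\|_2\le a_0$. Then for any $\gamma\ge 0$ with $\gamma>1-\frac1{2\kappa}$, variable selection with $\mathrm{BIC}_\gamma$ is consistent in the sense that the event $$J_0(n)=\arg\min\{\mathrm{BIC}_\gamma(J): J\subset[p_n],\ |J|\le q_n\}$$ (i.e. $J_0(n)$ is the unique minimizer) has probability tending to one as $n\to\infty$.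
   Context: $[p]=\{1,\dots,p\}$; the support of a vector is the set of indices of its nonzero coordinates; a vector is $k$-sparse if it has at most $k$ nonzero coordinates; a unit vector has Euclidean norm $1$. When $\kappa=\infty$, the condition $p_n\le n^\kappa$ is vacuous and $\frac1{2\kappa}=0$. Logistic regression model with parameter $\beta_0\in\mathbb{R}^p$: $X_i\in\mathbb{R}^p$ are random covariates, $Y_i\in\{0,1\}$, and $\log\frac{P(Y_i=1\mid X_i=x)}{1-P(Y_i=1\mid X_i=x)}=x^\top\beta_0$. With $\mathrm{b}(\theta)=\log(1+e^\theta)$ the log-likelihood is $\log \mathrm{L}(\beta)=\sum_{i=1}^n\big(Y_i\,X_i^\top\beta-\mathrm{b}(X_i^\top\beta)\big)$. For $J\subseteq[p]$, $\mathbb{R}^J$ is identified with the set of vectors in $\mathbb{R}^p$ that vanish outside $J$, and $\hat\beta_J$ is the maximum likelihood estimator in the model given by $J$, i.e. a maximizer of $\log\mathrm{L}$ over $\mathbb{R}^J$ (so $\log\mathrm{L}(\hat\beta_J)$ is the supremum of $\log\mathrm{L}$ over $\mathbb{R}^J$). The (extended) Bayesian information criterion, for $\gamma\ge0$, is $\mathrm{BIC}_\gamma(J)=-2\log \mathrm{L}(\hat\beta_J)+|J|\big(\log(n)+2\gamma\log(p)\big)$, with $p=p_n$ in the $n$-th problem. A minimum over the empty set is read as $+\infty$. *)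

(* Defs.v *)
From mathcomp Require Import all_boot all_order all_algebra.
From mathcomp Require Import all_classical all_reals all_analysis.

Set Implicit Arguments.
Unset Strict Implicit.
Unset Printing Implicit Defensive.

Import Order.TTheory GRing.Theory Num.Theory.
Import numFieldNormedType.Exports.

Local Open Scope classical_set_scope.
Local Open Scope ring_scope.

Section Vectors.
Context {R : realType} {p : nat}.
Implicit Types (beta : 'rV[R]_p) (x : p.-tuple R).

Definition supp beta : {set 'I_p} := finset (fun j => beta ord0 j != 0).

Definition sparse (k : nat) beta : Prop := (#|supp beta| <= k)%N.

(* The library's norm on row vectors is the sup norm. *)
Definition norm2 beta : R := Num.sqrt (\sum_(j < p) beta ord0 j ^+ 2).

(* Covariate vectors are tuples because these carry the product Borel
   sigma-algebra in the library, which row vectors do not. *)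
Definition dot x beta : R := \sum_(j < p) tnth x j * beta ord0 j.

(* +oo when beta = 0. *)
Definition beta_min beta : \bar R :=
  \big[Order.min/+oo%E]_(j in supp beta) (`|beta ord0 j|)%:E.

Definition coord_space (J : {set 'I_p}) : set 'rV[R]_p :=
  [set beta | forall j, j \notin J -> beta ord0 j = 0].

End Vectors.

Section Probability.
Context {d d' : measure_display} {T : measurableType d} {R : realType}
  (P : probability T R).

Definition mutually_independent {T' : measurableType d'} (n : nat)
    (Z : 'I_n -> {RV P >-> T'}) : Prop :=
  forall (I : {set 'I_n}) (B : 'I_n -> set T'),
    (forall i, measurable (B i)) ->
    P (\bigcap_(i in [set` I]) (Z i @^-1` B i)) =
    (\prod_(i in I) P (Z i @^-1` B i))%E.

Definition identically_distributed {T' : measurableType d'} (n : nat)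
    (Z : 'I_n -> {RV P >-> T'}) : Prop :=
  forall (i k : 'I_n) (B : set T'), measurable B ->
    distribution P (Z i) B = distribution P (Z k) B.

Definition iid {T' : measurableType d'} (n : nat)
    (Z : 'I_n -> {RV P >-> T'}) : Prop :=
  mutually_independent Z /\ identically_distributed Z.

(* h x is a version of P(Y = 1 | X = x), where Z = (X, Y). *)
Definition cond_prob1 {T' : measurableType d'}
    (Z : {RV P >-> (T' * bool)%type}) (h : T' -> R) : Prop :=
  measurable_fun setT h /\
  forall B : set T', measurable B ->
    P [set w | B (Z w).1 /\ (Z w).2] =
    (\int[P]_(w in [set w | B (Z w).1]) (h (Z w).1)%:E)%E.

End Probability.

(* The bounds 0 < h x < 1 make the log-odds meaningful, as ln is total with
   ln t = 0 for t <= 0 and 1 / 0 = 0. *)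
Definition logistic_model {d : measure_display} {T : measurableType d}
    {R : realType} (P : probability T R) (p : nat)
    (Z : {RV P >-> (p.-tuple R * bool)%type}) (beta0 : 'rV[R]_p) : Prop :=
  exists h : p.-tuple R -> R,
    [/\ cond_prob1 Z h,
        forall x, 0 < h x < 1
      & forall x, ln (h x / (1 - h x)) = dot x beta0].

Section BIC.
Context {R : realType} {n p : nat}.
Implicit Types (D : 'I_n -> p.-tuple R * bool) (J : {set 'I_p}).

Definition cumulant (theta : R) : R := ln (1 + expR theta).

Definition loglik D (beta : 'rV[R]_p) : R :=
  \sum_(i < n) ((D i).2%:R * dot (D i).1 beta - cumulant (dot (D i).1 beta)).

(* log L at the maximum likelihood estimator of the model J.  As log L <= 0,
   this supremum is always finite; for separable data it is not attained. *)
Definition max_loglik D J : R := sup [set loglik D beta | beta in coord_space J].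

Definition bic (gamma : R) D J : R :=
  - 2 * max_loglik D J + #|J|%:R * (ln n%:R + 2 * gamma * ln p%:R).

Definition argmin_bic (gamma : R) (q : nat) D : set {set 'I_p} :=
  [set J : {set 'I_p} | (#|J| <= q)%N /\
           forall K : {set 'I_p}, (#|K| <= q)%N ->
             bic gamma D J <= bic gamma D K].

End BIC.

(* Main.v *)
(* Let L = log n + log p and write LR(v) for the likelihood ratio of beta0 + v
   against beta0.  For a fixed v, E LR(v) = 1 and, for small sparse v,
   E LR(v)^(1/2) <= exp (- c n |v|^2), so P(LR(v) >= e^t) is at most
   exp (- (1 - eta) t - 2 eta c n |v|^2).  Taking v on the lattice of integer
   combinations of vectors n^(-1/2) w_j and t = |K| T with T > log p, where K is
   the set of active indices, a union bound controls all lattice points at once: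
   the Gaussian factor makes the sum over the integer coordinates converge, and
   the choice of K costs log p per index.  By concavity and a bounded Hessian,
   an arbitrary point can be rounded to a lattice point at a cost O(1) per
   coordinate.

   With w_j = e_j this shows that the likelihood at distance at least r, with
   r^2 of order q L / n, is smaller than at beta0 by a multiple of q L, which
   excludes the models missing an index of J0, since beta_min >= r.  For
   J containing J0 and |beta - beta0| < r, write beta - beta0 = a + w with a
   supported in J0 and w spanned by w_j, j in J \ J0, where w_j is the residual
   of e_j after projection onto the coordinates J0, orthogonal for the Fisher
   information.  The cross term between a and w is then negligible (as
   q^3 L / n -> 0), so the gain of J over J0 is at most the log-likelihood ratio
   of w, that is |J \ J0| (log n / 2 + gamma log p - eps L), which is below half
   the difference of the penalties. *)

Require Import Defs.
From mathcomp Require Import all_boot all_order all_algebra.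
From mathcomp Require Import all_classical all_reals all_analysis.
From mathcomp Require Import measurable_realfun ring lra.

Set Implicit Arguments.
Unset Strict Implicit.
Unset Printing Implicit Defensive.

Import Order.TTheory GRing.Theory Num.Theory.
Import numFieldNormedType.Exports.
Import HBNNSimple.

Local Open Scope classical_set_scope.
Local Open Scope ring_scope.

(** * The logistic cumulant *)

(** The condition on gamma leaves no constant factor to lose: the price [T] per extra index must
    exceed log p, to pay for the union bound, and stay below half the penalty, log n / 2 + gamma log
    p, and these differ only by a small multiple of L. Hence the sharp tail exp (- t), available
    because likelihood ratios have mean 1, is weakened only by a small power eta. The Gaussian
    factor is spent twice: one share makes the sum over lattice points converge, another stays in
    the bound as -aL times the sum of the squared integer coordinates, where it absorbs the cross
    and cubic terms. The residuals w_j are needed because expanding along the coordinate vectors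
    would charge [T] for the indices of J0 as well, while the penalty pays only for J \ J0; the part
    a is free since beta0 + a competes in the model J0. With r^2 of order q L / n and Gram
    deviations of order sqrt (L / n), the errors q^2 n (L / n) r^2 and q r^2 n r^2 are of order q^3
    L^2 / n and must be small against L, which is the condition psi < (1 - tau) / 3. *)

Section Calculus.
Context {R : realType}.
Implicit Types (f df : R -> R) (s t x y : R).

(** Increments of either sign occur below, so the intermediate point is located by its distance from
    [x] and its side of [x] rather than by an interval. *)
Lemma MVT_sym f df x y : (forall t, is_derive t 1 f (df t)) ->
  exists c, [/\ `|c - x| <= `|y - x|, 0 <= (c - x) * (y - x) &
    f y - f x = df c * (y - x)].
Proof.
move=> fdf; have fc A : {within A, continuous f}.
  apply: continuous_subspaceT => t.
  by apply: differentiable_continuous; apply/derivable1_diffP; case: (fdf t).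
case: (leP x y) => xy.
  have [c /[!in_itv]/= /andP[xc cy] e] := MVT_segment xy (fun t _ => fdf t) (fc _).
  by exists c; split; rewrite ?mulr_ge0 ?subr_ge0// !ger0_norm ?subr_ge0// lerB.
have [c /[!in_itv]/= /andP[yc cx] e] :=
  MVT_segment (ltW xy) (fun t _ => fdf t) (fc _).
exists c; split; last by rewrite -[f y - _]opprB e -mulrN opprB.
  by rewrite !ler0_norm ?subr_le0// ?(ltW xy)// !opprB lerB.
by rewrite mulr_le0 ?subr_le0// ltW.
Qed.

Lemma lipschitz_derive f df (k : R) x y : (forall t, is_derive t 1 f (df t)) ->
  (forall t, `|df t| <= k) -> `|f y - f x| <= k * `|y - x|.
Proof.
move=> fdf dfk; have [c [_ _ ->]] := MVT_sym x y fdf.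
by rewrite normrM ler_wpM2r.
Qed.

(** From exp (- x) >= 1 - x one gets exp x <= 1 / (1 - x), which lies below the quadratic when |x|
    <= 1/2. *)
Lemma expR_quadratic x : `|x| <= 2^-1 -> expR x <= 1 + x + 2 * x ^+ 2.
Proof.
rewrite ler_norml => /andP[x1 x2].
rewrite -[x in expR x]opprK expRN invf_ple ?posrE ?expR_gt0//; last nra.
apply: (@le_trans _ _ (1 - x)); last by have := expR_ge1Dx (- x).
rewrite -[leLHS]mul1r ler_pdivrMr; last nra.
have : 0 <= x ^+ 2 * (1 - 2 * x) by rewrite mulr_ge0 ?sqr_ge0//; lra.
lra.
Qed.

(** In fact |exp x - 1| >= |x| / 2: for x >= 0 by the tangent at 0, and for -1/4 <= x < 0 because
    [expR_quadratic] gives exp x <= 1 + x / 2. *)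
Lemma expR_sub1_sqr x : `|x| <= 4^-1 -> x ^+ 2 / 4 <= (expR x - 1) ^+ 2.
Proof.
move=> x4; have := @expR_quadratic x; have := expR_ge1Dx x.
move: x4; rewrite ler_norml => /andP[x1 x2] e1 e2.
have {}e2 : expR x <= 1 + x + 2 * x ^+ 2.
  by apply: e2; rewrite ler_norml; apply/andP; split; lra.
have -> : x ^+ 2 / 4 = (x / 2) ^+ 2 by field.
have [x0|x0] := leP 0 x; first by rewrite ler_sqr ?nnegrE; lra.
by rewrite -sqrrN -[leRHS]sqrrN ler_sqr ?nnegrE; nra.
Qed.

Definition sigmoid t : R := expR t / (1 + expR t).

Lemma expRD1_gt0 t : 0 < 1 + expR t.
Proof. by rewrite addr_gt0 ?expR_gt0. Qed.

Lemma expRD1_neq0 t : 1 + expR t != 0.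
Proof. by rewrite gt_eqF// expRD1_gt0. Qed.

Hint Resolve expRD1_neq0 expRD1_gt0 : core.

(** Variance of a Bernoulli variable with mean [sigmoid t], hence the second derivative of
    [cumulant]. *)
Definition logistic_var t : R := sigmoid t * (1 - sigmoid t).

Lemma sigmoid_gt0 t : 0 < sigmoid t.
Proof. by rewrite divr_gt0 ?expR_gt0. Qed.

Lemma sigmoidC t : 1 - sigmoid t = (1 + expR t)^-1.
Proof. by rewrite /sigmoid; field. Qed.

Lemma sigmoid_lt1 t : sigmoid t < 1.
Proof. by rewrite -subr_gt0 sigmoidC invr_gt0. Qed.

Lemma logistic_var_ge0 t : 0 <= logistic_var t.
Proof. by rewrite mulr_ge0 ?subr_ge0 ?(ltW (sigmoid_gt0 _))// (ltW (sigmoid_lt1 _)). Qed.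

Lemma logistic_var_le1 t : logistic_var t <= 1.
Proof.
have := sigmoid_gt0 t; have := sigmoid_lt1 t; rewrite /logistic_var; nra.
Qed.

Lemma is_derive_cumulant t : is_derive t 1 (@cumulant R) (sigmoid t).
Proof.
have d1 : is_derive t 1 (fun x => 1 + expR x) (expR t).
  by rewrite -[X in is_derive _ _ _ X]add0r; exact: is_deriveD.
have d2 := is_derive1_ln (expRD1_gt0 t).
have := @is_derive1_comp R (@ln R) (fun x => 1 + expR x) t _ _ d2 d1.
by rewrite mulrC.
Qed.

Lemma is_derive_sigmoid t : is_derive t 1 sigmoid (logistic_var t).
Proof.
have d1 : is_derive t 1 (fun x => 1 + expR x) (expR t).
  by rewrite -[X in is_derive _ _ _ X]add0r; exact: is_deriveD.
have d2 := @is_deriveV R (fun x => 1 + expR x) t _ _ (expRD1_neq0 t) d1.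
have d3 := is_deriveM (is_derive_expR t) d2.
apply: (is_derive_eq d3).
rewrite /logistic_var sigmoidC /sigmoid /GRing.scale/=.
by field.
Qed.

Lemma sigmoid_lipschitz x y : `|sigmoid y - sigmoid x| <= `|y - x|.
Proof.
rewrite -[leRHS]mul1r; apply: (@lipschitz_derive sigmoid logistic_var 1 x y is_derive_sigmoid) => t.
by rewrite ger0_norm ?logistic_var_ge0// logistic_var_le1.
Qed.

Lemma logistic_var_lipschitz x y :
  `|logistic_var y - logistic_var x| <= `|y - x|.
Proof.
apply: le_trans (sigmoid_lipschitz x y); rewrite /logistic_var.
set a := sigmoid y; set b := sigmoid x.
have -> : a * (1 - a) - b * (1 - b) = (a - b) * (1 - a - b) by ring.
rewrite normrM -[leRHS]mulr1 ler_wpM2l// ler_norml.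
have := (sigmoid_gt0 x, sigmoid_gt0 y, sigmoid_lt1 x, sigmoid_lt1 y).
rewrite -/a -/b => -[[[]]] *; apply/andP; split; lra.
Qed.

Lemma cumulant_lipschitz x y : `|cumulant y - cumulant x| <= `|y - x|.
Proof.
rewrite -[leRHS]mul1r; apply: (@lipschitz_derive (@cumulant R) sigmoid 1 x y is_derive_cumulant) => t.
by rewrite ger0_norm (ltW (sigmoid_gt0 _), ltW (sigmoid_lt1 _)).
Qed.

(** The slope at the intermediate point differs from [sigmoid t] by at most |s|. The coefficient of
    [s ^+ 2] is not sharp, as only boundedness of the Hessian matters. *)
Lemma cumulant_quadratic t s :
  cumulant (t + s) <= cumulant t + sigmoid t * s + s ^+ 2.
Proof.
have [c [ct _ e]] := MVT_sym t (t + s) is_derive_cumulant.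
rewrite -addrA -lerBlDl e addrAC subrr add0r -lerBlDl -mulrBl.
apply: le_trans (ler_norm _) _; rewrite normrM.
rewrite -[leRHS]real_normK ?num_real// expr2.
rewrite ler_wpM2r//; apply: le_trans (sigmoid_lipschitz _ _) _.
by apply: le_trans ct _; rewrite addrAC subrr add0r.
Qed.

Lemma sigmoid_homo x y : x <= y -> sigmoid x <= sigmoid y.
Proof.
move=> xy; rewrite -lerN2 -(lerD2l 1) !sigmoidC lef_pV2 ?posrE//.
by rewrite lerD2l ler_expR.
Qed.

Lemma cumulant_tangent x y : cumulant x + sigmoid x * (y - x) <= cumulant y.
Proof.
have [c [_ cxy e]] := MVT_sym x y is_derive_cumulant.
rewrite addrC -lerBrDr e -subr_ge0 -mulrBl.
have [xy|yx|<-] := ltgtP x y; last by rewrite subrr mulr0.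
  rewrite mulr_ge0 ?subr_ge0 ?(ltW xy)// sigmoid_homo//.
  by move: cxy; rewrite pmulr_lge0 ?subr_gt0// subr_ge0.
rewrite mulr_le0 ?subr_le0 ?(ltW yx)// sigmoid_homo//.
by move: cxy; rewrite nmulr_lge0 ?subr_lt0// subr_le0.
Qed.

(** Two applications of the mean value theorem turn the mixed second difference into x y times the
    variance at a point within |x| + |y| of [t]; the Lipschitz bound on the variance gives the cubic
    error. *)
Lemma cumulant_interaction t x y :
  logistic_var t * x * y - (x ^+ 2 * `|y| + `|x| * y ^+ 2) <=
  cumulant (t + x + y) - cumulant (t + x) - cumulant (t + y) + cumulant t.
Proof.
pose g z := cumulant (z + x) - cumulant z.
have dg (z : R) : is_derive z 1 g (sigmoid (z + x) - sigmoid z).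
  apply: is_deriveB; last exact: is_derive_cumulant.
  have d1 : is_derive z 1 (fun u => u + x) (1 : R).
    by rewrite -[X in is_derive _ _ _ X]addr0; exact: is_deriveD.
  have := @is_derive1_comp R (@cumulant R) (fun u => u + x) z _ _
    (is_derive_cumulant (z + x)) d1.
  by rewrite mulr1.
have [c [ct _ e]] := MVT_sym t (t + y) dg.
have [c' [ct' _ e']] := MVT_sym c (c + x) is_derive_sigmoid.
have xK (u v : R) : u + v - u = v by ring.
rewrite !xK in ct e ct' e'; rewrite e' in e.
have -> : cumulant (t + x + y) - cumulant (t + x) - cumulant (t + y) + cumulant t
  = g (t + y) - g t by rewrite /g [t + x + y]addrAC; ring.
rewrite e lerBlDl -lerBlDr.
rewrite -[_ * x * y]mulrA -[X in _ - X]mulrA -mulrBl.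
apply: le_trans (ler_norm _) _; rewrite normrM.
have h : `|logistic_var t - logistic_var c'| <= `|x| + `|y|.
  apply: le_trans (logistic_var_lipschitz _ _) _; rewrite distrC.
  have -> : c' - t = (c' - c) + (c - t) by ring.
  by apply: le_trans (ler_normD _ _) _; exact: lerD.
apply: le_trans (ler_wpM2r _ h) _ => //.
rewrite normrM -(real_normK (num_real x)) -(real_normK (num_real y)).
by rewrite le_eqVlt; apply/orP; left; apply/eqP; ring.
Qed.

End Calculus.

(** * Integration and independence *)

Section Integration.
Context {d d' : measure_display} {T : measurableType d} {T' : measurableType d'}
  {R : realType} (mu : measure T R).
Implicit Types (Z : T -> T') (f : T' -> R) (G H : T -> R).

(** The values [y] are nonnegative anyway; the absolute value makes each summand visibly nonnegative
    for every real [y]. *)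
Lemma integral_nnsfun_comp Z G (s : {nnsfun T' >-> R}) :
  measurable_fun setT Z -> measurable_fun setT G -> (forall w, 0 <= G w) ->
  (\int[mu]_w (s (Z w) * G w)%:E =
   \sum_(y \in range s) `|y|%:E * \int[mu]_(w in Z @^-1` (s @^-1` [set y])) (G w)%:E)%E.
Proof.
move=> mZ mG G0.
have mpre y : measurable (Z @^-1` (s @^-1` [set y])).
  by rewrite -[X in measurable X]setTI; apply: mZ => //; exact: measurable_funPTI.
transitivity (\int[mu]_w (\sum_(y \in range s)
    (`|y| * (\1_(Z @^-1` (s @^-1` [set y])) w * G w))%:E))%E.
  apply: eq_integral => w _; rewrite (fimfunE s) mulr_fsuml -fsumEFin//.
  by apply: eq_fsbigr => y; rewrite inE => -[t _ <-]; rewrite ger0_norm// mulrA.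
rewrite ge0_integral_fsum//; last first.
- by move=> y w _; rewrite lee_fin !mulr_ge0.
- move=> y; apply/measurable_EFinP; apply: measurable_funM => //.
  by apply: measurable_funM => //; exact: measurable_indic.
apply: eq_fsbigr => y _.
under eq_integral do rewrite EFinM.
rewrite ge0_integralZl_EFin//; last first.
- by apply/measurable_EFinP; apply: measurable_funM => //; exact: measurable_indic.
- by move=> w _; rewrite lee_fin mulr_ge0.
rewrite [in RHS]integral_mkcond; congr (_ * _)%E.
by apply: eq_integral => w _; rewrite epatch_indic/= EFinM muleC.
Qed.

Lemma cvg_integral_nnsfun_comp Z G f (mf : measurable_fun setT (EFin \o f)) :
  measurable_fun setT Z -> measurable_fun setT G -> (forall w, 0 <= G w) ->
  (forall t, 0 <= f t) ->
  (\int[mu]_w (nnsfun_approx measurableT mf n (Z w) * G w)%:E)%E @[n --> \oo]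
   --> (\int[mu]_w (f (Z w) * G w)%:E)%E.
Proof.
move=> mZ mG G0 f0.
have lim w : (nnsfun_approx measurableT mf n (Z w) * G w)%:E @[n --> \oo]
    --> (f (Z w) * G w)%:E.
  rewrite EFinM; under eq_fun do rewrite EFinM.
  apply: cvgeZr => //; apply: (@cvg_nnsfun_approx _ _ _ _ measurableT _ mf) => //.
  by move=> t _; rewrite lee_fin.
rewrite (_ : integral _ _ _ =
  \int[mu]_w limn (fun n => (nnsfun_approx measurableT mf n (Z w) * G w)%:E))%E.
  apply: cvg_monotone_convergence => //.
  - move=> n; apply/measurable_EFinP; apply: measurable_funM => //.
    exact: measurableT_comp.
  - by move=> n w _; rewrite lee_fin mulr_ge0.
  - move=> w _ n m nm; rewrite lee_fin ler_wpM2r//.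
    by have /lefP/(_ (Z w)) := nd_nnsfun_approx measurableT mf nm.
by apply: eq_integral => w _; apply/esym/cvg_lim => //; exact: lim.
Qed.

(* Two nonnegative densities with the same integrals over the sigma-algebra
   generated by Z have the same conditional expectation given Z. *)
Lemma eq_integral_comp Z G H f :
  measurable_fun setT Z -> measurable_fun setT G -> measurable_fun setT H ->
  measurable_fun setT f ->
  (forall w, 0 <= G w) -> (forall w, 0 <= H w) -> (forall t, 0 <= f t) ->
  (forall B, measurable B ->
    \int[mu]_(w in Z @^-1` B) (G w)%:E = \int[mu]_(w in Z @^-1` B) (H w)%:E)%E ->
  (\int[mu]_w (f (Z w) * G w)%:E = \int[mu]_w (f (Z w) * H w)%:E)%E.
Proof.
move=> mZ mG mH mf G0 H0 f0 GH.
have mf' : measurable_fun setT (EFin \o f) by exact/measurable_EFinP.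
have cG := cvg_integral_nnsfun_comp mf' mZ mG G0 f0.
have cH := cvg_integral_nnsfun_comp mf' mZ mH H0 f0.
rewrite -(cvg_lim _ cG)// -(cvg_lim _ cH)//.
congr (limn _); apply/funext => n; rewrite !integral_nnsfun_comp//.
by apply: eq_fsbigr => y _; rewrite GH//; exact: measurable_funPTI.
Qed.

End Integration.

(** * Expectations of almost surely bounded variables *)

Section BoundedFun.
Context {d : measure_display} {T : measurableType d} {R : realType}
  (P : probability T R).
Implicit Types (f g : T -> R).

(** The covariates are bounded only almost surely. This class is closed under sums, products and
    exponentials, and its members are integrable, so expectations can be computed in the reals. *)
Definition ess_bounded f :=
  measurable_fun setT f /\ exists M : R, {ae P, forall w, `|f w| <= M}.

Definition expect f : R := (\int[P]_w f w)%R.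

Lemma ess_bounded_integrable f : ess_bounded f -> P.-integrable setT (EFin \o f).
Proof.
move=> [mf [M fM]]; apply/integrableP; split; first exact/measurable_EFinP.
apply: (@le_lt_trans _ _ (\int[P]_w (`|M|)%:E)%E).
  apply: ae_ge0_le_integral => //.
  - by apply: measurableT_comp => //; exact/measurable_EFinP.
  - apply: filterS fM => w fwM _; rewrite lee_fin.
    exact: le_trans fwM (ler_norm _).
rewrite integral_cst// [X in (_ * X)%E](_ : _ = 1%E) ?mule1 ?ltry//.
exact: probability_setT.
Qed.

Lemma expectE f : ess_bounded f -> (expect f)%:E = (\int[P]_w (f w)%:E)%E.
Proof.
move=> bf; rewrite /expect /Rintegral fineK//.
by apply: integrable_fin_num => //; exact: ess_bounded_integrable.
Qed.

Lemma ess_bounded_cst (c : R) : ess_bounded (fun=> c).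
Proof. by split => //; exists `|c|; apply: aeW => w /=. Qed.

Lemma ess_boundedD f g : ess_bounded f -> ess_bounded g ->
  ess_bounded (fun w => f w + g w).
Proof.
move=> [mf [M fM]] [mg [N gN]]; split; first exact: measurable_funD.
exists (M + N); apply: filterS2 fM gN => w h1 h2.
by apply: le_trans (ler_normD _ _) _; exact: lerD.
Qed.

Lemma ess_boundedM f g : ess_bounded f -> ess_bounded g ->
  ess_bounded (fun w => f w * g w).
Proof.
move=> [mf [M fM]] [mg [N gN]]; split; first exact: measurable_funM.
exists (M * N); apply: filterS2 fM gN => w h1 h2.
by rewrite normrM; exact: ler_pM.
Qed.

Lemma ess_boundedN f : ess_bounded f -> ess_bounded (fun w => - f w).
Proof.
move=> bf; rewrite (_ : (fun w => _) = (fun w => -1 * f w)).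
  by apply: ess_boundedM => //; exact: ess_bounded_cst.
by apply/funext => w; rewrite mulN1r.
Qed.

Lemma ess_bounded_exp f k : ess_bounded f -> ess_bounded (fun w => f w ^+ k).
Proof.
move=> bf; elim: k => [|k IH]; first exact: ess_bounded_cst.
under eq_fun do rewrite exprS.
exact: ess_boundedM.
Qed.

Lemma ess_bounded_norm f : ess_bounded f -> ess_bounded (fun w => `|f w|).
Proof.
move=> [mf [M fM]]; split; first exact: measurableT_comp.
by exists M; apply: filterS fM => w; rewrite normr_id.
Qed.

Lemma ess_bounded_expR f : ess_bounded f -> ess_bounded (fun w => expR (f w)).
Proof.
move=> [mf [M fM]]; split; first exact: measurableT_comp.
exists (expR M); apply: filterS fM => w fwM.
by rewrite ger0_norm ?expR_ge0// ler_expR; exact: le_trans (ler_norm _) fwM.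
Qed.

Lemma ess_bounded_sum (I : Type) (s : seq I) (F : I -> T -> R) :
  (forall i, ess_bounded (F i)) -> ess_bounded (fun w => \sum_(i <- s) F i w).
Proof.
move=> bF; elim: s => [|i s IH].
  by under eq_fun do rewrite big_nil; exact: ess_bounded_cst.
under eq_fun do rewrite big_cons.
exact: ess_boundedD.
Qed.

Lemma expectD f g : ess_bounded f -> ess_bounded g ->
  expect (fun w => f w + g w) = expect f + expect g.
Proof. by move=> bf bg; rewrite /expect RintegralD//; exact: ess_bounded_integrable. Qed.

Lemma expect_cst (c : R) : expect (fun=> c) = c.
Proof.
apply/EFin_inj; rewrite expectE; last exact: ess_bounded_cst.
rewrite integral_cst// [X in (_ * X)%E](_ : _ = 1%E) ?mule1//.
exact: probability_setT.
Qed.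

Lemma expectZ (c : R) f : ess_bounded f -> expect (fun w => c * f w) = c * expect f.
Proof. by move=> bf; rewrite /expect RintegralZl//; exact: ess_bounded_integrable. Qed.

Lemma expect_sum (I : Type) (s : seq I) (F : I -> T -> R) :
  (forall i, ess_bounded (F i)) ->
  expect (fun w => \sum_(i <- s) F i w) = \sum_(i <- s) expect (F i).
Proof.
move=> bF; elim: s => [|i s IH].
  by under eq_fun do rewrite big_nil; rewrite big_nil expect_cst.
under eq_fun do rewrite big_cons.
by rewrite expectD ?big_cons ?IH//; exact: ess_bounded_sum.
Qed.

Lemma le_expect f g : ess_bounded f -> ess_bounded g ->
  {ae P, forall w, f w <= g w} -> expect f <= expect g.
Proof.
move=> bf bg fg; rewrite -subr_ge0.
have bgf : ess_bounded (fun w => g w - f w).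
  by apply: ess_boundedD => //; exact: ess_boundedN.
have -> : expect g - expect f = expect (fun w => g w - f w).
  rewrite expectD//; last exact: ess_boundedN.
  by rewrite -[- expect f]mulN1r -expectZ//; congr (_ + expect _);
     apply/funext => w; rewrite mulN1r.
have b0 := ess_bounded_cst 0.
rewrite -lee_fin expectE//.
(* The difference is nonnegative only almost everywhere; its positive part is nonnegative everywhere
   and has the same integral. *)
apply: (@le_trans _ _ (\int[P]_w (Num.max 0 (g w - f w))%:E)%E).
  by apply: integral_ge0 => w _; rewrite lee_fin le_max lexx.
rewrite le_eqVlt; apply/orP; left; apply/eqP.
apply: ae_eq_integral => //.
- by apply/measurable_EFinP; apply: measurable_maxr => //; case: bgf.
- by apply/measurable_EFinP; case: bgf.
- by apply: filterS fg => w fgw _; congr EFin; rewrite max_r// subr_ge0.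
Qed.

End BoundedFun.

(** * Independence, Chernoff bounds and conditioning on the covariates *)

Section Independence.
Context {d d' : measure_display} {T : measurableType d} {T' : measurableType d'}
  {R : realType} (P : probability T R).

Lemma measurable_indic_comp (B : set T') (Z : {RV P >-> T'}) :
  measurable B -> measurable_fun setT (fun w => \1_B (Z w) : R).
Proof. by move=> mB; apply: measurableT_comp; [exact: measurable_indic|]. Qed.

(** Independence speaks of indicators only, so these are exchanged for the functions [f i] one index
    at a time. The induction hypothesis, used with an arbitrary event at index [i0], says that the
    product of the other factors integrates over events of [Z i0] like a constant;
    [eq_integral_comp] extends this from indicators to [f i0]. *)
Lemma independent_integral_prod (n : nat) (Z : 'I_n -> {RV P >-> T'})
    (f : 'I_n -> T' -> R) (c : 'I_n -> R) :
  mutually_independent Z -> (forall i, measurable_fun setT (f i)) ->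
  (forall i t, 0 <= f i t) ->
  (forall i, \int[P]_w (f i (Z i w))%:E = (c i)%:E)%E ->
  (\int[P]_w (\prod_i f i (Z i w))%:E = (\prod_i c i)%:E)%E.
Proof.
move=> indZ mf f0 fc.
pose g k (B : 'I_n -> set T') (i : 'I_n) := if (i < k)%N then f i else (\1_(B i) : T' -> R).
pose m k (B : 'I_n -> set T') (i : 'I_n) :=
  if (i < k)%N then c i else fine (P (Z i @^-1` B i)).
have mpre i B : measurable B -> measurable (Z i @^-1` B).
  exact: measurable_funPTI.
have Pfin i B : measurable B -> (fine (P (Z i @^-1` B)))%:E = P (Z i @^-1` B).
  by move=> mB; rewrite fineK// fin_num_measure//; exact: mpre.
have c0 i : 0 <= c i.
  by rewrite -lee_fin -fc integral_ge0// => w _; rewrite lee_fin.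
have m0 k B i : 0 <= m k B i by rewrite /m; case: ifP => // _; rewrite fine_ge0.
have g0 k B i t : 0 <= g k B i t by rewrite /g; case: ifP.
have mg k B i : measurable (B i) -> measurable_fun setT (fun w => g k B i (Z i w)).
  move=> mB; rewrite /g; case: ifP => _; last exact: measurable_indic_comp.
  exact: measurableT_comp.
have mprod k B (Q : pred 'I_n) : (forall i, measurable (B i)) ->
    measurable_fun setT (fun w => \prod_(i | Q i) g k B i (Z i w)).
  move=> mB; under eq_fun do rewrite -big_filter.
  by apply: measurable_prod => i _; exact: mg.
suff H k : (k <= n)%N -> forall B, (forall i, measurable (B i)) ->
    (\int[P]_w (\prod_i g k B i (Z i w))%:E = (\prod_i m k B i)%:E)%E.
  have := H n (leqnn _) (fun=> setT) (fun=> measurableT).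
  rewrite /g /m; under eq_integral do under eq_bigr do rewrite ltn_ord.
  by under [X in _ = X%:E -> _]eq_bigr do rewrite ltn_ord.
elim: k => [_ B mB|k IH kn B mB].
  have -> : (\prod_i m 0 B i)%:E = (\prod_(i in (finset.setT : {set 'I_n})) P (Z i @^-1` B i))%E.
    rewrite -prodEFin; apply: eq_big => [i|i _]; first by rewrite finset.in_setT.
    by rewrite /m ltn0 Pfin.
  rewrite -(indZ finset.setT B mB) -[X in P X]setIT -integral_indic//; last first.
    by apply: fin_bigcap_measurable => [|i _]; [exact: finite_finset|exact: mpre].
  apply: eq_integral => w _; congr EFin.
  rewrite indicE /g; have [|] := boolP (w \in _).
    rewrite inE => wB; rewrite big1// => i _; rewrite ?ltn0 indicE mem_set//.
    by apply: wB => /=; rewrite finset.in_setT.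
  move=> /negP wB; have [i wi] : exists i, Z i w \notin B i.
    apply/existsP; rewrite -negb_forall; apply/negP => /forallP wB'; apply: wB.
    by rewrite inE => i _ /=; have := wB' i; rewrite inE.
  by rewrite (bigD1 i)//= ?ltn0 indicE (negbTE wi) mul0r.
pose i0 := Ordinal kn.
pose G w := \prod_(i | i != i0) g k B i (Z i w).
pose C := \prod_(i | i != i0) m k B i.
have C0 : 0 <= C by apply: prodr_ge0.
have G0 w : 0 <= G w by apply: prodr_ge0.
have upd i : i != i0 -> (i < k.+1)%N = (i < k)%N.
  by rewrite ltnS leq_eqVlt => /negbTE; rewrite -val_eqE /= => ->.
have key : (\int[P]_w (f i0 (Z i0 w) * G w)%:E =
            \int[P]_w (f i0 (Z i0 w) * C)%:E)%E.
  apply: (@eq_integral_comp _ _ _ _ _ P (Z i0) G (fun=> C)) => //.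
    exact: mprod.
  move=> A mA; pose B' i := if i == i0 then A else B i.
  have mB' i : measurable (B' i) by rewrite /B'; case: ifP.
  have mk0 : m k B' i0 = fine (P (Z i0 @^-1` A)) by rewrite /m ltnn /B' eqxx.
  have gk0 w : g k B' i0 (Z i0 w) = \1_A (Z i0 w) by rewrite /g ltnn /B' eqxx.
  have := IH (ltnW kn) B' mB'.
  rewrite (bigD1 i0)//= mk0.
  rewrite (eq_bigr (m k B)); last by move=> i /negbTE ii; rewrite /m /B' ii.
  rewrite -/C => e; rewrite integral_cst//; last exact: mpre.
  rewrite muleC [X in (X * _)%E](_ : _ = (fine (P (Z i0 @^-1` A)))%:E); last first.
    by rewrite Pfin.
  rewrite -EFinM -e [LHS]integral_mkcond.
  apply: eq_integral => w _; rewrite [in RHS](bigD1 i0)//= gk0.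
  rewrite epatch_indic/= EFinM muleC; congr (_ * _%:E)%E.
  by apply: eq_bigr => i /negbTE ii; rewrite /g /B' ii.
transitivity (\int[P]_w (f i0 (Z i0 w) * G w)%:E)%E.
  apply: eq_integral => w _; rewrite (bigD1 i0)//=; congr (_ * _)%:E; first by rewrite /g ltnSn.
  by apply: eq_bigr => i ii; rewrite /g upd.
have mk1 : m k.+1 B i0 = c i0 by rewrite /m ltnSn.
rewrite key (bigD1 i0)//= mk1.
rewrite (eq_bigr (m k B)); last by move=> i ii; rewrite /m upd.
rewrite -/C EFinM -fc muleC -ge0_integralZl_EFin//; last first.
- by apply/measurable_EFinP; exact: measurableT_comp.
- by move=> w _; rewrite lee_fin.
by apply: eq_integral => w _; rewrite EFinM muleC.
Qed.

Lemma identically_distributed_integral (n : nat) (Z : 'I_n -> {RV P >-> T'})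
    (f : T' -> R) i k :
  identically_distributed Z -> measurable_fun setT f -> (forall t, 0 <= f t) ->
  (\int[P]_w (f (Z i w))%:E = \int[P]_w (f (Z k w))%:E)%E.
Proof.
move=> idZ mf f0.
have pf j : (\int[P]_w (f (Z j w))%:E = \int[distribution P (Z j)]_t (f t)%:E)%E.
  rewrite ge0_integral_pushforward//; first exact/measurable_EFinP.
  by move=> t _; rewrite lee_fin.
by rewrite !pf; apply: eq_measure_integral => A mA _; exact: idZ.
Qed.

(** Markov's inequality for the exponential of the sum. The moment is assumed at one index [i0] only
    and transported to the others by identical distribution. *)
Lemma iid_chernoff (n : nat) (Z : 'I_n -> {RV P >-> T'}) (i0 : 'I_n)
    (g : T' -> R) (M t : R) :
  iid Z -> measurable_fun setT g ->
  (\int[P]_w (expR (g (Z i0 w)))%:E <= M%:E)%E ->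
  (P [set w | t <= \sum_i g (Z i w)]%R <= (M ^+ n * expR (- t))%:E)%E.
Proof.
move=> [indZ idZ] mg gM.
have meg : measurable_fun setT (fun s => expR (g s)) by exact: measurableT_comp.
have e0 (i : 'I_n) s : 0 <= expR (g s) by exact: expR_ge0.
pose c := fine (\int[P]_w (expR (g (Z i0 w)))%:E).
have I0 : (0 <= \int[P]_w (expR (g (Z i0 w)))%:E)%E.
  by apply: integral_ge0 => w _; rewrite lee_fin expR_ge0.
have cE i : (\int[P]_w (expR (g (Z i w)))%:E = c%:E)%E.
  rewrite (@identically_distributed_integral n Z (fun s => expR (g s)) i i0)// fineK//.
  by rewrite ge0_fin_numE ?(le_lt_trans gM) ?ltry.
have c0 : 0 <= c by rewrite fine_ge0.
have msum : measurable_fun setT (fun w => \sum_i g (Z i w)).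
  by apply: measurable_sum => i; exact: measurableT_comp.
set A := [set w | _].
have mA : measurable A.
  rewrite (_ : A = (fun w => \sum_i g (Z i w)) @^-1` `[t, +oo[%classic).
    by rewrite -[X in measurable X]setTI; apply: msum.
  by apply/seteqP; split=> w /=; rewrite /A/= in_itv/= andbT.
rewrite -[A]setIT -integral_indic//.
apply: (@le_trans _ _ (\int[P]_w ((expR (- t))%:E * (\prod_i expR (g (Z i w)))%:E))%E).
  apply: ge0_le_integral => //.
  - by apply/measurable_EFinP; exact: measurable_indic.
  - apply: measurable_funeM; apply/measurable_EFinP.
    by apply: measurable_prod => i _; exact: (measurableT_comp meg).
  - move=> w _; rewrite -EFinM lee_fin -expR_sum -expRD indicE.
    have [wA|_] := boolP (w \in A); last by rewrite expR_ge0.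
    by rewrite -expR0 ler_expR addrC subr_ge0; move: wA; rewrite inE.
rewrite ge0_integralZl_EFin ?expR_ge0//; last first.
- apply/measurable_EFinP.
  by apply: measurable_prod => i _; exact: (measurableT_comp meg).
- by move=> w _; rewrite lee_fin prodr_ge0// => i _; exact: expR_ge0.
rewrite (@independent_integral_prod n Z (fun _ s => expR (g s)) (fun=> c))//.
rewrite -EFinM lee_fin mulrC ler_wpM2r ?expR_ge0// prodr_const card_ord.
have cM : c <= M by rewrite -lee_fin -(cE i0).
by rewrite lerXn2r ?nnegrE// (le_trans c0).
Qed.

(** Over events of the covariates, the indicator of Y = 1 integrates like h (X) and that of Y = 0
    like 1 - h (X), so [eq_integral_comp] may exchange them. *)
Lemma cond_prob1_integral (Z : {RV P >-> (T' * bool)%type}) (h : T' -> R)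
    (F : T' * bool -> R) :
  cond_prob1 Z h -> (forall t, 0 < h t < 1) ->
  (forall b, measurable_fun setT (fun t => F (t, b))) -> (forall t, 0 <= F t) ->
  (\int[P]_w (F (Z w))%:E = \int[P]_w
    (F ((Z w).1, true) * h (Z w).1 + F ((Z w).1, false) * (1 - h (Z w).1))%:E)%E.
Proof.
move=> [mh hB] h01 mF F0.
pose X w := (Z w).1.
have mX : measurable_fun setT X by exact: measurableT_comp.
have mY : measurable_fun setT (fun w => (Z w).2) by exact: measurableT_comp.
pose A := [set w | (Z w).2].
have mA : measurable A.
  rewrite (_ : A = (fun w => (Z w).2) @^-1` [set true]).
    by rewrite -[X in measurable X]setTI; apply: mY => //; exact: measurable_set1.
  by apply/seteqP; split => w.
have mpre B : measurable B -> measurable (X @^-1` B).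
  by move=> mB; rewrite -[X in measurable X]setTI; exact: mX.
have h0 t : 0 <= h t by have /andP[/ltW] := h01 t.
have h1 t : 0 <= 1 - h t by rewrite subr_ge0; have /andP[_ /ltW] := h01 t.
have mhX : measurable_fun setT (fun w => h (X w)) by exact: measurableT_comp.
have mh1X : measurable_fun setT (fun w => 1 - h (X w)) by exact: measurable_funB.
have mA1 : measurable_fun setT (\1_A : T -> R) by exact: measurable_indic.
have mAC : measurable_fun setT (\1_(~` A) : T -> R).
  by apply: measurable_indic; exact: measurableC.
have eT B : measurable B ->
    (\int[P]_(w in X @^-1` B) (\1_A w)%:E = \int[P]_(w in X @^-1` B) (h (X w))%:E)%E.
  move=> mB; rewrite integral_indic//; last exact: mpre.
  by rewrite -hB// setIC.
have addI (u v : T -> R) D : measurable D -> measurable_fun setT u ->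
    measurable_fun setT v -> (forall w, 0 <= u w) -> (forall w, 0 <= v w) ->
    (\int[P]_(w in D) (u w + v w)%:E =
     \int[P]_(w in D) (u w)%:E + \int[P]_(w in D) (v w)%:E)%E.
  move=> mD mu mv u0 v0; under eq_integral do rewrite EFinD.
  apply: ge0_integralD => //.
  - by move=> w _; rewrite lee_fin.
  - by apply: measurable_funTS; apply/measurable_EFinP.
  - by move=> w _; rewrite lee_fin.
  - by apply: measurable_funTS; apply/measurable_EFinP.
have eF B : measurable B -> (\int[P]_(w in X @^-1` B) (\1_(~` A) w)%:E =
    \int[P]_(w in X @^-1` B) (1 - h (X w))%:E)%E.
  move=> mB; have mXB := mpre _ mB.
  have fin1 : (\int[P]_(w in X @^-1` B) (h (X w))%:E)%E \is a fin_num.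
    by rewrite -eT// integral_indic// fin_num_measure//; exact: measurableI.
  (* Adding the finite integral of h (X) to both sides turns both integrands into the constant 1. *)
  rewrite -[LHS](addeK _ fin1) -[RHS](addeK _ fin1); congr (_ - _)%E.
  rewrite -{1}eT// -!addI//.
  apply: eq_integral => w _; congr EFin.
  rewrite !indicE in_setC subrK.
  by case: (w \in A); rewrite ?addr0 ?add0r.
transitivity (\int[P]_w (F (X w, true) * \1_A w + F (X w, false) * \1_(~` A) w)%:E)%E.
  apply: eq_integral => w _; rewrite !indicE in_setC /X.
  case Zw : (Z w) => [x []] /=.
    by rewrite mem_set ?mulr1 ?mulr0 ?addr0// /A/= Zw.
  by rewrite memNset ?mulr1 ?mulr0 ?add0r// /A/= Zw.
have mFX b : measurable_fun setT (fun w => F (X w, b)).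
  by apply: (measurableT_comp (mF b)).
rewrite !addI//.
- by rewrite (eq_integral_comp mX mA1 mhX (mF true))//
             (eq_integral_comp mX mAC mh1X (mF false)).
- exact: measurable_funM.
- exact: measurable_funM.
- by move=> w; rewrite mulr_ge0.
- by move=> w; rewrite mulr_ge0.
- exact: measurable_funM.
- exact: measurable_funM.
- by move=> w; rewrite mulr_ge0.
- by move=> w; rewrite mulr_ge0.
Qed.

End Independence.

(** * Sparse vectors and bilinear forms *)

Section VectorLemmas.
Context {R : realType} {p : nat}.
Implicit Types (u v : 'rV[R]_p) (x : p.-tuple R) (J : {set 'I_p}).

Lemma dotD x u v : dot x (u + v) = dot x u + dot x v.
Proof. by rewrite /dot -big_split; apply: eq_bigr => j _; rewrite mxE mulrDr. Qed.

Lemma dotZ x (c : R) u : dot x (c *: u) = c * dot x u.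
Proof. by rewrite /dot mulr_sumr; apply: eq_bigr => j _; rewrite mxE mulrCA. Qed.

Lemma dot0 x : dot x 0 = 0.
Proof. by rewrite /dot big1// => j _; rewrite mxE mulr0. Qed.

Lemma in_supp u j : (j \in supp u) = (u ord0 j != 0).
Proof. by rewrite finset.inE. Qed.

Lemma supp_subP u J : reflect (coord_space J u) (supp u \subset J).
Proof.
apply: (iffP fintype.subsetP) => uJ j.
  by apply: contraNeq => uj; apply: uJ; rewrite in_supp.
by rewrite in_supp; apply: contraNT => /uJ ->.
Qed.

Lemma coord_spaceD J u v :
  coord_space J u -> coord_space J v -> coord_space J (u + v).
Proof. by move=> uJ vJ j jJ; rewrite mxE uJ ?vJ ?addr0. Qed.

Lemma coord_spaceN J u : coord_space J u -> coord_space J (- u).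
Proof. by move=> uJ j jJ; rewrite mxE uJ ?oppr0. Qed.

Lemma coord_spaceZ J (c : R) u : coord_space J u -> coord_space J (c *: u).
Proof. by move=> uJ j jJ; rewrite mxE uJ ?mulr0. Qed.

Lemma coord_spaceS (J K : {set 'I_p}) u :
  J \subset K -> coord_space J u -> coord_space K u.
Proof. by move=> JK uJ j jK; apply: uJ; apply: contraNN jK => /(fintype.subsetP JK). Qed.

Lemma coord_space_sum J (I : Type) (s : seq I) (Q : pred I) (F : I -> 'rV[R]_p) :
  (forall i, Q i -> coord_space J (F i)) -> coord_space J (\sum_(i <- s | Q i) F i).
Proof.
move=> FJ j jJ; rewrite summxE big1// => i Qi.
by rewrite FJ.
Qed.

Lemma coord_space_supp u : coord_space (supp u) u.
Proof. exact/supp_subP. Qed.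

Lemma coord_space_sparse J u k : (#|J| <= k)%N -> coord_space J u -> sparse k u.
Proof. by move=> Jk /supp_subP/subset_leq_card uJ; exact: leq_trans Jk. Qed.

Definition sqnorm u : R := \sum_j u ord0 j ^+ 2.
Definition norm1 u : R := \sum_j `|u ord0 j|.

Lemma sqnorm_ge0 u : 0 <= sqnorm u.
Proof. by apply: sumr_ge0 => j _; exact: sqr_ge0. Qed.

Lemma norm2_sqr u : norm2 u ^+ 2 = sqnorm u.
Proof. by rewrite sqr_sqrtr ?sqnorm_ge0. Qed.

Lemma norm2_ge0 u : 0 <= norm2 u.
Proof. exact: sqrtr_ge0. Qed.

Lemma sqnormZ (c : R) u : sqnorm (c *: u) = c ^+ 2 * sqnorm u.
Proof. by rewrite /sqnorm mulr_sumr; apply: eq_bigr => j _; rewrite mxE exprMn. Qed.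

Lemma norm2Z (c : R) u : norm2 (c *: u) = `|c| * norm2 u.
Proof.
rewrite /norm2 -/(sqnorm _) -/(sqnorm u) sqnormZ sqrtrM ?sqr_ge0//.
by rewrite sqrtr_sqr.
Qed.

Lemma sqnorm_eq0 u : sqnorm u = 0 -> u = 0.
Proof.
move=> /eqP; rewrite psumr_eq0 => [/allP u0|j _]; last exact: sqr_ge0.
apply/rowP => j; rewrite mxE; apply/eqP.
by have := u0 j; rewrite mem_index_enum sqrf_eq0 => /(_ isT).
Qed.

Lemma le_sqnorm u j : u ord0 j ^+ 2 <= sqnorm u.
Proof.
by rewrite /sqnorm (bigD1 j)//= lerDl sumr_ge0// => i _; exact: sqr_ge0.
Qed.

Lemma sqnormD_le u v : sqnorm (u + v) <= 2 * sqnorm u + 2 * sqnorm v.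
Proof.
rewrite /sqnorm !mulr_sumr -big_split; apply: ler_sum => j _; rewrite mxE/=.
by rewrite -subr_ge0 (_ : _ - _ = (u ord0 j - v ord0 j) ^+ 2) ?sqr_ge0//; ring.
Qed.

(** Cauchy-Schwarz on the support, by expanding the square and bounding each product by the mean of
    two squares. *)
Lemma norm1_sqr u k : sparse k u -> norm1 u ^+ 2 <= k%:R * sqnorm u.
Proof.
move=> uk.
have -> : norm1 u = \sum_(j in supp u) `|u ord0 j|.
  rewrite /norm1 (bigID (mem (supp u)))/= [X in _ + X]big1 ?addr0// => j.
  by rewrite in_supp negbK => /eqP ->; rewrite normr0.
have le2 (a b : R) : a * b <= (a ^+ 2 + b ^+ 2) / 2.
  rewrite -subr_ge0 (_ : _ - _ = (a - b) ^+ 2 / 2); last by field.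
  by rewrite divr_ge0 ?sqr_ge0.
rewrite expr2 mulr_suml.
apply: (@le_trans _ _ (\sum_(i in supp u) \sum_(j in supp u)
    (u ord0 i ^+ 2 + u ord0 j ^+ 2) / 2)).
  apply: ler_sum => i _; rewrite mulr_sumr; apply: ler_sum => j _.
  by apply: le_trans (le2 _ _) _; rewrite !real_normK ?num_real.
set s := \sum_(i in supp u) u ord0 i ^+ 2.
have s0 : 0 <= s by apply: sumr_ge0 => i _; exact: sqr_ge0.
have ss : s <= sqnorm u.
  rewrite /sqnorm (bigID (mem (supp u)))/= lerDl sumr_ge0// => i _.
  exact: sqr_ge0.
under eq_bigr => i _ do rewrite -mulr_suml big_split/= sumr_const -(mulr_natl _ #|supp u|).
rewrite -mulr_suml big_split/= -mulr_sumr sumr_const -(mulr_natl _ #|supp u|) -/s.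
rewrite (_ : _ / 2 = #|supp u|%:R * s); last by field.
apply: ler_pM => //.
by rewrite ler_nat.
Qed.

Lemma dot_norm1 x u (a : R) :
  (forall j, `|tnth x j| <= a) -> `|dot x u| <= a * norm1 u.
Proof.
move=> xa; rewrite /dot /norm1 mulr_sumr; apply: le_trans (ler_norm_sum _ _ _) _.
by apply: ler_sum => j _; rewrite normrM ler_wpM2r.
Qed.

Lemma dot_sqr_sparse x u (a : R) k : sparse k u ->
  (forall j, `|tnth x j| <= a) -> dot x u ^+ 2 <= a ^+ 2 * k%:R * sqnorm u.
Proof.
move=> uk xa; rewrite -(real_normK (num_real (dot x u))).
apply: (@le_trans _ _ ((a * norm1 u) ^+ 2)).
  rewrite lerXn2r ?nnegrE ?normr_ge0//; last exact: dot_norm1.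
  exact: le_trans (dot_norm1 _ xa).
by rewrite exprMn -mulrA ler_wpM2l ?sqr_ge0// norm1_sqr.
Qed.

Definition bilin (G : 'I_p -> 'I_p -> R) u v : R :=
  \sum_i \sum_j G i j * u ord0 i * v ord0 j.

Lemma bilinDl G u u' v : bilin G (u + u') v = bilin G u v + bilin G u' v.
Proof.
rewrite /bilin -big_split; apply: eq_bigr => i _; rewrite -big_split/=.
by apply: eq_bigr => j _; rewrite mxE; ring.
Qed.

Lemma bilinDr G u v v' : bilin G u (v + v') = bilin G u v + bilin G u v'.
Proof.
rewrite /bilin -big_split; apply: eq_bigr => i _; rewrite -big_split/=.
by apply: eq_bigr => j _; rewrite mxE; ring.
Qed.

Lemma bilinZl G (c : R) u v : bilin G (c *: u) v = c * bilin G u v.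
Proof.
rewrite /bilin mulr_sumr; apply: eq_bigr => i _; rewrite mulr_sumr.
by apply: eq_bigr => j _; rewrite mxE; ring.
Qed.

Lemma bilinC G u v : (forall i j, G i j = G j i) -> bilin G u v = bilin G v u.
Proof.
move=> GC; rewrite /bilin exchange_big; apply: eq_bigr => i _.
by apply: eq_bigr => j _; rewrite GC; ring.
Qed.

Lemma bilinB G H u v :
  bilin (fun i j => G i j - H i j) u v = bilin G u v - bilin H u v.
Proof.
rewrite /bilin -sumrB; apply: eq_bigr => i _; rewrite -sumrB.
by apply: eq_bigr => j _; ring.
Qed.

Lemma bilin_norm1 G u v (a : R) : (forall i j, `|G i j| <= a) ->
  `|bilin G u v| <= a * norm1 u * norm1 v.
Proof.
move=> Ga; rewrite /bilin /norm1 -mulrA mulr_suml mulr_sumr.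
apply: le_trans (ler_norm_sum _ _ _) _; apply: ler_sum => i _.
rewrite mulr_sumr mulr_sumr; apply: le_trans (ler_norm_sum _ _ _) _.
apply: ler_sum => j _; by rewrite !normrM -mulrA ler_wpM2r.
Qed.

Lemma bilin_dot x u v (c : R) :
  c * dot x u * dot x v = bilin (fun i j => c * tnth x i * tnth x j) u v.
Proof.
rewrite /dot /bilin -mulrA mulr_suml mulr_sumr; apply: eq_bigr => i _.
rewrite !mulr_sumr; apply: eq_bigr => j _; ring.
Qed.

Lemma bilin_sum (I : Type) (s : seq I) (F : I -> 'I_p -> 'I_p -> R) u v :
  bilin (fun i j => \sum_(k <- s) F k i j) u v = \sum_(k <- s) bilin (F k) u v.
Proof.
elim: s => [|k s IH].
  by rewrite big_nil /bilin big1// => i _; rewrite big1// => j _;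
     rewrite big_nil !mul0r.
rewrite big_cons -IH /bilin -big_split; apply: eq_bigr => i _.
rewrite -big_split/=; apply: eq_bigr => j _; rewrite big_cons; ring.
Qed.

End VectorLemmas.

(** * Log-likelihood ratios of one observation *)

Section LogLikelihoodRatio.
Context {R : realType}.

Lemma expR_cumulant (t : R) : expR (cumulant t) = 1 + expR t.
Proof. by rewrite /cumulant lnK// posrE expRD1_gt0. Qed.

Definition llr {p : nat} (beta0 v : 'rV[R]_p) (z : p.-tuple R * bool) : R :=
  z.2%:R * dot z.1 v - (cumulant (dot z.1 beta0 + dot z.1 v) - cumulant (dot z.1 beta0)).

Lemma loglik_llr (n p : nat) (D : 'I_n -> p.-tuple R * bool) (beta0 v : 'rV[R]_p) :
  loglik D (beta0 + v) = loglik D beta0 + \sum_i llr beta0 v (D i).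
Proof.
rewrite /loglik -big_split; apply: eq_bigr => i _/=; rewrite /llr !dotD; ring.
Qed.

(** The two terms are the Bernoulli probabilities at parameter [t + s]: weighting by the likelihood
    ratio changes [sigmoid t] into [sigmoid (t + s)]. *)
Lemma llr_mean1 (t s : R) :
  expR (s - (cumulant (t + s) - cumulant t)) * sigmoid t +
  expR (- (cumulant (t + s) - cumulant t)) * (1 - sigmoid t) = 1.
Proof.
rewrite sigmoidC /sigmoid opprB [s + _]addrA !expRB !expRD !expR_cumulant expRD.
have e : 1 + expR t * expR s != 0 by rewrite -expRD expRD1_neq0.
by field; rewrite e expRD1_neq0.
Qed.

(** The factor 4 is the square of 2, since 1 + exp t is at most twice the larger of its terms. *)
Lemma logistic_var_lower (t : R) : expR (- `|t|) / 4 <= logistic_var t.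
Proof.
have E0 : 0 < expR t by exact: expR_gt0.
rewrite /logistic_var sigmoidC /sigmoid -mulrA -invfM.
rewrite ler_pdivlMr; last by rewrite mulr_gt0 ?expRD1_gt0.
have [t0|t0] := leP 0 t.
  rewrite ger0_norm// expRN.
  have t1 : 1 <= expR t by rewrite -expR0 ler_expR.
  rewrite [leLHS](_ : _ = (1 + expR t) ^+ 2 / (4 * expR t)); last first.
    by field; rewrite gt_eqF.
  rewrite ler_pdivrMr; nra.
have t1 : expR t <= 1 by rewrite -expR0 ler_expR ltW.
rewrite ltr0_norm// opprK; nra.
Qed.

(* The Hellinger affinity [rho] of two Bernoulli laws satisfies
   [rho <= (1 + rho^2) / 2], and [1 - rho^2] is explicit for logistic laws. *)
Lemma llr_half_mean (t s : R) : `|s| <= 2^-1 ->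
  expR (2^-1 * (s - (cumulant (t + s) - cumulant t))) * sigmoid t +
  expR (2^-1 * (- (cumulant (t + s) - cumulant t))) * (1 - sigmoid t) <=
  1 - expR (- `|t|) * s ^+ 2 / 256.
Proof.
move=> s2.
set u := expR (2^-1 * cumulant t); set v := expR (2^-1 * cumulant (t + s)).
set e := expR (2^-1 * s).
have sq x : expR (2^-1 * x) ^+ 2 = expR x :> R.
  by rewrite -expRM_natl; congr expR; field.
have u2 : u ^+ 2 = 1 + expR t by rewrite sq expR_cumulant.
have e2 : e ^+ 2 = expR s by rewrite sq.
have v2 : v ^+ 2 = 1 + expR t * e ^+ 2 by rewrite sq expR_cumulant expRD e2.
have u0 : 0 < u by exact: expR_gt0.
have v0 : 0 < v by exact: expR_gt0.
have e0 : 0 < e by exact: expR_gt0.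
have E0 : 0 < expR t by exact: expR_gt0.
rewrite sigmoidC /sigmoid -u2.
have -> : 2^-1 * (s - (cumulant (t + s) - cumulant t)) =
  2^-1 * s + 2^-1 * cumulant t - 2^-1 * cumulant (t + s) by ring.
have -> : 2^-1 * - (cumulant (t + s) - cumulant t) =
  2^-1 * cumulant t - 2^-1 * cumulant (t + s) by ring.
rewrite !expRB expRD -/u -/v -/e.
have le1 : s ^+ 2 / 16 <= (e - 1) ^+ 2.
  have : `|2^-1 * s| <= 4^-1.
    by rewrite normrM gtr0_norm ?invr_gt0//; lra.
  by move=> /expR_sub1_sqr; rewrite -/e; apply: le_trans; rewrite exprMn; lra.
clearbody u v e; have un0 : u != 0 by rewrite gt_eqF.
have vn0 : v != 0 by rewrite gt_eqF.
have [rho rhoE] : {rho | rho = (1 + expR t * e) / (u * v)} by eexists.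
rewrite (_ : _ + _ = rho); last by rewrite rhoE; field; rewrite ?un0 ?vn0.
(* Lagrange's identity (1 + E) (1 + E e^2) - (1 + E e)^2 = E (e - 1)^2 with E = exp t. *)
have rho2 : 1 - rho ^+ 2 = expR t * (e - 1) ^+ 2 / (u ^+ 2 * v ^+ 2).
  rewrite rhoE expr_div_n exprMn.
  apply: (@mulIf _ (u ^+ 2 * v ^+ 2)); first by rewrite gt_eqF// mulr_gt0// exprn_gt0.
  rewrite mulrBl !divfK ?gt_eqF// ?mulr_gt0// ?exprn_gt0//.
  by rewrite u2 v2; ring.
(* The constant is 128 = 16 * 2 * 4: 16 from [le1], 2 from the growth of the normalizer over a step
   of length at most 1/2, and 4 from the variance bound. Passing from rho^2 to rho doubles it. *)
suff : expR (- `|t|) * s ^+ 2 / 128 <= 1 - rho ^+ 2.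
  have : 0 <= (1 - rho) ^+ 2 by exact: sqr_ge0.
  lra.
have le2 : v ^+ 2 <= 2 * u ^+ 2.
  rewrite v2 u2 e2; suff : expR s <= 2 by nra.
  have := expR_quadratic s2; move: s2; rewrite ler_norml => /andP[]; nra.
have le3 : expR (- `|t|) / 4 <= expR t / (u ^+ 2 * u ^+ 2).
  have := logistic_var_lower t.
  by rewrite /logistic_var sigmoidC /sigmoid -mulrA -invfM -u2.
rewrite rho2.
apply: (@le_trans _ _ (expR t * (s ^+ 2 / 16) / (u ^+ 2 * (2 * u ^+ 2)))).
  rewrite [leRHS](_ : _ = expR t / (u ^+ 2 * u ^+ 2) * (s ^+ 2 / 32)); last first.
    by field; rewrite gt_eqF.
  apply: (@le_trans _ _ (expR (- `|t|) / 4 * (s ^+ 2 / 32))); first by lra.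
  by rewrite ler_wpM2r// divr_ge0 ?sqr_ge0.
apply: ler_pM.
- by apply: mulr_ge0; [exact: ltW|rewrite divr_ge0 ?sqr_ge0].
- by rewrite invr_ge0; apply: mulr_ge0; [|apply: mulr_ge0 => //]; exact: sqr_ge0.
- by rewrite ler_wpM2l// ltW.
- rewrite lef_pV2 ?posrE ?mulr_gt0 ?exprn_gt0//.
  by rewrite ler_wpM2l ?sqr_ge0.
Qed.

End LogLikelihoodRatio.

Section Measurability.
Context {R : realType} {p : nat}.

Lemma measurable_dot (u : 'rV[R]_p) :
  measurable_fun setT (fun x : p.-tuple R => dot x u).
Proof.
apply: measurable_sum => j; apply: measurable_funM => //.
exact: measurable_tnth.
Qed.

Lemma measurable_cumulant : measurable_fun setT (@cumulant R).
Proof.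
apply: (measurableT_comp (@measurable_ln R)).
by apply: measurable_funD => //; exact: measurable_expR.
Qed.

Lemma measurable_sigmoid : measurable_fun setT (@sigmoid R).
Proof.
rewrite (_ : sigmoid = fun t => 1 - expR (- cumulant t)); last first.
  apply/funext => t; rewrite expRN expR_cumulant -sigmoidC; ring.
apply: measurable_funB => //; apply: measurableT_comp => //.
by apply: measurableT_comp => //; exact: measurable_cumulant.
Qed.

Lemma measurable_logistic_var : measurable_fun setT (@logistic_var R).
Proof.
have ms := measurable_sigmoid.
by apply: measurable_funM => //; apply: measurable_funB.
Qed.

Lemma measurable_llr (beta0 v : 'rV[R]_p) : measurable_fun setT (llr beta0 v).
Proof.
have mdot u : measurable_fun setT (fun z : p.-tuple R * bool => dot z.1 u).
  by apply: (measurableT_comp (measurable_dot u)).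
apply: measurable_funB.
  apply: measurable_funM => //.
  by apply: (measurableT_comp (_ : measurable_fun setT (fun b : bool => b%:R : R))).
apply: measurable_funB; last exact: (measurableT_comp measurable_cumulant).
by apply: (measurableT_comp measurable_cumulant); exact: measurable_funD.
Qed.

End Measurability.

(* The moment bounds only control X^T u, while the logistic variance decays like
   exp (- |X^T beta0|): truncating at |X^T beta0| <= trunc_level loses at most
   half of E (X^T u)^2, by trunc_sqr with M = 4 a2 / a1. *)
Definition trunc_level {R : realType} (a0 a1 a2 : R) : R :=
  1 + 4 * (4 * a2 / a1) ^+ 2 * a2 * a0 ^+ 3 / a1.

Definition curvature {R : realType} (a0 a1 a2 : R) : R :=
  expR (- trunc_level a0 a1 a2) * (a1 / 2).

Lemma curvature_gt0 {R : realType} (a0 a1 a2 : R) : 0 < a1 -> 0 < curvature a0 a1 a2.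
Proof. by move=> a10; rewrite mulr_gt0 ?expR_gt0 ?divr_gt0. Qed.

(** Each summand handles one case: the first A <= K, the third A > K with |U| <= M, since then 1 <=
    (A / K)^3, and the second |U| > M. *)
Lemma trunc_sqr {R : realType} (U A M K : R) : 0 < M -> 0 < K -> 0 <= A ->
  U ^+ 2 <= expR K * (expR (- A) * U ^+ 2) + (M^-1 * `|U| ^+ 3 +
            M ^+ 2 / K ^+ 3 * A ^+ 3).
Proof.
move=> M0 K0 A0; have U20 := sqr_ge0 U.
have T1 : 0 <= expR K * (expR (- A) * U ^+ 2) by rewrite mulr_ge0 ?expR_ge0// mulr_ge0 ?expR_ge0.
have T2 : 0 <= M^-1 * `|U| ^+ 3 by rewrite mulr_ge0 ?invr_ge0 ?exprn_ge0// ltW.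
have T3 : 0 <= M ^+ 2 / K ^+ 3 * A ^+ 3.
  by rewrite mulr_ge0 ?divr_ge0 ?exprn_ge0// ltW.
have [AK|AK] := leP A K.
  apply: (@le_trans _ _ (expR K * (expR (- A) * U ^+ 2))); last by lra.
  rewrite mulrA -expRD -[leLHS]mul1r ler_wpM2r// -expR0 ler_expR; lra.
have [UM|UM] := leP `|U| M.
  apply: (@le_trans _ _ (M ^+ 2 / K ^+ 3 * A ^+ 3)); last by lra.
  rewrite -mulrA -[leLHS]mulr1 ler_pM//.
    by rewrite -(real_normK (num_real U)) lerXn2r ?nnegrE// ltW.
  by rewrite mulrC ler_pdivlMr ?exprn_gt0// mul1r lerXn2r ?nnegrE// ltW.
apply: (@le_trans _ _ (M^-1 * `|U| ^+ 3)); last by lra.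
rewrite [leRHS]mulrC ler_pdivlMr// -(real_normK (num_real U)) [leLHS]mulrC [leRHS]exprS.
by rewrite ler_wpM2r ?sqr_ge0// ltW.
Qed.

(** * Moments and exponential moments of one observation *)

Section SingleObservation.
Context {d : measure_display} {T : measurableType d} {R : realType}
  (P : probability T R) (p : nat) (Z : {RV P >-> (p.-tuple R * bool)%type})
  (beta0 : 'rV[R]_p) (k : nat) (a0 a1 a2 a3 : R).
Context (a0_gt0 : 0 < a0) (a1_gt0 : 0 < a1) (a2_gt0 : 0 < a2) (a3_gt0 : 0 < a3).
Context (Zlog : logistic_model Z beta0).
Context (Xbd : forall j, {ae P, forall w, `|tnth (Z w).1 j| <= a3}).
Context (moments : forall u : 'rV[R]_p, sparse k u -> norm2 u = 1 ->
  (a1%:E <= 'E_P[fun w => (dot (Z w).1 u ^+ 2)%R])%E /\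
  ('E_P[fun w => (`|dot (Z w).1 u| ^+ 3)%R] <= a2%:E)%E).
Context (beta0_sparse : sparse k beta0) (beta0_norm : norm2 beta0 <= a0).

Lemma ae_bounded_all : {ae P, forall w, forall j, `|tnth (Z w).1 j| <= a3}.
Proof.
have H (s : seq 'I_p) : {ae P, forall w, forall j, j \in s -> `|tnth (Z w).1 j| <= a3}.
  elim: s => [|j s IH]; first by apply: aeW.
  apply: filterS2 (Xbd j) IH => w h1 h2 i; rewrite in_cons => /orP[/eqP ->//|].
  exact: h2.
by apply: filterS (H (enum 'I_p)) => w h j; apply: h; rewrite mem_enum.
Qed.

Lemma ess_bounded_dot u : ess_bounded P (fun w => dot (Z w).1 u).
Proof.
split.
  apply: (measurableT_comp (measurable_dot u)).
  exact: measurableT_comp.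
exists (a3 * norm1 u); apply: filterS ae_bounded_all => w; exact: dot_norm1.
Qed.

Lemma ess_bounded_tnth j : ess_bounded P (fun w => tnth (Z w).1 j).
Proof.
split; last by exists a3.
apply: (measurableT_comp (@measurable_tnth _ _ p j)).
exact: measurableT_comp.
Qed.

Lemma expectation_expect (f : T -> R) : ess_bounded P f -> 'E_P[f]%E = (expect P f)%:E.
Proof. by move=> bf; rewrite expectE// unlock. Qed.

Lemma unit_moments u : sparse k u -> norm2 u = 1 ->
  a1 <= expect P (fun w => dot (Z w).1 u ^+ 2) /\
  expect P (fun w => `|dot (Z w).1 u| ^+ 3) <= a2.
Proof.
move=> uk u1; have [] := moments uk u1.
have b := ess_bounded_dot u.
rewrite !expectation_expect ?lee_fin//.
- by apply: ess_bounded_exp; exact: ess_bounded_norm.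
- exact: ess_bounded_exp.
Qed.

Lemma expect_dot_sqr (g : T -> R) u (c : R) : ess_bounded P g ->
  expect P (fun w => g w * dot (Z w).1 (c *: u) ^+ 2) =
  c ^+ 2 * expect P (fun w => g w * dot (Z w).1 u ^+ 2).
Proof.
move=> bg; rewrite -expectZ; last first.
  by apply: ess_boundedM => //; apply: ess_bounded_exp; exact: ess_bounded_dot.
by congr expect; apply/funext => w; rewrite dotZ exprMn; ring.
Qed.

Lemma unit_vector (u : 'rV[R]_p) : u != 0 -> sparse k u ->
  exists v : 'rV[R]_p, [/\ u = norm2 u *: v, sparse k v & norm2 v = 1].
Proof.
move=> u0 uk; have n0 : norm2 u != 0.
  apply: contra u0 => /eqP n0; apply/eqP/sqnorm_eq0.
  by rewrite -norm2_sqr n0 expr0n.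
exists ((norm2 u)^-1 *: u); split.
- by rewrite scalerA mulfV// scale1r.
- by apply: coord_space_sparse uk _; apply: coord_spaceZ; exact: coord_space_supp.
- by rewrite norm2Z ger0_norm ?invr_ge0 ?norm2_ge0// mulVf.
Qed.

Lemma beta0_moment3 : expect P (fun w => `|dot (Z w).1 beta0| ^+ 3) <= a2 * a0 ^+ 3.
Proof.
have [->|b0] := eqVneq beta0 0.
  rewrite (_ : (fun w => _) = fun=> 0); last first.
    by apply/funext => w; rewrite dot0 normr0 expr0n.
  by rewrite expect_cst mulr_ge0 ?exprn_ge0// ltW.
have [v [bE vk v1]] := unit_vector b0 beta0_sparse.
have [_ v3] := unit_moments vk v1.
have bv : ess_bounded P (fun w => `|dot (Z w).1 v| ^+ 3).
  by apply: ess_bounded_exp; apply: ess_bounded_norm; exact: ess_bounded_dot.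
rewrite (_ : (fun w => _) = fun w => norm2 beta0 ^+ 3 * `|dot (Z w).1 v| ^+ 3); last first.
  by apply/funext => w; rewrite {1}bE dotZ normrM exprMn (ger0_norm (norm2_ge0 _)).
rewrite expectZ// mulrC; apply: ler_pM => //; last first.
- by rewrite lerXn2r ?nnegrE ?norm2_ge0// ltW.
- by rewrite exprn_ge0// norm2_ge0.
rewrite -(expect_cst P 0); apply: le_expect => //; first exact: ess_bounded_cst.
by apply: aeW => w /=; rewrite exprn_ge0.
Qed.

(** On unit vectors the third moment controls the second through U^2 <= 1 + |U|^3; the rest is
    homogeneity. *)
Lemma moment2_upper u : sparse k u ->
  expect P (fun w => dot (Z w).1 u ^+ 2) <= (1 + a2) * sqnorm u.
Proof.
move=> uk; have [->|u0] := eqVneq u 0.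
  rewrite (_ : (fun w => _) = fun=> 0); last first.
    by apply/funext => w; rewrite dot0 expr0n.
  by rewrite expect_cst mulr_ge0 ?sqnorm_ge0// addr_ge0// ltW.
have [v [uE vk v1]] := unit_vector u0 uk.
have [_ v3] := unit_moments vk v1.
have bv := ess_bounded_dot v.
have bv3 : ess_bounded P (fun w => `|dot (Z w).1 v| ^+ 3).
  by apply: ess_bounded_exp; exact: ess_bounded_norm.
have := expect_dot_sqr v (norm2 u) (ess_bounded_cst P 1).
rewrite -uE; under eq_fun do rewrite mul1r.
under [X in _ = _ * expect P X -> _]eq_fun do rewrite mul1r.
move=> ->; rewrite norm2_sqr mulrC ler_wpM2r ?sqnorm_ge0//.
apply: (@le_trans _ _ (1 + expect P (fun w => `|dot (Z w).1 v| ^+ 3))); last by rewrite lerD2l.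
rewrite -{1}(expect_cst P 1) -expectD//; last exact: ess_bounded_cst.
apply: le_expect; [exact: ess_bounded_exp|exact: ess_boundedD (ess_bounded_cst _ _) bv3|].
apply: aeW => w /=; set U := dot _ _; rewrite -(real_normK (num_real U)).
have U0 := normr_ge0 U; have [U1|U1] := leP `|U| 1.
  apply: (@le_trans _ _ 1); first by rewrite expr_le1.
  by rewrite lerDl exprn_ge0.
rewrite exprS -[leLHS]mul1r; apply: le_trans (ler_wpM2r _ (ltW U1)) _; first exact: sqr_ge0.
by rewrite lerDr.
Qed.

(** For a unit vector, integrating [trunc_sqr] with M = 4 a2 / a1 leaves two error terms of at most
    a1 / 4 each, hence half of the lower bound a1 survives. *)
Lemma curvature_lower u : sparse k u ->
  curvature a0 a1 a2 * sqnorm u <=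
  expect P (fun w => expR (- `|dot (Z w).1 beta0|) * dot (Z w).1 u ^+ 2).
Proof.
set g := fun w => expR (- `|dot (Z w).1 beta0|).
have bg : ess_bounded P g.
  by apply: ess_bounded_expR; apply: ess_boundedN; apply: ess_bounded_norm;
     exact: ess_bounded_dot.
move=> uk; have [->|u0] := eqVneq u 0.
  rewrite (_ : (fun w => _) = fun=> 0); last first.
    by apply/funext => w; rewrite dot0 expr0n mulr0.
  by rewrite expect_cst /sqnorm big1 ?mulr0// => j _; rewrite mxE expr0n.
have [v [uE vk v1]] := unit_vector u0 uk.
have [v2 v3] := unit_moments vk v1.
have bv := ess_bounded_dot v.
have := expect_dot_sqr v (norm2 u) bg; rewrite -uE => ->.
rewrite norm2_sqr mulrC ler_wpM2l ?sqnorm_ge0//.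
pose M := 4 * a2 / a1; pose K := trunc_level a0 a1 a2.
have M0 : 0 < M by rewrite divr_gt0 ?mulr_gt0.
have K1 : 1 <= K.
  rewrite /K /trunc_level lerDl divr_ge0 ?(ltW a1_gt0)//.
  rewrite mulr_ge0 ?exprn_ge0 ?(ltW a0_gt0)// mulr_ge0 ?(ltW a2_gt0)//.
  by rewrite mulr_ge0 ?sqr_ge0.
have K0 : 0 < K by exact: lt_le_trans K1.
have b1 : ess_bounded P (fun w => g w * dot (Z w).1 v ^+ 2).
  by apply: ess_boundedM => //; exact: ess_bounded_exp.
have b3 : ess_bounded P (fun w => `|dot (Z w).1 v| ^+ 3).
  by apply: ess_bounded_exp; exact: ess_bounded_norm.
have b4 : ess_bounded P (fun w => `|dot (Z w).1 beta0| ^+ 3).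
  by apply: ess_bounded_exp; apply: ess_bounded_norm; exact: ess_bounded_dot.
have cM c f : ess_bounded P f -> ess_bounded P (fun w => c * f w).
  by move=> bf; apply: ess_boundedM => //; exact: ess_bounded_cst.
have : expect P (fun w => dot (Z w).1 v ^+ 2) <=
  expect P (fun w => expR K * (g w * dot (Z w).1 v ^+ 2) +
    (M^-1 * `|dot (Z w).1 v| ^+ 3 + M ^+ 2 / K ^+ 3 * `|dot (Z w).1 beta0| ^+ 3)).
  apply: le_expect; first exact: ess_bounded_exp.
    by apply: ess_boundedD; [exact: cM|apply: ess_boundedD; exact: cM].
  by apply: aeW => w /=; exact: trunc_sqr.
rewrite expectD ?expectD ?expectZ//; try (exact: cM); last first.
  by apply: ess_boundedD; exact: cM.
have t2 : M^-1 * expect P (fun w => `|dot (Z w).1 v| ^+ 3) <= a1 / 4.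
  apply: (@le_trans _ _ (M^-1 * a2)); first by rewrite ler_wpM2l// invr_ge0 ltW.
  rewrite le_eqVlt; apply/orP; left; apply/eqP; rewrite /M.
  by field; rewrite !gt_eqF.
have t3 : M ^+ 2 / K ^+ 3 * expect P (fun w => `|dot (Z w).1 beta0| ^+ 3) <= a1 / 4.
  apply: (@le_trans _ _ (M ^+ 2 / K ^+ 3 * (a2 * a0 ^+ 3))).
    by rewrite ler_wpM2l ?beta0_moment3// divr_ge0 ?exprn_ge0// ltW.
  rewrite mulrAC ler_pdivrMr ?exprn_gt0//.
  (* This is the reason for the summand 1 in [trunc_level]; its other summand is M^2 a2 a0^3 divided
     by a1 / 4. *)
  have KK : K <= K ^+ 3 by rewrite ler_eXnr.
  apply: (@le_trans _ _ (a1 / 4 * K)); last by rewrite ler_wpM2l// divr_ge0// ltW.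
  rewrite /K /trunc_level -/M mulrDr.
  rewrite (_ : a1 / 4 * (_ / a1) = M ^+ 2 * (a2 * a0 ^+ 3)); last by field; rewrite gt_eqF.
  by rewrite lerDr mulr1 divr_ge0// ltW.
move=> h; rewrite /curvature -/K expRN mulrC ler_pdivrMr ?expR_gt0//.
rewrite mulrC; lra.
Qed.

Lemma sigmoid_log_odds h : (forall x, 0 < h x < 1) ->
  (forall x, ln (h x / (1 - h x)) = dot x beta0) ->
  forall x, h x = sigmoid (dot x beta0).
Proof.
move=> h01 lnh x; have /andP[h0 h1] := h01 x.
have h1' : 0 < 1 - h x by rewrite subr_gt0.
rewrite /sigmoid -lnh lnK ?posrE ?divr_gt0//.
field; rewrite gt_eqF//= (_ : _ + _ = 1) ?oner_eq0//; ring.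
Qed.

Lemma integral_llr (F : bool -> R -> R -> R) v :
  (forall b, measurable_fun setT (fun x : p.-tuple R => F b (dot x beta0) (dot x v))) ->
  (forall b s t, 0 <= F b s t) ->
  (\int[P]_w (F (Z w).2 (dot (Z w).1 beta0) (dot (Z w).1 v))%:E =
   \int[P]_w (F true (dot (Z w).1 beta0) (dot (Z w).1 v) * sigmoid (dot (Z w).1 beta0) +
     F false (dot (Z w).1 beta0) (dot (Z w).1 v) * (1 - sigmoid (dot (Z w).1 beta0)))%:E)%E.
Proof.
move=> mF F0; have [h [hZ h01 lnh]] := Zlog.
rewrite (@cond_prob1_integral _ _ _ _ _ P Z h
  (fun z => F z.2 (dot z.1 beta0) (dot z.1 v)))//.
apply: eq_integral => w _ /=.
by rewrite (sigmoid_log_odds h01 lnh).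
Qed.

Lemma measurable_expR_llr (c : R) v (b : bool) :
  measurable_fun setT (fun x : p.-tuple R => expR (c *
    (b%:R * dot x v - (cumulant (dot x beta0 + dot x v) - cumulant (dot x beta0))))).
Proof.
apply: measurableT_comp => //; apply: measurable_funM => //.
apply: measurable_funB.
  by apply: measurable_funM => //; exact: measurable_dot.
apply: measurable_funB.
  apply: (measurableT_comp measurable_cumulant).
  by apply: measurable_funD; exact: measurable_dot.
by apply: (measurableT_comp measurable_cumulant); exact: measurable_dot.
Qed.

Lemma llr_exp_mean v : (\int[P]_w (expR (llr beta0 v (Z w)))%:E = 1)%E.
Proof.
rewrite /llr (@integral_llr (fun b s t => expR (b%:R * t - (cumulant (s + t) - cumulant s)))).
- under eq_integral do rewrite mul1r mul0r sub0r llr_mean1.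
  by rewrite integral_cst// mul1e; exact: probability_setT.
- move=> b; have := measurable_expR_llr 1 v b.
  by under eq_fun do rewrite mul1r.
- by move=> *; exact: expR_ge0.
Qed.

(** The smallness condition forces |X^T v| <= 1/2 almost surely, so the conditional bound
    [llr_half_mean] applies; it is integrated with [curvature_lower] and turned into an exponential
    by 1 - y <= exp (- y). *)
Lemma llr_half_exp_mean v : sparse k v -> a3 ^+ 2 * k%:R * sqnorm v <= 4^-1 ->
  (\int[P]_w (expR (2^-1 * llr beta0 v (Z w)))%:E <=
   (expR (- (curvature a0 a1 a2 / 256 * sqnorm v)))%:E)%E.
Proof.
move=> vk vs; have [c [cE c0 c1]] : exists c : R, [/\ 256^-1 = c, 0 < c & c <= 1].
  by exists 256^-1; split; [exact: erefl|lra|lra].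
rewrite cE.
rewrite /llr (@integral_llr (fun b s t =>
  expR (2^-1 * (b%:R * t - (cumulant (s + t) - cumulant s))))); last 2 first.
- by move=> b; exact: measurable_expR_llr.
- by move=> *; exact: expR_ge0.
have bt : ess_bounded P (fun w => expR (- `|dot (Z w).1 beta0|) * dot (Z w).1 v ^+ 2).
  apply: ess_boundedM; last by apply: ess_bounded_exp; exact: ess_bounded_dot.
  by apply: ess_bounded_expR; apply: ess_boundedN; apply: ess_bounded_norm;
     exact: ess_bounded_dot.
have bt' : ess_bounded P (fun w =>
    1 + - c * (expR (- `|dot (Z w).1 beta0|) * dot (Z w).1 v ^+ 2)).
  apply: ess_boundedD; first exact: ess_bounded_cst.
  by apply: ess_boundedM => //; exact: ess_bounded_cst.
have mth : measurable_fun setT (fun w => dot (Z w).1 beta0).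
  by case: (ess_bounded_dot beta0).
have msig : measurable_fun setT (fun w => sigmoid (dot (Z w).1 beta0)).
  by apply: (measurableT_comp measurable_sigmoid).
have mfst (b : bool) : measurable_fun setT (fun w => expR (2^-1 * (b%:R * dot (Z w).1 v -
    (cumulant (dot (Z w).1 beta0 + dot (Z w).1 v) - cumulant (dot (Z w).1 beta0))))).
  have mX : measurable_fun setT (fun w => (Z w).1) by exact: measurableT_comp.
  exact: (measurableT_comp (measurable_expR_llr 2^-1 v b) mX).
have small : {ae P, forall w, `|dot (Z w).1 v| <= 2^-1}.
  apply: filterS ae_bounded_all => w Xa.
  rewrite -ler_sqr ?nnegrE// real_normK ?num_real//.
  apply: le_trans (dot_sqr_sparse vk Xa) _.
  by apply: le_trans vs _; lra.
(* The conditional bound is known to be nonnegative only where |X^T v| <= 1/2, so its positive part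
   is compared first. *)
apply: (@le_trans _ _ (\int[P]_w (Num.max 0 (1 + - c *
    (expR (- `|dot (Z w).1 beta0|) * dot (Z w).1 v ^+ 2)))%:E)%E).
  apply: (@ae_ge0_le_integral _ _ _ _ _ measurableT).
  - move=> w _; rewrite lee_fin addr_ge0// mulr_ge0 ?expR_ge0// ?(ltW (sigmoid_gt0 _))//.
    by rewrite subr_ge0 (ltW (sigmoid_lt1 _)).
  - apply/measurable_EFinP; apply: measurable_funD; apply: measurable_funM => //.
    exact: measurable_funB.
  - by move=> w _; rewrite lee_fin le_max lexx.
  - by apply/measurable_EFinP; apply: measurable_maxr; [exact: measurable_cst|case: bt'].
  - apply: (filterS _ small) => w s2 _; rewrite lee_fin le_max; apply/orP; right.
    rewrite mul1r mul0r sub0r; apply: le_trans (llr_half_mean _ s2) _.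
    by rewrite cE mulNr mulrC.
rewrite (_ : integral _ _ _ = (expect P (fun w =>
    1 + - c * (expR (- `|dot (Z w).1 beta0|) * dot (Z w).1 v ^+ 2)))%:E); last first.
  rewrite expectE//; apply: ae_eq_integral.
  - exact: measurableT.
  - by apply/measurable_EFinP; apply: measurable_maxr; [exact: measurable_cst|case: bt'].
  - by apply/measurable_EFinP; case: bt'.
  - apply: (filterS _ small) => w s2 _; congr EFin; rewrite max_r//.
    apply: (@le_trans _ _ (1 - c)); first by rewrite subr_ge0.
    rewrite mulNr lerD2l lerN2 ler_piMr ?(ltW c0)//.
    have e1 : expR (- `|dot (Z w).1 beta0|) <= 1 by rewrite expR_le1 oppr_le0.
    apply: mulr_ile1 => //; rewrite ?expR_ge0 ?sqr_ge0//.
    rewrite -(real_normK (num_real _)) expr_le1//; apply: le_trans s2 _; lra.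
rewrite lee_fin expectD ?expect_cst ?expectZ//; last 2 first.
- exact: ess_bounded_cst.
- by apply: ess_boundedM => //; exact: ess_bounded_cst.
apply: le_trans (expR_ge1Dx _); rewrite lerD2l mulNr lerN2.
by rewrite mulrAC mulrC ler_wpM2l ?(ltW c0)// curvature_lower.
Qed.

(** For g = 1 this is the second moment matrix of the covariates, and for g the logistic variance at
    [beta0] it is the Fisher information. *)
Definition pop_gram (g : p.-tuple R -> R) i j : R :=
  expect P (fun w => g (Z w).1 * tnth (Z w).1 i * tnth (Z w).1 j).

Section Gram.
Context (g : p.-tuple R -> R) (mg : measurable_fun setT g)
  (g01 : forall x, 0 <= g x <= 1).

Lemma ess_bounded_weight : ess_bounded P (fun w => g (Z w).1).
Proof.
split; first by apply: (measurableT_comp mg); exact: measurableT_comp.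
exists 1; apply: aeW => w /=; have /andP[h0 h1] := g01 (Z w).1.
by rewrite ger0_norm.
Qed.

Lemma ess_bounded_gram i j :
  ess_bounded P (fun w => g (Z w).1 * tnth (Z w).1 i * tnth (Z w).1 j).
Proof.
by do 2 (apply: ess_boundedM; last exact: ess_bounded_tnth); exact: ess_bounded_weight.
Qed.

Lemma pop_gramC i j : pop_gram g i j = pop_gram g j i.
Proof. by congr expect; apply/funext => w; rewrite mulrAC. Qed.

Lemma bilin_pop_gram u v :
  bilin (pop_gram g) u v = expect P (fun w => g (Z w).1 * dot (Z w).1 u * dot (Z w).1 v).
Proof.
under [in RHS]eq_fun do rewrite bilin_dot /bilin.
have cM (c c' : R) f : ess_bounded P f -> ess_bounded P (fun w => f w * c * c').
  by move=> bf; do 2 (apply: ess_boundedM; last exact: ess_bounded_cst).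
rewrite expect_sum; last first.
  by move=> i; apply: ess_bounded_sum => j; apply: cM; exact: ess_bounded_gram.
apply: eq_bigr => i _; rewrite expect_sum; last first.
  by move=> j; apply: cM; exact: ess_bounded_gram.
apply: eq_bigr => j _; rewrite -mulrA mulrC -expectZ; last exact: ess_bounded_gram.
by congr expect; apply/funext => w; ring.
Qed.

Lemma pop_gram_upper u : sparse k u ->
  bilin (pop_gram g) u u <= (1 + a2) * sqnorm u.
Proof.
move=> uk; rewrite bilin_pop_gram; apply: le_trans (moment2_upper uk).
have bu := ess_bounded_dot u.
apply: le_expect; last apply: aeW => w /=.
- by do 2 (apply: ess_boundedM => //); exact: ess_bounded_weight.
- exact: ess_bounded_exp.
- rewrite -mulrA -expr2 -[leRHS]mul1r ler_wpM2r ?sqr_ge0//.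
  by have /andP[] := g01 (Z w).1.
Qed.

(** The centred variable Y, scaled by [l], is at most 2 |l| a3^2 <= 1/2 in absolute value, so exp Y
    <= 1 + Y + 2 Y^2. Its mean vanishes and 2 (2 l a3^2)^2 = 8 l^2 a3^4. *)
Lemma gram_mgf i j (l : R) : `|l| * a3 ^+ 2 <= 4^-1 ->
  (\int[P]_w (expR (l * (g (Z w).1 * tnth (Z w).1 i * tnth (Z w).1 j
       - pop_gram g i j)))%:E <= (expR (8 * l ^+ 2 * a3 ^+ 4))%:E)%E.
Proof.
move=> la; set V := fun w => g (Z w).1 * tnth (Z w).1 i * tnth (Z w).1 j.
have bV : ess_bounded P V by exact: ess_bounded_gram.
have Va : {ae P, forall w, `|V w| <= a3 ^+ 2}.
  apply: filterS ae_bounded_all => w Xa; rewrite /V !normrM expr2.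
  have /andP[h0 h1] := g01 (Z w).1; rewrite (ger0_norm h0).
  by rewrite ler_pM ?mulr_ge0// -[leRHS]mul1r ler_pM.
have mu_le : `|pop_gram g i j| <= a3 ^+ 2.
  rewrite ler_norml -[X in X <= _ <= _](expect_cst P) -[X in _ <= _ <= X](expect_cst P).
  apply/andP; split; apply: le_expect => //; try exact: ess_bounded_cst.
    by apply: filterS Va => w; rewrite ler_norml => /andP[].
  by apply: filterS Va => w; rewrite ler_norml => /andP[].
set mu := pop_gram g i j; rewrite -/mu in mu_le.
pose Y w := l * (V w - mu).
have bY : ess_bounded P Y.
  apply: ess_boundedM; first exact: ess_bounded_cst.
  by apply: ess_boundedD => //; exact: ess_bounded_cst.
have Ya : {ae P, forall w, `|Y w| <= `|l| * (2 * a3 ^+ 2)}.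
  apply: filterS Va => w Vw; rewrite normrM ler_wpM2l//.
  by apply: le_trans (ler_normB _ _) _; lra.
rewrite -expectE; last by exact: ess_bounded_expR bY.
rewrite lee_fin; apply: le_trans (expR_ge1Dx _).
apply: (@le_trans _ _ (expect P (fun w => Y w + (1 + 8 * l ^+ 2 * a3 ^+ 4)))).
  apply: le_expect.
  - exact: ess_bounded_expR bY.
  - by apply: ess_boundedD => //; exact: ess_bounded_cst.
  - apply: filterS Ya => w Yw; apply: le_trans (expR_quadratic _) _.
      by apply: le_trans Yw _; lra.
    rewrite -(real_normK (num_real (Y w))).
    have : `|Y w| ^+ 2 <= (`|l| * (2 * a3 ^+ 2)) ^+ 2 by rewrite lerXn2r ?nnegrE// (le_trans _ Yw).
    rewrite (_ : (_ * (2 * _)) ^+ 2 = 4 * `|l| ^+ 2 * a3 ^+ 4); last by ring.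
    rewrite [`|l| ^+ 2]real_normK ?num_real// -/(V w) -/(Y w); lra.
rewrite expectD//; last exact: ess_bounded_cst.
rewrite expect_cst expectZ; last by apply: ess_boundedD => //; exact: ess_bounded_cst.
rewrite expectD//; last exact: ess_bounded_cst.
by rewrite expect_cst subrr mulr0 add0r.
Qed.

End Gram.

Lemma pop_gram_lower u : sparse k u ->
  curvature a0 a1 a2 / 4 * sqnorm u <=
  bilin (pop_gram (fun x => logistic_var (dot x beta0))) u u.
Proof.
move=> uk.
have bu := ess_bounded_dot u.
have bt : ess_bounded P (fun w => expR (- `|dot (Z w).1 beta0|) * dot (Z w).1 u ^+ 2).
  apply: ess_boundedM; last exact: ess_bounded_exp.
  by apply: ess_bounded_expR; apply: ess_boundedN; apply: ess_bounded_norm;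
     exact: ess_bounded_dot.
have mw : measurable_fun setT (fun x : p.-tuple R => logistic_var (dot x beta0)).
  by apply: (measurableT_comp measurable_logistic_var); exact: measurable_dot.
have w01 (x : p.-tuple R) : 0 <= logistic_var (dot x beta0) <= 1.
  by rewrite logistic_var_ge0 logistic_var_le1.
rewrite bilin_pop_gram//.
apply: (@le_trans _ _ (4^-1 *
    expect P (fun w => expR (- `|dot (Z w).1 beta0|) * dot (Z w).1 u ^+ 2))).
  by rewrite mulrAC mulrC ler_wpM2l ?invr_ge0// curvature_lower.
rewrite -expectZ//; apply: le_expect.
- by apply: ess_boundedM => //; exact: ess_bounded_cst.
- by do 2 (apply: ess_boundedM => //); exact: (ess_bounded_weight mw).
- apply: aeW => w /=; rewrite -[leRHS]mulrA -expr2 mulrA ler_wpM2r ?sqr_ge0//.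
  by rewrite mulrC logistic_var_lower.
Qed.

End SingleObservation.

(** * Deterministic bounds on the likelihood *)

Section Rounding.
Context {R : realType} {n p : nat} (D : 'I_n -> p.-tuple R * bool).
Implicit Types (beta u w : 'rV[R]_p).

(** Bounds minus the second derivative of [loglik] in direction [w] at every point, as the logistic
    variance is at most 1. *)
Definition energy w : R := \sum_i dot (D i).1 w ^+ 2.

Lemma energyZ (c : R) w : energy (c *: w) = c ^+ 2 * energy w.
Proof. by rewrite /energy mulr_sumr; apply: eq_bigr => i _; rewrite dotZ exprMn. Qed.

Lemma loglik_segment beta u (t : R) : 0 <= t <= 1 ->
  (1 - t) * loglik D beta + t * loglik D (beta + u) <= loglik D (beta + t *: u).
Proof.
move=> /andP[t0 t1]; rewrite /loglik !mulr_sumr -big_split; apply: ler_sum => i _ /=.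
rewrite !dotD dotZ; set b := dot _ beta; set s := dot _ u.
have h1 := cumulant_tangent (b + t * s) b.
have h2 := cumulant_tangent (b + t * s) (b + s).
have := ler_wpM2l t0 h2; have := ler_wpM2l (_ : 0 <= 1 - t) h1.
by rewrite subr_ge0 => /(_ t1); lra.
Qed.

Lemma wmean_max (f a b c : R) : 0 <= f -> f <= 1 ->
  c <= (1 - f) * a + f * b -> c <= a \/ c <= b.
Proof.
move=> f0 f1 h; have [ab|ba] := leP a b; first by right; nra.
by left; nra.
Qed.

(** Weighting the two neighbouring integers so that their mean is [c] cancels the linear terms of
    the expansion at [c] and leaves a quadratic error; the better neighbour is at least as good as
    the weighted mean. *)
Lemma loglik_round beta w (c : R) : exists z : int,
  `|z%:~R - c| <= 1 /\
  loglik D (beta + c *: w) <= loglik D (beta + z%:~R *: w) + energy w.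
Proof.
pose lo := Num.floor c; pose f : R := c - lo%:~R.
have f0 : 0 <= f by rewrite subr_ge0 floor_le.
have f1 : f < 1 by rewrite ltrBlDl -[1]/(1%:~R) -intrD floorD1_gt.
have z0 : `|lo%:~R - c| <= 1.
  by rewrite ler_norml; apply/andP; move: f0 f1; rewrite /f; split; lra.
have z1 : `|(lo + 1)%:~R - c| <= 1.
  by rewrite intrD ler_norml; apply/andP; move: f0 f1; rewrite /f; split; lra.
suff : loglik D (beta + c *: w) - energy w <=
    (1 - f) * loglik D (beta + lo%:~R *: w) + f * loglik D (beta + (lo + 1)%:~R *: w).
  move=> h; have [h'|h'] := wmean_max f0 (ltW f1) h.
    by exists lo; split; rewrite -?lerBlDr.
  by exists (lo + 1); split; rewrite -?lerBlDr.
rewrite /loglik /energy !mulr_sumr -big_split -sumrB; apply: ler_sum => i _ /=.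
rewrite !dotD !dotZ intrD; set b := dot _ beta; set s := dot _ w.
have h1 := cumulant_quadratic (b + c * s) (- f * s).
have h2 := cumulant_quadratic (b + c * s) ((1 - f) * s).
rewrite [b + c * s + - f * s](_ : _ = b + lo%:~R * s) in h1; last by rewrite /f; ring.
rewrite [b + c * s + (1 - f) * s](_ : _ = b + (lo%:~R + 1%:~R) * s) in h2; last by rewrite /f; ring.
have h3 := ler_wpM2l f0 h2; have := ler_wpM2l (_ : 0 <= 1 - f) h1.
rewrite subr_ge0 => /(_ (ltW f1)) h4.
have h5 : (f * (1 - f) ^+ 2 + (1 - f) * f ^+ 2) * s ^+ 2 <= 1 * s ^+ 2.
  by rewrite ler_wpM2r ?sqr_ge0//; nra.
have -> : c = f + lo%:~R by rewrite /f subrK.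
rewrite (_ : c = f + lo%:~R) in h3 h4; last by rewrite /f subrK.
clearbody f; lra.
Qed.

(** One coordinate is rounded at a time. The base point is general because every rounding moves
    it. *)
Lemma loglik_round_family (w : 'I_p -> 'rV[R]_p) (c : 'I_p -> R) (B : R)
    (s : seq 'I_p) beta :
  uniq s -> (forall j, j \in s -> energy (w j) <= B) ->
  exists m : 'I_p -> int, (forall j, `|(m j)%:~R - c j| <= 1) /\
    loglik D (beta + \sum_(j <- s) c j *: w j) <=
    loglik D (beta + \sum_(j <- s) (m j)%:~R *: w j) + (size s)%:R * B.
Proof.
elim: s beta => [|j s IH] beta /=.
  move=> _ _; exists (fun j => Num.floor (c j)); split => [j|].
    have h1 := floor_le (c j); have h2 := floorD1_gt (c j).
    by rewrite intrD in h2; rewrite ler_norml; apply/andP; split; lra.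
  by rewrite !big_nil /= mulr0n mul0r !addr0.
move=> /andP[js us] sB.
have [z [zc hz]] := loglik_round (beta + \sum_(j <- s) c j *: w j) (w j) (c j).
have [|m [mc hm]] := IH (beta + z%:~R *: w j) us.
  by move=> i si; apply: sB; rewrite in_cons si orbT.
exists (fun i => if i == j then z else m i); split => [i|].
  by case: eqP => [->|].
rewrite !big_cons eqxx.
rewrite [X in _ <= loglik D (_ + (_ + X)) + _](_ : _ = \sum_(j <- s) (m j)%:~R *: w j); last first.
  rewrite big_seq [RHS]big_seq; apply: eq_bigr => i si.
  by case: eqP => [ij|//]; move: js; rewrite -ij si.
have e1 : energy (w j) <= B by apply: sB; rewrite in_cons eqxx.
rewrite [_ + (c j *: _ + _)]addrCA [c j *: _ + _]addrC.
apply: le_trans hz _; rewrite [_ + _ + z%:~R *: _]addrAC [X in _ <= loglik D X + _]addrA.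
have e (k : nat) : k.+1%:R * B = k%:R * B + B by rewrite -natr1 mulrDl mul1r.
rewrite e [X in _ <= X]addrA.
by apply: lerD; [exact: hm|exact: e1].
Qed.

Lemma loglik_interaction beta u w :
  loglik D (beta + u + w) <= loglik D (beta + u) + loglik D (beta + w) - loglik D beta
   - \sum_i logistic_var (dot (D i).1 beta) * dot (D i).1 u * dot (D i).1 w
   + \sum_i (dot (D i).1 u ^+ 2 * `|dot (D i).1 w| + `|dot (D i).1 u| * dot (D i).1 w ^+ 2).
Proof.
rewrite /loglik -big_split -!sumrB -big_split; apply: ler_sum => i _ /=.
rewrite !dotD.
have := cumulant_interaction (dot (D i).1 beta) (dot (D i).1 u) (dot (D i).1 w).
lra.
Qed.

Lemma sum_dot_bilin (g : p.-tuple R -> R) u w :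
  \sum_i g (D i).1 * dot (D i).1 u * dot (D i).1 w =
  bilin (fun j l => \sum_i g (D i).1 * tnth (D i).1 j * tnth (D i).1 l) u w.
Proof. by rewrite bilin_sum; apply: eq_bigr => i _; rewrite bilin_dot. Qed.

Lemma loglik_le0 beta : loglik D beta <= 0.
Proof.
apply: sumr_le0 => i _; set t := dot _ _.
have c0 (s : R) : 0 <= cumulant s by rewrite ln_ge0// lerDl expR_ge0.
case: (D i).2; rewrite ?mul0r ?mul1r ?sub0r ?oppr_le0// subr_le0.
rewrite -{1}[t]expRK /cumulant ler_ln ?posrE ?expR_gt0 ?expRD1_gt0//.
by rewrite lerDr.
Qed.

Lemma le_max_loglik (J : {set 'I_p}) beta :
  coord_space J beta -> loglik D beta <= max_loglik D J.
Proof.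
move=> bJ; apply: ub_le_sup; last by exists beta.
by exists 0 => _ [b _ <-]; exact: loglik_le0.
Qed.

Lemma max_loglik_le (J : {set 'I_p}) (M : R) :
  (forall beta, coord_space J beta -> loglik D beta <= M) -> max_loglik D J <= M.
Proof.
move=> H; apply: ge_sup; last by move=> _ [b bJ <-]; exact: H.
by exists (loglik D 0); exists 0 => // j _; rewrite mxE.
Qed.

End Rounding.

(** * Residuals of the coordinate vectors *)

Section Projection.
Context {R : realType} {p : nat} (Q : 'I_p -> 'I_p -> R) (c : R)
  (J0 : {set 'I_p}).

(* The matrix below equals Q on J0 x J0 and the identity outside, so it is
   positive definite, and solving one linear system with it projects a unit
   vector onto the coordinate space of J0. *)
Lemma residual_vector j : (forall i l, Q i l = Q l i) -> 0 < c ->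
  (forall u, coord_space J0 u -> c * sqnorm u <= bilin Q u u) ->
  exists w : 'rV[R]_p, j \notin J0 ->
    [/\ coord_space (finset.setU (finset.set1 j) J0) w, w ord0 j = 1 &
        forall a, coord_space J0 a -> bilin Q a w = 0].
Proof.
move=> QC c0 Qc.
pose M : 'M[R]_p := \matrix_(i, l) (if (i \in J0) && (l \in J0) then Q i l else (i == l)%:R).
have ME i l : M i l = if (i \in J0) && (l \in J0) then Q i l else (i == l)%:R.
  by rewrite mxE.
(* A vector in the kernel vanishes outside J0, where [M] is the identity, and then annihilates the
   quadratic form of [Q], which is positive on J0. *)
have uM : M \in unitmx.
  rewrite -row_free_unit -kermx_eq0; apply/eqP/row_matrixP => i; rewrite row0.
  set x := row i _; have xM : x *m M = 0.
    by apply/sub_kermxP; exact: row_sub.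
  have xl l : \sum_k x ord0 k * M k l = 0.
    by have /matrixP/(_ ord0 l) := xM; rewrite !mxE.
  have x0 l : l \notin J0 -> x ord0 l = 0.
    move=> lJ; rewrite -(xl l) (bigD1 l)//= ME (negbTE lJ) eqxx mulr1 big1 ?addr0// => k kl.
    by rewrite ME (negbTE lJ) andbF (negbTE kl) mulr0.
  apply: sqnorm_eq0; apply/eqP; rewrite eq_le sqnorm_ge0 andbT.
  rewrite -(@pmulr_rle0 _ c)//; apply: le_trans (Qc x x0) _.
  rewrite le_eqVlt; apply/orP; left; apply/eqP.
  rewrite /bilin exchange_big big1// => l _ /=.
  have [lJ|lJ] := boolP (l \in J0); last first.
    by rewrite big1// => k _; rewrite (x0 l lJ) mulr0.
  transitivity ((\sum_k x ord0 k * M k l) * x ord0 l); last by rewrite xl mul0r.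
  rewrite mulr_suml; apply: eq_bigr => k _; rewrite ME lJ andbT.
  have [kJ|kJ] := boolP (k \in J0); first by rewrite [x _ _ * Q _ _]mulrC.
  by rewrite (x0 k kJ) mulr0 !mul0r.
(* Normal equations: [z] is supported in J0 and carries the projection of the [j]-th coordinate
   vector. *)
pose y : 'cV[R]_p := \col_i (if i \in J0 then Q i j else 0).
pose z := invmx M *m y.
have Mz i : \sum_k M i k * z k ord0 = y i ord0.
  by have /matrixP/(_ i ord0) := mulKVmx uM y; rewrite !mxE.
have z0 i : i \notin J0 -> z i ord0 = 0.
  move=> iJ; have := Mz i; rewrite [y _ _]mxE (negbTE iJ) => <-.
  rewrite (bigD1 i)//= ME (negbTE iJ) eqxx mul1r big1 ?addr0// => k ki.
  by rewrite ME (negbTE iJ)/= eq_sym (negbTE ki) mul0r.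
exists (\row_i ((i == j)%:R - z i ord0)) => jJ; split.
- move=> i; rewrite finset.in_setU1 negb_or => /andP[ij iJ].
  by rewrite mxE (negbTE ij) z0// subr0.
- by rewrite mxE eqxx z0// subr0.
move=> a aJ; rewrite /bilin big1// => i _.
have [iJ|iJ] := boolP (i \in J0); last first.
  by rewrite big1// => l _; rewrite aJ// mulr0 mul0r.
transitivity (a ord0 i * (\sum_l Q i l * ((l == j)%:R - z l ord0))).
  by rewrite mulr_sumr; apply: eq_bigr => l _; rewrite mxE; ring.
rewrite (_ : \sum_l _ = Q i j - \sum_l M i l * z l ord0).
  by rewrite Mz mxE iJ subrr mulr0.
rewrite (_ : Q i j = \sum_l Q i l * (l == j)%:R); last first.
  rewrite (bigD1 j)//= eqxx mulr1 big1 ?addr0// => l /negbTE ->.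
  by rewrite mulr0.
rewrite -sumrB; apply: eq_bigr => l _; rewrite mulrBr; congr (_ - _).
rewrite ME iJ/=; case: ifPn => // lJ.
by rewrite z0// !mulr0.
Qed.

End Projection.

Section Arithmetic.
Context {R : realType}.

Lemma loc_arith1 (x y r : R) : y <= 2 * x + 2 * r -> x <= r / 8 -> 0 < r -> y <= 3 * r.
Proof. lra. Qed.

Lemma loc_arith2 (x y r : R) : r <= 2 * x + 2 * y -> x <= r / 8 -> 0 < r -> r / 4 <= y.
Proof. lra. Qed.

Lemma loc_arith3 (s kT kT' ka ka' aN aN' drop x : R) :
  s <= kT - aN -> aN' <= aN -> kT <= kT' -> ka <= ka' -> kT' + ka' + drop <= aN' ->
  x + s + ka <= x - drop.
Proof. lra. Qed.

Lemma loc_arith4 (t x y drop : R) : 0 < t -> t <= 1 -> 0 <= drop ->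
  (1 - t) * x + t * y <= x - drop -> y <= x - drop.
Proof. by move=> t0 t1 d0 h; rewrite -subr_ge0 -(@pmulr_rge0 _ t)//; nra. Qed.

Lemma amgm (e x y : R) : 0 < e -> x * y <= e * y ^+ 2 + x ^+ 2 / (4 * e).
Proof.
move=> e0; rewrite -subr_ge0 (_ : _ - _ = (2 * e * y - x) ^+ 2 / (4 * e)).
  by rewrite divr_ge0 ?sqr_ge0// mulr_ge0// ltW.
by field; rewrite gt_eqF.
Qed.

Lemma sv_arith (m2 N K k r2 NE : R) : m2 <= 2 * NE + 2 * K -> K <= k ->
  k <= r2 / 8 * N -> NE <= N * r2 -> 0 <= N * r2 -> m2 <= 3 * r2 * N.
Proof. move=> *; lra. Qed.

Lemma lo_arith (aL N E2 K m2 : R) : 0 < aL -> N * E2 / 2 - K <= m2 ->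
  aL * N * E2 / 2 - K * aL <= aL * m2.
Proof.
move=> a0 h; rewrite [leLHS](_ : _ = aL * (N * E2 / 2 - K)); last by ring.
by rewrite ler_pM2l.
Qed.

Lemma slack_arith (K aL AC e1 e2 slack : R) : 1 <= K -> 0 <= e1 -> 0 <= e2 ->
  aL + AC + e1 + e2 <= slack -> K * AC + K * aL + e1 + e2 <= K * slack.
Proof. by move=> *; nra. Qed.

Lemma true_arith (lb lbaw lba lbw lbv l0 cross cub1 cub2 aNE s msq err1 err2 kk kT kB slack aL : R) :
  lbaw <= lba + lbw - l0 - cross + (cub1 + cub2) -> lba <= lb ->
  lbw <= lbv + kB -> lbv <= l0 + (kT - msq) ->
  aNE / 2 - kk * aL <= msq ->
  - cross <= aNE / 16 + err1 -> cub1 <= aNE / 16 + err2 -> cub2 <= aNE / 16 ->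
  0 <= aNE -> kB + kk * aL + err1 + err2 <= kk * slack -> s = kk * slack ->
  lbaw <= lb + (kT + s).
Proof. lra. Qed.

End Arithmetic.

(** * From lattice bounds to arbitrary sparse parameters *)

Section Deterministic.
Context {R : realType} {n p : nat} (D : 'I_n -> p.-tuple R * bool)
  (beta0 : 'rV[R]_p) (k M : nat) (a3 T aL r2 : R).
Implicit Types (w : 'I_p -> 'rV[R]_p) (K J : {set 'I_p}) (m : 'I_p -> int).

Definition unit_vec (j : 'I_p) : 'rV[R]_p := delta_mx ord0 j.

Definition comb w K (e : 'I_p -> R) : 'rV[R]_p := \sum_(j in K) e j *: w j.

(** The conclusion of the union bound: each active index costs [T], and a quadratic reserve with
    coefficient [aL] is kept for later errors. [M] only makes the lattice finite and enters no
    estimate. *)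
Definition lr_bound w (K0 : {set 'I_p}) : Prop :=
  forall K m, K != finset.set0 -> K \subset K0 ->
  (forall j, j \in K -> (`|m j| < M)%N) ->
  let v := comb w K (fun j => (m j)%:~R) in
  sparse k v -> a3 ^+ 2 * k%:R * sqnorm v <= 4^-1 ->
  \sum_i llr beta0 v (D i) <= #|K|%:R * T - aL * \sum_(j in K) (m j)%:~R ^+ 2.

Lemma combZ w K e (c : R) : comb (fun j => c *: w j) K e = c *: comb w K e.
Proof.
rewrite /comb scaler_sumr; apply: eq_bigr => j _.
by rewrite !scalerA mulrC.
Qed.

Lemma comb_unitE K (e : 'I_p -> R) i :
  comb unit_vec K e ord0 i = if i \in K then e i else 0.
Proof.
rewrite summxE; case: ifPn => iK.
  rewrite (bigD1 i)//= big1 ?addr0 => [|j /andP[_ ji]]; rewrite !mxE !eqxx/= ?mulr1//.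
  by rewrite eq_sym (negbTE ji) mulr0.
rewrite big1// => j jK; rewrite !mxE eqxx/=.
by case: eqP => [ij|_]; [move: iK; rewrite ij jK|rewrite mulr0].
Qed.

Lemma sqnorm_comb_unit K (e : 'I_p -> R) :
  sqnorm (comb unit_vec K e) = \sum_(j in K) e j ^+ 2.
Proof.
rewrite /sqnorm [RHS]big_mkcond; apply: eq_bigr => j _.
by rewrite comb_unitE; case: ifP => // _; rewrite expr0n.
Qed.

Lemma dot_unit (x : p.-tuple R) j : dot x (unit_vec j) = tnth x j.
Proof.
rewrite /dot (bigD1 j)//= mxE !eqxx mulr1 big1 ?addr0// => i ij.
by rewrite mxE eqxx (negbTE ij) mulr0.
Qed.

Lemma round_sqr (z : int) (c : R) : `|z%:~R - c| <= 1 ->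
  z%:~R ^+ 2 <= 2 * c ^+ 2 + 2 /\ c ^+ 2 / 2 - 1 <= z%:~R ^+ 2.
Proof.
move: (z%:~R : R) => x; rewrite ler_norml => /andP[h1 h2].
have d2 : (x - c) ^+ 2 <= 1 by nra.
by have := sqr_ge0 (2 * c - x); have := sqr_ge0 (2 * x - c); split; lra.
Qed.

Lemma absz_lt (z : int) (c : R) (x : R) : `|z%:~R - c| <= 1 -> c ^+ 2 <= x ^+ 2 ->
  0 <= x -> x + 1 < M%:R -> (`|z| < M)%N.
Proof.
move=> zc cx x0 xM; rewrite -(ltr_nat R) natr_absz intr_norm.
apply: le_lt_trans xM; rewrite -[z%:~R](subrK c) addrC.
apply: le_trans (ler_normD _ _) _; apply: lerD => //.
by rewrite -(ger0_norm x0) -ler_sqr ?nnegrE// !real_normK ?num_real.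
Qed.

Context (hX : forall i j, `|tnth (D i).1 j| <= a3).
Context (n_gt0 : (0 < n)%N) (a3_gt0 : 0 < a3) (r2_gt0 : 0 < r2) (T_ge0 : 0 <= T)
  (aL_gt0 : 0 < aL).
Context (k_r2 : k%:R / n%:R <= r2 / 8) (hM : Num.sqrt (n%:R * r2) + 1 < M%:R).

Let N : R := n%:R.
Let rho : R := (Num.sqrt N)^-1.

Let N_gt0 : 0 < N. Proof. by rewrite ltr0n. Qed.

Let sqrtN_gt0 : 0 < Num.sqrt N. Proof. by rewrite sqrtr_gt0 N_gt0. Qed.

Let sqrtN_sqr : Num.sqrt N ^+ 2 = N. Proof. by rewrite sqr_sqrtr ?ltW// N_gt0. Qed.

Lemma rho_sqr : rho ^+ 2 = N^-1. Proof. by rewrite /rho exprVn sqrtN_sqr. Qed.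

Let rhoK (x : R) : Num.sqrt N * x * rho = x.
Proof. by rewrite mulrAC mulfV ?mul1r// gt_eqF// sqrtN_gt0. Qed.

Lemma energy_unit j : energy D (rho *: unit_vec j) <= a3 ^+ 2.
Proof.
rewrite energyZ rho_sqr mulrC ler_pdivrMr ?N_gt0//.
apply: (@le_trans _ _ (\sum_(i < n) a3 ^+ 2)); last first.
  by rewrite sumr_const card_ord mulr_natr.
apply: ler_sum => i _; rewrite dot_unit -(real_normK (num_real _)).
by rewrite lerXn2r ?nnegrE// ltW.
Qed.

(** The point is first shrunk to length sqrt r2 and rounded. The reserve aL n r2 / 4 at the lattice
    point pays for [T] and the rounding cost of up to [k] coordinates and for [drop]; by concavity
    the original point is at least as bad as the shrunk one. *)
Lemma localisation (drop : R) u :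
  lr_bound (fun j => rho *: unit_vec j) finset.setT ->
  a3 ^+ 2 * k%:R * (3 * r2) <= 4^-1 -> 0 <= drop ->
  k%:R * T + k%:R * a3 ^+ 2 + drop <= aL * (N * (r2 / 4)) ->
  sparse k u -> r2 <= sqnorm u ->
  loglik D (beta0 + u) <= loglik D beta0 - drop.
Proof.
move=> lrb small drop0 big uk ur.
have s0 : 0 < sqnorm u by exact: lt_le_trans ur.
pose t := Num.sqrt (r2 / sqnorm u).
have t2 : t ^+ 2 = r2 / sqnorm u by rewrite sqr_sqrtr// divr_ge0 ?ltW.
have t0 : 0 < t by rewrite sqrtr_gt0 divr_gt0.
have t1 : t <= 1.
  rewrite -(@ler_sqr R) ?nnegrE ?(ltW t0)// t2 expr1n ler_pdivrMr// mul1r//.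
pose K := supp u; pose c j := Num.sqrt N * (t * u ord0 j).
have uE : t *: u = comb (fun j => rho *: unit_vec j) K c.
  apply/rowP => i; rewrite combZ !mxE comb_unitE /K in_supp /c.
  case: eqP => [->|_] /=; first by rewrite !mulr0.
  by rewrite [RHS]mulrC rhoK.
have sc : \sum_(j in K) c j ^+ 2 = N * r2.
  transitivity (N * sqnorm (t *: u)); last first.
    by rewrite sqnormZ t2 divfK// gt_eqF.
  rewrite uE combZ sqnormZ sqnorm_comb_unit rho_sqr mulrA mulfV ?mul1r//.
  by rewrite gt_eqF// N_gt0.
have cj j : j \in K -> c j ^+ 2 <= N * r2.
  move=> jK; rewrite -sc (bigD1 j)//= lerDl sumr_ge0// => i _; exact: sqr_ge0.
have [m [mc lm]] := @loglik_round_family R n p D (fun j => rho *: unit_vec j)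
  c (a3 ^+ 2) (enum K) beta0 (enum_uniq _) (fun j _ => energy_unit j).
rewrite !big_enum/= -/(comb _ _ c) -uE -/(comb _ K (fun j => (m j)%:~R)) -cardE in lm.
set v := comb _ _ _ in lm.
have Nr : n%:R * r2 = N * r2 by [].
have Kk : #|K|%:R <= k%:R :> R by rewrite ler_nat.
have k0 : 0 <= k%:R :> R by [].
have mM j : j \in K -> (`|m j| < M)%N.
  move=> jK; apply: (absz_lt (mc j) _ _ hM); last exact: sqrtr_ge0.
  by rewrite sqr_sqrtr ?cj// mulr_ge0// ltW// N_gt0.
have vE : v = comb (fun j => rho *: unit_vec j) K (fun j => (m j)%:~R) by [].
have sv : sqnorm v = N^-1 * \sum_(j in K) (m j)%:~R ^+ 2.
  by rewrite vE combZ sqnormZ rho_sqr sqnorm_comb_unit.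
(* At most [k] coordinates move, each by at most n^(-1/2), so the squared displacement is at most k
   / n. *)
have dv : sqnorm (v - t *: u) <= r2 / 8.
  rewrite uE vE !combZ -scalerBr sqnormZ rho_sqr.
  rewrite (_ : _ - _ = comb unit_vec K (fun j => (m j)%:~R - c j)); last first.
    by rewrite /comb -sumrB; apply: eq_bigr => j _; rewrite scalerBl.
  rewrite sqnorm_comb_unit; apply: le_trans k_r2; rewrite mulrC ler_wpM2r ?invr_ge0 ?(ltW N_gt0)//.
  apply: (@le_trans _ _ (\sum_(j in K) 1)); last by rewrite sumr_const.
  apply: ler_sum => j _; rewrite -(real_normK (num_real _)) expr_le1//.
have su : sqnorm (t *: u) = r2 by rewrite sqnormZ t2 divfK// gt_eqF.
have v_up : sqnorm v <= 3 * r2.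
  have := sqnormD_le (v - t *: u) (t *: u); rewrite subrK su.
  by move=> h; apply: loc_arith1 h dv r2_gt0.
have v_lo : r2 / 4 <= sqnorm v.
  have := sqnormD_le (t *: u - v) v; rewrite subrK su.
  have -> : sqnorm (t *: u - v) = sqnorm (v - t *: u).
    by rewrite -opprB -scaleN1r sqnormZ sqrrN expr1n mul1r.
  by move=> h; apply: loc_arith2 h dv r2_gt0.
have vk : sparse k v.
  apply: coord_space_sparse uk _; rewrite vE combZ; apply: coord_spaceZ => j jK.
  by rewrite comb_unitE; move: jK => /negbTE ->.
have K0 : K != finset.set0.
  apply/negP => /eqP K0; have : sqnorm v = 0.
    by rewrite sv K0 big1 ?mulr0// => j; rewrite finset.in_set0.
  by move=> v0; move: v_lo; rewrite v0 leNgt divr_gt0.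
have vs : a3 ^+ 2 * k%:R * sqnorm v <= 4^-1.
  apply: le_trans small; rewrite ler_wpM2l// mulr_ge0 ?sqr_ge0//.
have := lrb K m K0 (finset.subsetT _) mM vk vs.
rewrite -/v (_ : \sum_(j in K) _ = N * sqnorm v); last first.
  by rewrite sv mulrA mulfV ?mul1r// gt_eqF// N_gt0.
move=> hl.
have h1 : loglik D (beta0 + t *: u) <= loglik D beta0 - drop.
  apply: le_trans lm _; rewrite loglik_llr.
  have e1 : aL * (N * (r2 / 4)) <= aL * (N * sqnorm v).
    by rewrite ler_pM2l// ler_pM2l ?N_gt0.
  have e2 : #|K|%:R * T <= k%:R * T by rewrite ler_wpM2r.
  have e3 : #|K|%:R * a3 ^+ 2 <= k%:R * a3 ^+ 2 by rewrite ler_wpM2r ?sqr_ge0.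
  exact: loc_arith3 hl e1 e2 e3 big.
have t01 : 0 <= t <= 1 by rewrite (ltW t0) t1.
have := le_trans (loglik_segment D beta0 u t01) h1.
exact: loc_arith4.
Qed.

Section TrueModel.
Context (W : 'I_p -> 'rV[R]_p) (Q S : 'I_p -> 'I_p -> R) (A2 c dev : R).
Let J0 := supp beta0.
Let C1 := A2 / c.
Context (QC : forall i j, Q i j = Q j i) (c_gt0 : 0 < c) (A2_gt0 : 0 < A2)
  (dev_ge0 : 0 <= dev)
  (Q_lo : forall u, sparse k u -> c * sqnorm u <= bilin Q u u)
  (Q_up : forall u, sparse k u -> bilin Q u u <= A2 * sqnorm u)
  (S_up : forall u, sparse k u -> bilin S u u <= A2 * sqnorm u)
  (hW : forall j, j \notin J0 ->
    [/\ coord_space (finset.setU (finset.set1 j) J0) (W j), W j ord0 j = 1 &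
        forall a, coord_space J0 a -> bilin Q a (W j) = 0])
  (devS : forall j l, `|\sum_i 1 * tnth (D i).1 j * tnth (D i).1 l - N * S j l| <= N * dev)
  (devQ : forall j l, `|\sum_i logistic_var (dot (D i).1 beta0) *
     tnth (D i).1 j * tnth (D i).1 l - N * Q j l| <= N * dev)
  (dev_k : k%:R * dev <= 1).

Let C1_gt0 : 0 < C1. Proof. exact: divr_gt0. Qed.

Lemma bilin_dev (G H : 'I_p -> 'I_p -> R) u v :
  (forall j l, `|G j l - N * H j l| <= N * dev) ->
  `|bilin G u v - N * bilin H u v| <= N * dev * norm1 u * norm1 v.
Proof.
move=> GH; rewrite (_ : N * _ = bilin (fun j l => N * H j l) u v).
  by rewrite -bilinB; exact: bilin_norm1.
rewrite /bilin mulr_sumr; apply: eq_bigr => i _; rewrite mulr_sumr.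
by apply: eq_bigr => j _; rewrite !mulrA.
Qed.

(** On sparse vectors an entrywise deviation [dev] changes the normalized form by at most k dev <= 1
    times the squared norm, hence [A2 + 1]. *)
Lemma energy_upper u : sparse k u -> energy D u <= N * ((A2 + 1) * sqnorm u).
Proof.
move=> uk.
rewrite (_ : energy D u = bilin (fun j l => \sum_i 1 * tnth (D i).1 j * tnth (D i).1 l) u u).
  have := bilin_dev u u devS.
  rewrite ler_norml => /andP[_]; rewrite lerBlDr => h; apply: le_trans h _.
  rewrite mulrDl mulrDr [leRHS]addrC; apply: lerD; last first.
    by rewrite ler_wpM2l ?S_up// ltW// N_gt0.
  rewrite -!mulrA ler_wpM2l ?(ltW N_gt0)// mul1r -expr2.
  apply: le_trans (ler_wpM2l dev_ge0 (norm1_sqr uk)) _.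
  by rewrite mulrA [dev * _]mulrC -[leRHS]mul1r ler_wpM2r ?sqnorm_ge0.
rewrite -(sum_dot_bilin D (fun=> 1)).
by apply: eq_bigr => i _; rewrite mul1r expr2.
Qed.

Section Residual.
Context (K : {set 'I_p}) (KJ0 : K \subset finset.setC J0) (e : 'I_p -> R).

Lemma notin_J0 j : j \in K -> j \notin J0.
Proof. by move=> /(fintype.subsetP KJ0); rewrite finset.in_setC. Qed.

Lemma comb_coord : coord_space (finset.setU K J0) (comb W K e).
Proof.
apply: coord_space_sum => j jK; apply: coord_spaceZ.
have [h _ _] := hW (notin_J0 jK); apply: coord_spaceS h.
apply/fintype.subsetP => i; rewrite finset.in_setU1 finset.in_setU.
by move=> /orP[/eqP->|->]; rewrite ?jK ?orbT.
Qed.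

(** Outside J0 the residual [W j] agrees with the [j]-th coordinate vector, so subtracting the
    combination clears the coordinates in [K] and leaves a vector supported in J0. *)
Lemma comb_in j : j \in K -> comb W K e ord0 j = e j.
Proof.
move=> jK; rewrite summxE (bigD1 j)//= big1 ?addr0 => [|i /andP[iK ij]].
  by rewrite mxE; have [_ -> _] := hW (notin_J0 jK); rewrite mulr1.
have [h _ _] := hW (notin_J0 iK); rewrite mxE h ?mulr0//.
by rewrite finset.in_setU1 negb_or eq_sym ij notin_J0.
Qed.

Lemma comb_orth a : coord_space J0 a -> bilin Q a (comb W K e) = 0.
Proof.
move=> aJ; rewrite bilinC// /comb.
have : forall j, j \in K -> bilin Q (e j *: W j) a = 0.
  by move=> j jK; rewrite bilinZl bilinC//; have [_ _ ->] := hW (notin_J0 jK); rewrite ?mulr0.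
move=> h; elim/big_rec : _ => [|j v jK IH].
  by rewrite -(scale0r a) bilinZl mul0r.
by rewrite bilinDl h// IH addr0.
Qed.

Context (u : 'rV[R]_p) (uKJ : coord_space (finset.setU K J0) u)
  (Kk : (#|finset.setU K J0| <= k)%N) (ue : forall j, j \in K -> u ord0 j = e j).

Lemma residual_coord : coord_space J0 (u - comb W K e).
Proof.
move=> j jJ; rewrite !mxE; have [jK|jK] := boolP (j \in K).
  by rewrite ue// comb_in// subrr.
by rewrite uKJ ?comb_coord ?subrr// finset.in_setU negb_or jK.
Qed.

Lemma residual_pythagoras :
  bilin Q u u = bilin Q (u - comb W K e) (u - comb W K e) + bilin Q (comb W K e) (comb W K e).
Proof.
have gen x y : bilin Q x y = 0 ->
    bilin Q (x + y) (x + y) = bilin Q x x + bilin Q y y.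
  by move=> xy; rewrite !(bilinDl, bilinDr) [bilin Q y x]bilinC// xy addr0 add0r.
by rewrite -gen ?subrK// comb_orth//; exact: residual_coord.
Qed.

Lemma comb_sparse : sparse k (comb W K e).
Proof. exact: coord_space_sparse Kk comb_coord. Qed.

Lemma residual_sparse : sparse k (u - comb W K e).
Proof.
apply: coord_space_sparse Kk _; apply: coord_spaceS residual_coord.
exact: finset.subsetUr.
Qed.

Lemma Q_ge0 v : sparse k v -> 0 <= bilin Q v v.
Proof. by move=> vk; apply: le_trans (Q_lo vk); rewrite mulr_ge0 ?sqnorm_ge0// ltW. Qed.

(** Orthogonality makes both parts of [u] shorter than [u] in the norm of [Q]; returning to the
    Euclidean norm costs the condition number [C1]. The same holds for [comb_sqnorm]. *)
Lemma residual_sqnorm : sqnorm (u - comb W K e) <= C1 * sqnorm u.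
Proof.
rewrite /C1 mulrAC ler_pdivlMr// mulrC; apply: le_trans (Q_lo residual_sparse) _.
apply: le_trans (Q_up (coord_space_sparse Kk uKJ)).
by rewrite residual_pythagoras lerDl; apply: Q_ge0; exact: comb_sparse.
Qed.

Lemma comb_sqnorm : sqnorm (comb W K e) <= C1 * sqnorm u.
Proof.
rewrite /C1 mulrAC ler_pdivlMr// mulrC; apply: le_trans (Q_lo comb_sparse) _.
apply: le_trans (Q_up (coord_space_sparse Kk uKJ)).
by rewrite residual_pythagoras lerDr; apply: Q_ge0; exact: residual_sparse.
Qed.

End Residual.

(** The previous bound applied to the vector with coordinates [e] on [K] and zero elsewhere. *)
Lemma comb_sqnorm_le K e : K \subset finset.setC J0 -> (#|finset.setU K J0| <= k)%N ->
  sqnorm (comb W K e) <= C1 * \sum_(j in K) e j ^+ 2.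
Proof.
move=> KJ Kk; rewrite -sqnorm_comb_unit; apply: comb_sqnorm => // j jK.
  by rewrite comb_unitE; move: jK; rewrite finset.in_setU negb_or => /andP[/negbTE ->].
by rewrite comb_unitE jK.
Qed.

Lemma energy_W K j : K \subset finset.setC J0 -> (#|finset.setU K J0| <= k)%N ->
  j \in K -> energy D (rho *: W j) <= (A2 + 1) * C1.
Proof.
move=> KJ Kk jK.
have j1 : finset.set1 j \subset finset.setC J0.
  by rewrite finset.sub1set; exact: (fintype.subsetP KJ).
have jk : (#|finset.setU (finset.set1 j) J0| <= k)%N.
  apply: leq_trans Kk; apply: subset_leq_card; apply: finset.setSU.
  by rewrite finset.sub1set.
have WE : W j = comb W (finset.set1 j) (fun=> 1).
  by rewrite /comb finset.big_set1 scale1r.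
rewrite energyZ rho_sqr mulrC ler_pdivrMr ?N_gt0//.
apply: le_trans (energy_upper _) _; first by rewrite WE; exact: comb_sparse.
rewrite mulrC ler_wpM2r ?(ltW N_gt0)// ler_wpM2l ?addr_ge0 ?(ltW A2_gt0)//.
rewrite WE; apply: le_trans (comb_sqnorm_le _ j1 jk) _.
by rewrite finset.big_set1 expr1n mulr1.
Qed.

(** The size at which [eta] times the energy of the residual part is one sixteenth of aL n times its
    squared coordinates. The cross term and both cubic terms take such a share, within the half that
    rounding leaves of the reserve. *)
Let eta := aL / (16 * ((A2 + 1) * C1)).

(** The part supported in J0 is compared with [max_loglik D J0] at no cost, so only the residual
    part is rounded and charged, once per index of J \ J0. What the reserve does not absorb of the
    interaction fits into [slack]. *)
Lemma true_model (slack : R) (J : {set 'I_p}) beta :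
  lr_bound (fun j => rho *: W j) (finset.setC J0) ->
  a3 ^+ 2 * k%:R * (3 * (C1 * r2)) <= 4^-1 ->
  a3 ^+ 2 * k%:R * (C1 * r2) <= eta ^+ 2 ->
  aL + (A2 + 1) * C1 + 4 * N * dev ^+ 2 * k%:R ^+ 2 * C1 ^+ 2 * r2 / aL +
    a3 ^+ 2 * k%:R * (C1 * r2) * (N * ((A2 + 1) * (C1 * r2))) / (4 * eta) <= slack ->
  J0 \subset J -> J != J0 -> (#|J| <= k)%N -> coord_space J beta ->
  sqnorm (beta - beta0) <= r2 ->
  loglik D beta <= max_loglik D J0 + #|finset.setD J J0|%:R * (T + slack).
Proof.
move=> lrb small1 small2 hslack J0J JJ0 Jk bJ br.
set K := finset.setD J J0; set u := beta - beta0 in br *.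
pose e j := u ord0 j.
have KJU : finset.setU K J0 = J.
  apply/setP => j; rewrite finset.in_setU finset.in_setD.
  by case: (boolP (j \in J0)) => [/(fintype.subsetP J0J) ->|_]; rewrite ?orbT ?orbF.
have KJ : K \subset finset.setC J0.
  by apply/fintype.subsetP => j; rewrite finset.in_setD finset.in_setC => /andP[].
have Kk : (#|finset.setU K J0| <= k)%N by rewrite KJU.
have b0J : coord_space J beta0 by exact/supp_subP.
have uJ : coord_space (finset.setU K J0) u.
  by rewrite KJU; apply: coord_spaceD => //; exact: coord_spaceN.
have ue j : j \in K -> u ord0 j = e j by [].
set w := comb W K e; set a := u - w.
have wk : sparse k w by exact: comb_sparse.
have ak : sparse k a by exact: residual_sparse.
have aJ0 : coord_space J0 a by exact: residual_coord.
have bE : beta = beta0 + a + w by rewrite -addrA subrK /u addrC subrK.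
set E2 := \sum_(j in K) e j ^+ 2.
have E2_ge0 : 0 <= E2 by apply: sumr_ge0 => j _; exact: sqr_ge0.
have E2u : E2 <= sqnorm u.
  by rewrite /E2 /sqnorm [leRHS](bigID (mem K))/= lerDl sumr_ge0// => j _; exact: sqr_ge0.
have E2r : E2 <= r2 by exact: le_trans br.
have k0 : 0 <= k%:R :> R by [].
have C0 := ltW C1_gt0; have N0 := ltW N_gt0.
have a20 : 0 <= a3 ^+ 2 by exact: sqr_ge0.
have w2 : sqnorm w <= C1 * E2 by exact: comb_sqnorm_le.
have a2 : sqnorm a <= C1 * r2.
  by apply: le_trans (residual_sqnorm KJ uJ Kk ue) _; rewrite ler_wpM2l.
pose cc j := Num.sqrt N * e j.
have wE : comb (fun j => rho *: W j) K cc = w.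
  by apply: eq_bigr => j _; rewrite scalerA rhoK.
have [m [mc lm]] := @loglik_round_family R n p D (fun j => rho *: W j)
  cc ((A2 + 1) * C1) (enum K) beta0 (enum_uniq _)
  (fun j h => energy_W KJ Kk (etrans (esym (mem_enum _ _)) h)).
rewrite !big_enum/= -/(comb _ _ cc) wE -/(comb _ K (fun j => (m j)%:~R)) -cardE in lm.
set v := comb _ _ _ in lm.
have cc2 j : cc j ^+ 2 = N * e j ^+ 2 by rewrite exprMn sqrtN_sqr.
have Kk' : #|K|%:R <= k%:R :> R.
  by rewrite ler_nat; apply: leq_trans Kk; apply: subset_leq_card; exact: finset.subsetUl.
have mM j : j \in K -> (`|m j| < M)%N.
  move=> jK; apply: (absz_lt (mc j) _ _ hM); last exact: sqrtr_ge0.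
  rewrite sqr_sqrtr ?mulr_ge0 ?(ltW r2_gt0)// cc2 ler_wpM2l//; apply: le_trans E2r.
  by rewrite /E2 (bigD1 j)//= lerDl sumr_ge0// => i _; exact: sqr_ge0.
set m2 := \sum_(j in K) (m j)%:~R ^+ 2 : R.
have m2_up : m2 <= 2 * (N * E2) + 2 * #|K|%:R.
  rewrite /E2 !mulr_sumr -sumr_const mulr_sumr -big_split; apply: ler_sum => j _ /=.
  by rewrite mulr1 -cc2; have [] := round_sqr (mc j).
have m2_lo : N * E2 / 2 - #|K|%:R <= m2.
  rewrite /E2 mulr_sumr mulr_suml -sumr_const -sumrB; apply: ler_sum => j _ /=.
  by rewrite -cc2; have [] := round_sqr (mc j).
have vE : v = comb W K (fun j => rho * (m j)%:~R).
  by apply: eq_bigr => j _; rewrite scalerA mulrC.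
have vk : sparse k v by rewrite vE; exact: comb_sparse.
have sv : sqnorm v <= 3 * (C1 * r2).
  rewrite vE; apply: le_trans (comb_sqnorm_le _ KJ Kk) _.
  rewrite mulrCA ler_wpM2l//.
  rewrite (_ : \sum_(j in K) _ = m2 / N); last first.
    by rewrite /m2 mulr_suml; apply: eq_bigr => j _; rewrite exprMn rho_sqr mulrC.
  rewrite ler_pdivrMr ?N_gt0//.
  have h8 : k%:R <= r2 / 8 * N by rewrite -ler_pdivrMr ?N_gt0.
  have hE := ler_wpM2l N0 E2r.
  have hr : 0 <= N * r2 by rewrite mulr_ge0// ltW.
  exact: sv_arith m2_up Kk' h8 hE hr.
have vs : a3 ^+ 2 * k%:R * sqnorm v <= 4^-1.
  by apply: le_trans small1; rewrite ler_wpM2l// mulr_ge0.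
have K0 : K != finset.set0.
  apply: contra JJ0; rewrite finset.setD_eq0 => JJ0; rewrite finset.eqEsubset JJ0//.
have K1 : 1 <= #|K|%:R :> R by rewrite ler1n card_gt0.
have hl := lrb K m K0 KJ mM vk vs.
rewrite -/m2 in hl.
have inter := loglik_interaction D beta0 a w; rewrite -bE big_split/= in inter.
have A21 : 0 < A2 + 1 by rewrite addr_gt0.
have AC : 0 < (A2 + 1) * C1 by rewrite mulr_gt0 ?C1_gt0.
have eta0 : 0 < eta by rewrite divr_gt0// mulr_gt0.
have eta4 : 0 <= (4 * eta)^-1 by rewrite invr_ge0 mulr_ge0// ltW.
have energy_w : energy D w <= N * ((A2 + 1) * (C1 * E2)).
  apply: le_trans (energy_upper wk) _; rewrite ler_wpM2l//.
  by rewrite ler_wpM2l// ltW.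
have energy_a : energy D a <= N * ((A2 + 1) * (C1 * r2)).
  apply: le_trans (energy_upper ak) _; rewrite ler_wpM2l//.
  by rewrite ler_wpM2l// ltW.
have alpha2 i : dot (D i).1 a ^+ 2 <= a3 ^+ 2 * k%:R * (C1 * r2).
  apply: le_trans (dot_sqr_sparse ak (hX i)) _.
  by rewrite ler_wpM2l// mulr_ge0.
have etaE : eta * (N * ((A2 + 1) * (C1 * E2))) = aL * N * E2 / 16.
  rewrite (_ : N * _ = N * E2 * ((A2 + 1) * C1)); last by ring.
  rewrite /eta; move: ((A2 + 1) * C1) AC => g g0.
  by field; rewrite gt_eqF.
(* Arithmetic-geometric mean with weight [eta]: the fourth power of X^T a that results is its
   uniform square bound times its square. *)
have cub1 : \sum_i dot (D i).1 a ^+ 2 * `|dot (D i).1 w| <=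
    aL * N * E2 / 16 +
    a3 ^+ 2 * k%:R * (C1 * r2) * (N * ((A2 + 1) * (C1 * r2))) / (4 * eta).
  apply: (@le_trans _ _ (\sum_i (eta * dot (D i).1 w ^+ 2 +
      a3 ^+ 2 * k%:R * (C1 * r2) / (4 * eta) * dot (D i).1 a ^+ 2))).
    apply: ler_sum => i _; apply: le_trans (amgm _ _ eta0) _.
    rewrite real_normK ?num_real// lerD2l [leRHS]mulrAC.
    by rewrite (ler_wpM2r eta4)// [leLHS]expr2 ler_wpM2r ?sqr_ge0.
  rewrite big_split/= -!mulr_sumr -etaE; apply: lerD.
    by rewrite ler_pM2l.
  rewrite [leRHS]mulrAC ler_wpM2l//; apply: mulr_ge0 eta4.
  by apply: mulr_ge0; apply: mulr_ge0 => //; exact: ltW.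
(* Here |X^T a| <= [eta] for each observation, by the second smallness condition. *)
have cub2 : \sum_i `|dot (D i).1 a| * dot (D i).1 w ^+ 2 <= aL * N * E2 / 16.
  rewrite -etaE; apply: (@le_trans _ _ (eta * energy D w)); last by rewrite ler_pM2l.
  rewrite /energy mulr_sumr; apply: ler_sum => i _; rewrite ler_wpM2r ?sqr_ge0//.
  rewrite -(ger0_norm (ltW eta0)) -ler_sqr ?nnegrE// !real_normK ?num_real//.
  exact: le_trans (alpha2 i) _.
have kpos : 0 < k%:R :> R by apply: lt_le_trans Kk'; exact: lt_le_trans K1.
(* Orthogonality for [Q] kills the population cross term; only the deviation of the empirical Fisher
   information remains. *)
have cross : - (\sum_i logistic_var (dot (D i).1 beta0) * dot (D i).1 a * dot (D i).1 w)
    <= aL * N * E2 / 16 + 4 * N * dev ^+ 2 * k%:R ^+ 2 * C1 ^+ 2 * r2 / aL.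
  rewrite (sum_dot_bilin D (fun x => logistic_var (dot x beta0))).
  have := bilin_dev a w devQ; rewrite comb_orth// mulr0 subr0 ler_norml => /andP[h _].
  rewrite lerNl in h; apply: le_trans h _.
  (* Chosen so that mu k C1 = aL / 16. *)
  pose mu := aL / (16 * (k%:R * C1)).
  have mu0 : 0 < mu by rewrite divr_gt0// mulr_gt0// mulr_gt0// C1_gt0.
  have mu4 : 0 <= (4 * mu)^-1 by rewrite invr_ge0 mulr_ge0// ltW.
  rewrite (_ : _ * norm1 w = N * (dev * norm1 a * norm1 w)); last by rewrite !mulrA.
  apply: le_trans (ler_wpM2l N0 (amgm _ _ mu0)) _.
  apply: (@le_trans _ _ (N * (mu * (k%:R * (C1 * E2)) +
     dev ^+ 2 * (k%:R * (C1 * r2)) / (4 * mu)))).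
    rewrite ler_wpM2l//; apply: lerD.
      by rewrite ler_pM2l//; apply: le_trans (norm1_sqr wk) _; rewrite ler_wpM2l.
    rewrite (ler_wpM2r mu4)// exprMn ler_wpM2l ?sqr_ge0//.
    by apply: le_trans (norm1_sqr ak) _; rewrite ler_wpM2l.
  rewrite le_eqVlt; apply/orP; left; apply/eqP; rewrite /mu.
  move: C1 C1_gt0 => g g0.
  by field; rewrite (gt_eqF aL_gt0) (gt_eqF g0) (gt_eqF kpos).
have aNE0 : 0 <= aL * N * E2 by rewrite !mulr_ge0// ltW.
have r0 := ltW r2_gt0.
have e1_ge0 : 0 <= 4 * N * dev ^+ 2 * k%:R ^+ 2 * C1 ^+ 2 * r2 / aL.
  rewrite divr_ge0 ?(ltW aL_gt0)// mulr_ge0// mulr_ge0 ?sqr_ge0//.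
  by rewrite mulr_ge0 ?sqr_ge0// mulr_ge0 ?sqr_ge0// mulr_ge0.
have e2_ge0 : 0 <= a3 ^+ 2 * k%:R * (C1 * r2) * (N * ((A2 + 1) * (C1 * r2))) / (4 * eta).
  have c0 : 0 <= C1 * r2 by rewrite mulr_ge0.
  rewrite (mulr_ge0 _ eta4)// mulr_ge0//; first by rewrite mulr_ge0// mulr_ge0.
  by rewrite mulr_ge0// mulr_ge0// ltW.
rewrite mulrDr.
apply: (true_arith inter (le_max_loglik _ _) lm _ _ cross cub1 cub2 aNE0 _ erefl).
- by apply: coord_spaceD => //; exact: coord_space_supp.
- by rewrite loglik_llr lerD2l; exact: hl.
- exact: lo_arith aL_gt0 m2_lo.
- exact: slack_arith K1 e1_ge0 e2_ge0 hslack.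
Qed.

End TrueModel.

End Deterministic.

(** * Events of high probability *)

Section UnionBound.
Context {d : measure_display} {T : measurableType d} {R : realType}
  (P : probability T R) (I : finType) (Q : pred I) (A : I -> set T).

Lemma union_bound : (forall i, measurable (A i)) ->
  (P (\big[setU/set0]_(i | Q i) A i) <= \sum_(i | Q i) P (A i))%E.
Proof.
move=> mA; elim: (index_enum I) => [|i s IH]; first by rewrite !big_nil measure0.
rewrite !big_cons; case: ifP => // _.
apply: le_trans (measureU2 _ _ _) _ => //; first exact: bigsetU_measurable.
exact: leeD2l.
Qed.

Lemma notin_bigsetU w : ~ (\big[setU/set0]_(i | Q i) A i) w ->
  forall i, Q i -> ~ A i w.
Proof. by move=> h i Qi Aw; apply: h; rewrite (bigD1 i)//=; left. Qed.

End UnionBound.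

(** * Counting lattice points with weights *)

Section Lattice.
Context {R : realType} {p M : nat}.
Implicit Types (f : {ffun 'I_p -> option (bool * 'I_M)}).

(* [None] marks a coordinate outside the model, so that a model together with
   its integer coordinates is a single finite function. *)
Definition signed_int (z : option (bool * 'I_M)) : int :=
  if z is Some (b, i) then if b then - (i : nat)%:Z else (i : nat)%:Z else 0.

Definition lattice_supp f : {set 'I_p} := finset (fun j => f j != None).

(** An integer of absolute value at least [M] would become [None] and drop out of the model;
    [lattice_codeP] assumes this away. The integer 0 remains a legitimate active coordinate,
    distinct from [None]. *)
Definition lattice_code (K : {set 'I_p}) (m : 'I_p -> int) :
    {ffun 'I_p -> option (bool * 'I_M)} :=
  [ffun j => if j \in K then omap (pair (m j < 0)) (insub `|m j|%N) else None].

Lemma lattice_codeP (K : {set 'I_p}) (m : 'I_p -> int) : (forall j, j \in K -> (`|m j| < M)%N) ->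
  lattice_supp (lattice_code K m) = K /\
  forall j, j \in K -> signed_int (lattice_code K m j) = m j.
Proof.
move=> mM; split; last first.
  move=> j jK; rewrite ffunE jK insubT ?mM//= => h.
  case: ifP => m0; first by rewrite ltz0_abs// opprK.
  by rewrite gez0_abs// leNgt m0.
apply/setP => j; rewrite finset.inE ffunE; case: ifP => // jK.
by rewrite insubT ?mM.
Qed.

Definition lattice_weight (x theta : R) (z : option (bool * 'I_M)) : R :=
  if z is Some (_, i) then x * theta ^+ i else 1.

(** The sum factorizes over coordinates into the p-th power of 1 + 2 x times a geometric sum, where
    2 counts the signs. *)
Lemma sum_lattice_weight (x theta : R) : 0 <= x -> 0 < theta < 1 ->
  \sum_(f : {ffun 'I_p -> option (bool * 'I_M)}) \prod_j lattice_weight x theta (f j) <=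
   expR (p%:R * (2 * x / (1 - theta))).
Proof.
move=> x0 /andP[t0 t1].
rewrite -(bigA_distr_bigA (fun=> lattice_weight x theta)) prodr_const card_ord.
have -> : \sum_z lattice_weight x theta z = 1 + 2 * x * \sum_(i < M) theta ^+ i.
  have -> (g : option (bool * 'I_M) -> R) : \sum_z g z = g None + \sum_z g (Some z).
    rewrite (bigD1 None)//=; congr (_ + _).
    rewrite (reindex_omap Some id)/=; last by case.
    by apply: eq_bigl => z; rewrite eqxx.
  congr (_ + _).
  rewrite (eq_bigr (fun z : bool * 'I_M => x * theta ^+ z.2)); last by case.
  rewrite -(pair_bigA _ (fun (b : bool) (i : 'I_M) => x * theta ^+ i))/=.
  by rewrite big_bool/= -mulr_sumr; ring.
have gs : \sum_(i < M) theta ^+ i <= (1 - theta)^-1.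
  have t1' : 0 < 1 - theta by rewrite subr_gt0.
  rewrite -[leRHS]mul1r ler_pdivlMr// mulrC.
  have -> : (1 - theta) * \sum_(i < M) theta ^+ i = 1 - theta ^+ M.
    by rewrite -[1 - theta]opprB mulNr -subrX1 opprB.
  by rewrite lerBlDr lerDl exprn_ge0// ltW.
rewrite expRM_natl lerXn2r ?nnegrE ?expR_ge0//.
  by rewrite addr_ge0// mulr_ge0 ?mulr_ge0// sumr_ge0// => i _; rewrite exprn_ge0// ltW.
apply: le_trans (expR_ge1Dx _); rewrite lerD2l ler_wpM2l// mulr_ge0//.
Qed.

End Lattice.

(** Lowering the threshold by eta c1 m2 uses up less than half of the decay 2 eta c1 m2; the amount
    discarded is eta^2 c1 m2. *)
Lemma tail_arith {R : realType} (eta Th c1 m2 k : R) : 0 <= c1 * m2 ->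
  - ((1 - eta) * (k * Th - eta * c1 * m2)) - 2 * eta * (c1 * m2) <=
  - ((1 - eta) * Th) * k - eta * c1 * m2.
Proof. by move=> /(ler_wpM2l (sqr_ge0 eta)); lra. Qed.

Section LatticeBound.
Context {d : measure_display} {T : measurableType d} {R : realType}
  (P : probability T R) (n p k M : nat) (Z : 'I_n -> {RV P >-> (p.-tuple R * bool)%type})
  (i0 : 'I_n) (beta0 : 'rV[R]_p) (a3 Th c1 eta : R) (w : 'I_p -> 'rV[R]_p)
  (K0 : {set 'I_p}).
Context (Ziid : iid Z) (Th_ge0 : 0 <= Th) (c1_gt0 : 0 < c1) (eta_gt0 : 0 < eta)
  (eta_le : eta <= 2^-1)
  (llr1 : forall v, (\int[P]_s (expR (llr beta0 v (Z i0 s)))%:E = 1)%E)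
  (llr2 : forall v, sparse k v -> a3 ^+ 2 * k%:R * sqnorm v <= 4^-1 ->
    (\int[P]_s (expR (2^-1 * llr beta0 v (Z i0 s)))%:E <= (expR (- (c1 * sqnorm v)))%:E)%E)
  (w_lo : forall (K : {set 'I_p}) (e : 'I_p -> R), K \subset K0 ->
    n%:R^-1 * \sum_(j in K) e j ^+ 2 <= sqnorm (comb w K e)).

(* Weighted geometric mean of the Chernoff bounds at exponents 1 and 1/2: the
   first gives the sharp rate exp (- t), the second a factor decaying in v. *)
Lemma llr_tail (v : 'rV[R]_p) (t m2 : R) : sparse k v -> a3 ^+ 2 * k%:R * sqnorm v <= 4^-1 ->
  m2 <= n%:R * sqnorm v ->
  (P [set s | t <= \sum_i llr beta0 v (Z i s)]%R <=
   (expR (- ((1 - eta) * t) - 2 * eta * (c1 * m2)))%:E)%E.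
Proof.
move=> vk vs mv.
have A1 : (P [set s | t <= \sum_i llr beta0 v (Z i s)]%R <= (expR (- t))%:E)%E.
  have := @iid_chernoff _ _ _ _ _ P n Z i0 (llr beta0 v) 1 t Ziid (measurable_llr _ _).
  by rewrite llr1 expr1n mul1r => /(_ (lexx _)).
have A2 : (P [set s | t <= \sum_i llr beta0 v (Z i s)]%R <=
    (expR (- (t / 2) - c1 * m2))%:E)%E.
  have := @iid_chernoff _ _ _ _ _ P n Z i0 (fun z => 2^-1 * llr beta0 v z)
    (expR (- (c1 * sqnorm v))) (t / 2) Ziid.
  have -> : [set s | t / 2 <= \sum_i 2^-1 * llr beta0 v (Z i s)]%R =
            [set s | t <= \sum_i llr beta0 v (Z i s)]%R.
    by apply/seteqP; split => s /=; rewrite -mulr_sumr mulrC ler_pM2l.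
  move=> /(_ _ (llr2 vk vs)) h; apply: le_trans (h _) _.
    by apply: measurable_funM => //; exact: measurable_llr.
  rewrite lee_fin -expRM_natl -expRD ler_expR addrC lerD2l mulrN lerN2.
  by rewrite mulrCA ler_pM2l.
(* The weights are 1 - 2 eta and 2 eta, and the smaller bound is at most the weighted geometric
   mean. *)
have [AB|BA] := leP (- t) (- (t / 2) - c1 * m2).
  apply: le_trans A1 _; rewrite lee_fin ler_expR.
  by have := ler_wpM2l (ltW eta_gt0) AB; lra.
apply: le_trans A2 _; rewrite lee_fin ler_expR.
have e2 : 0 <= 1 - 2 * eta by move: eta_le; lra.
by have := ler_wpM2l e2 (ltW BA); lra.
Qed.

Let aL := eta * c1.

Definition lattice_point (f : {ffun 'I_p -> option (bool * 'I_M)}) : 'rV[R]_p :=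
  comb w (lattice_supp f) (fun j => (signed_int (f j))%:~R).

Definition lattice_ok (f : {ffun 'I_p -> option (bool * 'I_M)}) : bool :=
  [&& f != [ffun=> None], lattice_supp f \subset K0,
      (#|supp (lattice_point f)| <= k)%N & a3 ^+ 2 * k%:R * sqnorm (lattice_point f) <= 4^-1].

Definition lattice_bad f : set T :=
  [set s | #|lattice_supp f|%:R * Th - aL * \sum_(j in lattice_supp f) (signed_int (f j))%:~R ^+ 2
    <= \sum_i llr beta0 (lattice_point f) (Z i s)].

Lemma measurable_lattice_bad f : measurable (lattice_bad f).
Proof.
rewrite -[X in measurable X]setTI.
have ms : measurable_fun setT (fun s => \sum_i llr beta0 (lattice_point f) (Z i s)).
  by apply: measurable_sum => i; apply: (measurableT_comp (measurable_llr _ _)).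
rewrite (_ : lattice_bad f = (fun s => \sum_i llr beta0 (lattice_point f) (Z i s)) @^-1`
  `[#|lattice_supp f|%:R * Th -
     aL * \sum_(j in lattice_supp f) (signed_int (f j))%:~R ^+ 2, +oo[%classic).
  exact: ms.
by apply/seteqP; split=> s /=; rewrite in_itv/= andbT.
Qed.

(** The Gaussian decay is weakened from m^2 to |m| in each coordinate, so that geometric series
    suffice. *)
Lemma lattice_bad_prob f : lattice_ok f -> (P (lattice_bad f) <=
  (\prod_j lattice_weight (expR (- ((1 - eta) * Th))) (expR (- aL)) (f j))%:E)%E.
Proof.
move=> /and4P[_ fK fk fs]; set m2 := \sum_(j in lattice_supp f) (signed_int (f j))%:~R ^+ 2 : R.
have n0 : 0 < n%:R :> R by rewrite ltr0n; case: (i0) => i; case: n.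
have m2v : m2 <= n%:R * sqnorm (lattice_point f).
  by have := w_lo (fun j => (signed_int (f j))%:~R) fK; rewrite mulrC ler_pdivrMr// mulrC.
apply: le_trans (llr_tail _ fk fs m2v) _; rewrite lee_fin -/m2.
have aL0 : 0 <= aL by rewrite mulr_ge0// ltW.
have m20 : 0 <= m2 by apply: sumr_ge0 => j _; exact: sqr_ge0.
apply: (@le_trans _ _ (expR (\sum_(j in lattice_supp f)
    (- ((1 - eta) * Th) - aL * (signed_int (f j))%:~R ^+ 2)))).
  rewrite ler_expR sumrB sumr_const -mulr_sumr -/m2 -(mulr_natr (- _) #|lattice_supp f|) /aL.
  by apply: tail_arith; rewrite mulr_ge0// ltW.
rewrite expR_sum big_mkcond; apply: ler_prod => j _.
rewrite finset.inE; case: (f j) => [[b i]|] /=; last by rewrite ler01 lexx.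
rewrite expR_ge0/= expRD ler_wpM2l ?expR_ge0// -expRM_natl ler_expR.
have sq (x : nat) : x%:R <= x%:R ^+ 2 :> R.
  by case: x => [|x]; rewrite ?expr0n// ler_eXnr// ler1n.
rewrite mulrN lerN2 mulrC (ler_wpM2l aL0)//; apply: le_trans (sq i) _.
by case: b; rewrite ?mulrNz ?sqrrN.
Qed.

Definition lattice_event : set T := \big[setU/set0]_(f | lattice_ok f) lattice_bad f.

Lemma measurable_lattice_event : measurable lattice_event.
Proof. by apply: bigsetU_measurable => f _; exact: measurable_lattice_bad. Qed.

(** The empty model has weight 1 and is not among the bad points. Subtracting it is what makes the
    bound tend to 0 instead of 1. *)
Lemma lattice_event_prob : (P lattice_event <=
  (expR (p%:R * (2 * expR (- ((1 - eta) * Th)) / (1 - expR (- aL)))) - 1)%:E)%E.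
Proof.
apply: le_trans (union_bound _ _ measurable_lattice_bad) _.
apply: le_trans (lee_sum _ (fun f => @lattice_bad_prob f)) _.
rewrite sumEFin lee_fin lerBrDr.
have t01 : 0 < expR (- aL) < 1 by rewrite expR_gt0 -expR0 ltr_expR oppr_lt0 mulr_gt0.
apply: le_trans (sum_lattice_weight _ t01); last exact: expR_ge0.
have g0 z : 0 <= lattice_weight (expR (- ((1 - eta) * Th))) (expR (- aL)) z :> R.
  by case: z => [[b i]|] //=; rewrite mulr_ge0 ?exprn_ge0 ?expR_ge0.
rewrite [leRHS](bigD1 [ffun=> None])//= [leLHS]addrC; apply: lerD.
  by rewrite [leRHS]big1// => j _; rewrite ffunE.
rewrite big_mkcond [leRHS]big_mkcond; apply: ler_sum => f _.
case: ifP => [/andP[-> _]//|_]; case: ifP => // _.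
by apply: prodr_ge0.
Qed.

Lemma lattice_event_lr_bound s : ~ lattice_event s ->
  lr_bound (fun i => Z i s) beta0 k M a3 Th aL w K0.
Proof.
move=> /notin_bigsetU h K m Kn0 KK0 mM v vk vs.
have [Kc mc] := @lattice_codeP p M K m mM.
pose f := @lattice_code p M K m.
have vE : lattice_point f = v.
  rewrite /lattice_point /f Kc; apply: eq_bigr => j jK; by rewrite mc.
have := h f; rewrite /lattice_ok vE /f Kc KK0 vk vs !andbT.
have -> : @lattice_code p M K m != [ffun=> None].
  apply/negP => /eqP f0; move/negP : Kn0; apply; rewrite -Kc f0; apply/eqP/setP => j.
  by rewrite !finset.inE ffunE.
move=> /(_ isT) /negP; rewrite /lattice_bad/= -ltNge vE Kc => /ltW.
rewrite (eq_bigr (fun j => (m j)%:~R ^+ 2))// => j jK.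
by rewrite mc.
Qed.

End LatticeBound.

(** * Concentration of the empirical Gram matrices *)

Section GramEvent.
Context {d : measure_display} {T : measurableType d} {R : realType}
  (P : probability T R) (n p : nat) (Z : 'I_n -> {RV P >-> (p.-tuple R * bool)%type})
  (i0 : 'I_n) (a3 L : R) (g : p.-tuple R -> R).
Context (Ziid : iid Z) (a3_gt0 : 0 < a3) (L_ge0 : 0 <= L)
  (Xbd : forall j, {ae P, forall s, `|tnth (Z i0 s).1 j| <= a3})
  (mg : measurable_fun setT g) (g01 : forall x, 0 <= g x <= 1)
  (L_small : L / n%:R <= 16^-1).

(** With Chernoff exponent sqrt (L / n) / a3^2 the moment bound contributes 8 L and this deviation
    -12 L, which leaves -4 L to beat the p^2 entries. *)
Definition gram_dev : R := 12 * a3 ^+ 2 * Num.sqrt (L / n%:R).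

Let sgn (b : bool) : R := if b then -1 else 1.

Definition gram_bad (t : bool * 'I_p * 'I_p) : set T :=
  [set s | n%:R * gram_dev <= \sum_i sgn t.1.1 *
    (g (Z i s).1 * tnth (Z i s).1 t.1.2 * tnth (Z i s).1 t.2 - pop_gram (Z i0) g t.1.2 t.2)].

Lemma measurable_gram_term (c m : R) j l : measurable_fun setT
  (fun z : p.-tuple R * bool => c * (g z.1 * tnth z.1 j * tnth z.1 l - m)).
Proof.
have mt i : measurable_fun setT (fun z : p.-tuple R * bool => tnth z.1 i).
  exact: (measurableT_comp (@measurable_tnth _ _ p i)).
apply: measurable_funM => //; apply: measurable_funB => //.
by do 2 (apply: measurable_funM => //); exact: (measurableT_comp mg).
Qed.

Lemma measurable_gram_bad t : measurable (gram_bad t).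
Proof.
rewrite -[X in measurable X]setTI.
pose f s := \sum_i sgn t.1.1 *
    (g (Z i s).1 * tnth (Z i s).1 t.1.2 * tnth (Z i s).1 t.2 - pop_gram (Z i0) g t.1.2 t.2).
have mf : measurable_fun setT f.
  by apply: measurable_sum => i; apply: (measurableT_comp (measurable_gram_term _ _ _ _)).
rewrite (_ : gram_bad t = f @^-1` `[n%:R * gram_dev, +oo[%classic); first exact: mf.
by apply/seteqP; split=> s /=; rewrite in_itv/= andbT.
Qed.

Lemma gram_bad_prob t : (P (gram_bad t) <= (expR (- (4 * L)))%:E)%E.
Proof.
have n0 : 0 < n%:R :> R by rewrite ltr0n; case: (i0) => i; case: n.
set s0 := Num.sqrt (L / n%:R).
have s00 : 0 <= s0 by exact: sqrtr_ge0.
have s2 : s0 ^+ 2 = L / n%:R by rewrite sqr_sqrtr// divr_ge0// ltW.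
have s4 : s0 <= 4^-1.
  rewrite -(@ler_sqr R) ?nnegrE//  s2; apply: le_trans L_small _.
  by rewrite le_eqVlt; apply/orP; left; apply/eqP; field.
pose lam := s0 / a3 ^+ 2.
have lam0 : 0 <= lam by rewrite divr_ge0 ?sqr_ge0.
have a2 : 0 < a3 ^+ 2 by rewrite exprn_gt0.
have n1 b : `|sgn b| = 1 by case: b; rewrite /= ?normrN normr1.
have n2 b : sgn b ^+ 2 = 1 by case: b; rewrite /= ?sqrrN expr1n.
have lsm : `|lam * sgn t.1.1| * a3 ^+ 2 <= 4^-1.
  by rewrite normrM n1 mulr1 (ger0_norm lam0) /lam divfK// gt_eqF.
have h := @iid_chernoff _ _ _ _ _ P n Z i0
  (fun z => lam * sgn t.1.1 * (g z.1 * tnth z.1 t.1.2 * tnth z.1 t.2 - pop_gram (Z i0) g t.1.2 t.2))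
  (expR (8 * (lam * sgn t.1.1) ^+ 2 * a3 ^+ 4)) (lam * (n%:R * gram_dev)) Ziid
  (measurable_gram_term _ _ _ _) (gram_mgf Xbd mg g01 t.1.2 t.2 lsm).
(* A zero exponent occurs only for L = 0, where the claimed bound is 1. *)
have [lam00|lamn0] := eqVneq lam 0.
  have L0 : L = 0.
    apply/eqP; move/eqP: lam00; rewrite mulf_eq0 invr_eq0 (gt_eqF a2) orbF => /eqP s0'.
    have := s2; rewrite s0' expr0n => /esym/eqP; rewrite mulf_eq0 invr_eq0.
    by rewrite (gt_eqF n0) orbF.
  by rewrite L0 mulr0 oppr0 expR0; apply: probability_le1; exact: measurable_gram_bad.
have lamp : 0 < lam by rewrite lt_neqAle eq_sym lamn0.
rewrite (_ : gram_bad t = [set s | lam * (n%:R * gram_dev) <= \sum_i lam * sgn t.1.1 *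
  (g (Z i s).1 * tnth (Z i s).1 t.1.2 * tnth (Z i s).1 t.2 - pop_gram (Z i0) g t.1.2 t.2)]%R);
  last first.
  apply/seteqP; split => s /=;
  by under eq_bigr do rewrite -mulrA; rewrite -mulr_sumr ler_pM2l.
apply: le_trans h _.
rewrite lee_fin -expRM_natl -expRD ler_expR exprMn n2 mulr1.
rewrite le_eqVlt; apply/orP; left; apply/eqP; rewrite /gram_dev -/s0.
have Ln : L = n%:R * s0 ^+ 2 by rewrite s2 mulrCA mulfV ?mulr1// gt_eqF.
rewrite Ln /lam; move: (n%:R : R) (s0) => N x.
by field; rewrite gt_eqF.
Qed.

Definition gram_event : set T := \big[setU/set0]_t gram_bad t.

Lemma measurable_gram_event : measurable gram_event.
Proof. by apply: bigsetU_measurable => t _; exact: measurable_gram_bad. Qed.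

Lemma gram_event_prob : (P gram_event <= (2 * p%:R ^+ 2 * expR (- (4 * L)))%:E)%E.
Proof.
apply: le_trans (union_bound _ _ measurable_gram_bad) _.
apply: le_trans (lee_sum _ (fun t _ => gram_bad_prob t)) _.
rewrite sumEFin lee_fin sumr_const !card_prod card_bool !card_ord.
by rewrite -(mulr_natl (expR _)) !natrM expr2 mulrA.
Qed.

Lemma gram_event_dev s : ~ gram_event s -> forall j l,
  `|\sum_i g (Z i s).1 * tnth (Z i s).1 j * tnth (Z i s).1 l - n%:R * pop_gram (Z i0) g j l|
    <= n%:R * gram_dev.
Proof.
move=> /notin_bigsetU h j l.
have e b : \sum_i sgn b * (g (Z i s).1 * tnth (Z i s).1 j * tnth (Z i s).1 l -
    pop_gram (Z i0) g j l) = sgn b * (\sum_i g (Z i s).1 * tnth (Z i s).1 j *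
    tnth (Z i s).1 l - n%:R * pop_gram (Z i0) g j l).
  by rewrite -mulr_sumr sumrB sumr_const card_ord mulr_natl.
have h1 b : sgn b * (\sum_i g (Z i s).1 * tnth (Z i s).1 j * tnth (Z i s).1 l -
    n%:R * pop_gram (Z i0) g j l) < n%:R * gram_dev.
  by rewrite ltNge -e; apply/negP; exact: h (b, j, l) isT.
have := h1 true; have := h1 false; rewrite /sgn mulN1r mul1r => /ltW hp /ltW hm.
by rewrite ler_norml lerNl hm hp.
Qed.

End GramEvent.

(** * Simultaneous boundedness of all covariates *)

Section BoundedEvent.
Context {d : measure_display} {T : measurableType d} {R : realType}
  (P : probability T R) (n p : nat) (Z : 'I_n -> {RV P >-> (p.-tuple R * bool)%type})
  (i0 : 'I_n) (a3 : R).
Context (Ziid : iid Z)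
  (Xbd : forall j, {ae P, forall s, `|tnth (Z i0 s).1 j| <= a3}).

Definition large_event : set T :=
  \big[setU/set0]_(t : 'I_n * 'I_p) [set s | a3 < `|tnth (Z t.1 s).1 t.2|].

Let large (j : 'I_p) : set (p.-tuple R * bool) := [set z | a3 < `|tnth z.1 j|].

Let measurable_large j : measurable (large j).
Proof.
have mt : measurable_fun setT (fun z : p.-tuple R * bool => `|tnth z.1 j|).
  apply: measurableT_comp => //.
  exact: (measurableT_comp (@measurable_tnth _ _ p j)).
rewrite -[X in measurable X]setTI.
rewrite (_ : large j = (fun z => `|tnth z.1 j|) @^-1` `]a3, +oo[%classic); first exact: mt.
by apply/seteqP; split=> s /=; rewrite in_itv/= andbT.
Qed.

Lemma measurable_large_set (t : 'I_n * 'I_p) :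
  measurable [set s | a3 < `|tnth (Z t.1 s).1 t.2|].
Proof. exact: measurable_funPTI (measurable_large t.2). Qed.

Lemma measurable_large_event : measurable large_event.
Proof. by apply: bigsetU_measurable => t _; exact: measurable_large_set. Qed.

(** The almost sure bound at [i0] passes to the other observations by identical distribution, and
    finitely many null events are united. *)
Lemma large_event_prob : P large_event = 0%E.
Proof.
apply/eqP; rewrite eq_le measure_ge0 andbT.
apply: le_trans (union_bound _ _ measurable_large_set) _.
rewrite big1// => t _.
have := Ziid.2 t.1 i0 _ (measurable_large t.2); rewrite /distribution /pushforward => e.
transitivity (P (Z i0 @^-1` large t.2)); first exact: e.
have [N [mN N0 sub]] := Xbd t.2.
apply/eqP; rewrite eq_le measure_ge0 andbT -N0 le_measure ?inE//.
  exact: measurable_funPTI.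
move=> s h; apply: sub => /= h'; move: h; rewrite /large/= => h.
by have := lt_le_trans h h'; rewrite ltxx.
Qed.

Lemma large_event_bound s : ~ large_event s -> forall i j, `|tnth (Z i s).1 j| <= a3.
Proof. by move=> /notin_bigsetU h i j; rewrite leNgt; apply/negP => /(h (i, j) isT). Qed.

End BoundedEvent.

(** * Measurability of the selection event *)

Section Measurable_bic.
Context {d : measure_display} {T : measurableType d} {R : realType}
  (P : probability T R) (n p : nat) (Z : 'I_n -> {RV P >-> (p.-tuple R * bool)%type}).

(** A sequence running through the rational vectors of the model, with 0 for codes of nothing: it
    turns the supremum in [max_loglik] into a countable one, whose measurability is known. *)
Definition rational_coord (J : {set 'I_p}) (i : nat) : 'rV[R]_p :=
  if unpickle i is Some r then \row_j (if j \in J then ratr ((r : 'rV[rat]_p) ord0 j) else 0)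
  else 0.

Lemma rational_coord_in J i : coord_space J (rational_coord J i).
Proof.
move=> j jJ; rewrite /rational_coord; case: unpickle => [r|]; rewrite mxE//.
by rewrite (negbTE jJ).
Qed.

Lemma loglik_lipschitz (D : 'I_n -> p.-tuple R * bool) (b b' : 'rV[R]_p) (e : R) :
  (forall j, `|b ord0 j - b' ord0 j| <= e) ->
  loglik D b - loglik D b' <= (\sum_i 2 * \sum_j `|tnth (D i).1 j|) * e.
Proof.
move=> be; rewrite -sumrB mulr_suml; apply: ler_sum => i _.
have dd : `|dot (D i).1 b - dot (D i).1 b'| <= (\sum_j `|tnth (D i).1 j|) * e.
  rewrite /dot -sumrB mulr_suml; apply: le_trans (ler_norm_sum _ _ _) _.
  by apply: ler_sum => j _; rewrite -mulrBr normrM ler_wpM2l.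
have cc := cumulant_lipschitz (dot (D i).1 b) (dot (D i).1 b').
rewrite distrC in dd; rewrite -mulrA.
set x := dot _ b in dd cc *; set y := dot _ b' in dd cc *.
set E := _ * e in dd *; move: (cumulant x) (cumulant y) cc => u v cc.
have := le_trans cc dd; rewrite !ler_norml in dd * => /andP[h1 h2].
by case: (D i).2; rewrite ?mul1r ?mul0r; case/andP: dd; lra.
Qed.

Lemma max_loglik_sups (D : 'I_n -> p.-tuple R * bool) (J : {set 'I_p}) :
  max_loglik D J = sups (fun i => loglik D (rational_coord J i)) 0%N.
Proof.
have hub : has_ubound (range (fun i => loglik D (rational_coord J i))).
  by exists 0 => _ [i _ <-]; exact: loglik_le0.
have E : sdrop (fun i => loglik D (rational_coord J i)) 0 =
    range (fun i => loglik D (rational_coord J i)).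
  by apply/seteqP; split => x /= [i hi <-]; exists i.
rewrite (_ : sups _ 0%N = sup (range (fun i => loglik D (rational_coord J i)))); last first.
  by congr sup; exact: E.
apply/eqP; rewrite eq_le; apply/andP; split; last first.
  apply: ge_sup; first by exists (loglik D (rational_coord J 0)); exists 0%N.
  by move=> _ [i _ <-]; apply: le_max_loglik; exact: rational_coord_in.
apply: max_loglik_le => b bJ; apply/ler_addgt0Pr => e e0.
set C := \sum_i 2 * \sum_j `|tnth (D i).1 j|.
have C0 : 0 <= C.
  by apply: sumr_ge0 => i _; rewrite mulr_ge0// sumr_ge0.
(* The denominator is C + 1 because [C] vanishes when all covariates are zero. *)
pose dl := e / (C + 1).
have dl0 : 0 < dl by rewrite divr_gt0// ltr_wpDl.
have near j : {r : rat | `|b ord0 j - ratr r| <= dl}.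
  apply: cid; have [|r] := @rat_in_itvoo R (b ord0 j - dl) (b ord0 j + dl).
    by rewrite ltrBlDr -addrA ltrDl addr_gt0.
  rewrite in_itv/= => /andP[r1 r2]; exists r.
  by rewrite distrC ler_distl (ltW r1) (ltW r2).
pose i := pickle (\row_j sval (near j) : 'rV[rat]_p).
have iE j : `|b ord0 j - rational_coord J i ord0 j| <= dl.
  rewrite /rational_coord /i pickleK !mxE; case: ifPn => jJ; first exact: (svalP (near j)).
  by rewrite bJ// subrr normr0 ltW.
have := loglik_lipschitz D iE; rewrite -/C => h.
have Ce : C * dl <= e.
  rewrite /dl mulrA ler_pdivrMr; last by rewrite ltr_wpDl.
  by rewrite mulrDr mulr1 mulrC lerDl ltW.
rewrite -lerBlDr; apply: le_trans (_ : loglik D (rational_coord J i) <= _); last first.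
  by apply: ub_le_sup => //; exists i.
by rewrite lerBlDr -lerBlDl; exact: le_trans h Ce.
Qed.

Lemma measurable_loglik (b : 'rV[R]_p) :
  measurable_fun setT (fun s => loglik (fun i => Z i s) b).
Proof.
apply: measurable_sum => i.
have mX : measurable_fun setT (fun s => (Z i s).1) by exact: measurableT_comp.
have mY : measurable_fun setT (fun s => (Z i s).2) by exact: measurableT_comp.
have md := measurableT_comp (measurable_dot b) mX.
apply: measurable_funB; last exact: (measurableT_comp measurable_cumulant md).
apply: measurable_funM => //.
by apply: (measurableT_comp (_ : measurable_fun setT (fun b : bool => b%:R : R)) mY).
Qed.

Lemma measurable_bic (gamma : R) J :
  measurable_fun setT (fun s => bic gamma (fun i => Z i s) J).
Proof.
apply: measurable_funD => //; apply: measurable_funM => //.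
under eq_fun do rewrite max_loglik_sups.
apply: measurable_fun_sups; last by move=> m; exact: measurable_loglik.
by move=> s _; exists 0 => _ [i _ <-]; exact: loglik_le0.
Qed.

Lemma argmin_bicP (gamma : R) q (D : 'I_n -> p.-tuple R * bool) (J : {set 'I_p}) :
  (#|J| <= q)%N ->
  argmin_bic gamma q D = [set J] <->
  (forall K : {set 'I_p}, (#|K| <= q)%N -> K != J -> bic gamma D J < bic gamma D K).
Proof.
move=> Jq; split => [E K Kq KJ|H].
  have [_ Jmin] : argmin_bic gamma q D J by rewrite E.
  rewrite lt_neqAle Jmin// andbT; apply/eqP => e.
  have : argmin_bic gamma q D K by split => // K' K'q; rewrite -e Jmin.
  by rewrite E /= => /eqP; rewrite (negbTE KJ).
apply/seteqP; split => [K [Kq Kmin]|K ->]; last first.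
  split => // K' K'q; have [->//|K'J] := eqVneq K' J.
  by apply/ltW/H.
have [->//|KJ] := eqVneq K J.
by have := H K Kq KJ; rewrite ltNge Kmin.
Qed.

Lemma measurable_selection (gamma : R) q (J : {set 'I_p}) : (#|J| <= q)%N ->
  measurable [set s | argmin_bic gamma q (fun i => Z i s) = [set J]].
Proof.
move=> Jq; pose bad K := [set s | bic gamma (fun i => Z i s) K <= bic gamma (fun i => Z i s) J].
have mbad K : measurable (bad K).
  have h := measurable_fun_ler (measurable_bic gamma K) (measurable_bic gamma J).
  rewrite -[X in measurable X]setTI.
  rewrite (_ : bad K = (fun s => bic gamma (fun i => Z i s) K <=
      bic gamma (fun i => Z i s) J) @^-1` [set true]); first exact: h.
  by apply/seteqP; split.
rewrite (_ : mkset _ =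
    ~` \big[setU/set0]_(K : {set 'I_p} | (#|K| <= q)%N && (K != J)) bad K).
  by apply: measurableC; apply: bigsetU_measurable.
apply/seteqP; split => s /=.
  move=> /(argmin_bicP _ _ Jq) h; elim/big_rec : _ => [//|K B /andP[Kq KJ] hB [hK|//]].
  by have := h K Kq KJ; rewrite ltNge => /negP; apply.
move=> /notin_bigsetU h; apply/argmin_bicP => // K Kq KJ.
by rewrite ltNge; apply/negP; apply: h; rewrite Kq KJ.
Qed.

End Measurable_bic.

(** * Model selection at a fixed sample size *)

Section BicArithmetic.
Context {R : realType}.

Lemma bic_true_arith (mK mJ j kk t pen : R) : mK <= mJ + kk * t -> 0 < kk ->
  2 * t < pen -> - 2 * mJ + j * pen < - 2 * mK + (j + kk) * pen.
Proof.
move=> h k0 tp; have : kk * (2 * t) < kk * pen by rewrite ltr_pM2l.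
lra.
Qed.

Lemma bic_false_arith (mK mJ l j kk q drop pen : R) : mK <= l - drop -> l <= mJ ->
  0 <= pen -> q * pen < 2 * drop -> j <= q -> 0 <= kk ->
  - 2 * mJ + j * pen < - 2 * mK + kk * pen.
Proof.
move=> h1 h2 p0 qp jq k0.
have : 0 <= kk * pen by rewrite mulr_ge0.
have : j * pen <= q * pen by rewrite ler_wpM2r.
lra.
Qed.

Lemma prob_arith (u v e : R) :
  u - 1 + (u - 1 + (2 * v * e + (2 * v * e + 0))) <= 2 * (u - 1) + 4 * v * e.
Proof. lra. Qed.

End BicArithmetic.

Section FixedSampleSize.
Context {d : measure_display} {T : measurableType d} {R : realType}
  (P : probability T R) (n p q : nat)
  (Z : 'I_n -> {RV P >-> (p.-tuple R * bool)%type}) (i0 : 'I_n)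
  (beta0 : 'rV[R]_p) (a0 a1 a2 a3 gamma : R).
Let J0 := supp beta0.
(** The union of J0 and a competing model has at most 2 q indices, so every difference beta - beta0
    is k-sparse. *)
Let k := (2 * q)%N.
Let A2 := 1 + a2.
Let c := curvature a0 a1 a2 / 4.
Let C1 := A2 / c.
Let c1 := curvature a0 a1 a2 / 256.
Let N : R := n%:R.
Let pen : R := ln n%:R + 2 * gamma * ln p%:R.

Context (a0_gt0 : 0 < a0) (a1_gt0 : 0 < a1) (a2_gt0 : 0 < a2) (a3_gt0 : 0 < a3).
Context (Ziid : iid Z) (Zlog : logistic_model (Z i0) beta0)
  (Xbd : forall j, {ae P, forall w, `|tnth (Z i0 w).1 j| <= a3})
  (moments : forall u : 'rV[R]_p, sparse k u -> norm2 u = 1 ->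
    (a1%:E <= 'E_P[fun w => (dot (Z i0 w).1 u ^+ 2)%R])%E /\
    ('E_P[fun w => (`|dot (Z i0 w).1 u| ^+ 3)%R] <= a2%:E)%E)
  (J0q : (#|J0| <= q)%N) (beta0_norm : norm2 beta0 <= a0).
Context (eta L Th r2 drop slack bm : R).
Let aL := eta * c1.
Let dev := gram_dev n a3 L.
Context (eta_gt0 : 0 < eta) (eta_le : eta <= 2^-1) (L_ge0 : 0 <= L)
  (L_small : L / n%:R <= 16^-1) (Th_ge0 : 0 <= Th) (r2_gt0 : 0 < r2)
  (r2_big : k%:R / n%:R <= r2 / 8)
  (r2_small : a3 ^+ 2 * k%:R * (3 * r2) <= 4^-1)
  (r2_small1 : a3 ^+ 2 * k%:R * (3 * (C1 * r2)) <= 4^-1)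
  (r2_small2 : a3 ^+ 2 * k%:R * (C1 * r2) <= (aL / (16 * ((A2 + 1) * C1))) ^+ 2)
  (dev_small : k%:R * dev <= 1)
  (drop_ge0 : 0 <= drop)
  (drop_hyp : k%:R * Th + k%:R * a3 ^+ 2 + drop <= aL * (n%:R * (r2 / 4)))
  (drop_pen : q%:R * pen < 2 * drop)
  (slack_hyp : aL + (A2 + 1) * C1 + 4 * N * dev ^+ 2 * k%:R ^+ 2 * C1 ^+ 2 * r2 / aL +
    a3 ^+ 2 * k%:R * (C1 * r2) * (N * ((A2 + 1) * (C1 * r2))) /
      (4 * (aL / (16 * ((A2 + 1) * C1)))) <= slack)
  (pen_hyp : 2 * (Th + slack) < pen)
  (bm_ge0 : 0 <= bm) (bm_beta : forall j, j \in J0 -> bm <= `|beta0 ord0 j|)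
  (bm_r2 : r2 <= bm ^+ 2).

Let one_weight : p.-tuple R -> R := fun=> 1.
Let var_weight (x : p.-tuple R) : R := logistic_var (dot x beta0).
Let S := pop_gram (Z i0) one_weight.
Let Q := pop_gram (Z i0) var_weight.

Let beta0_sparse : sparse k beta0.
Proof. by apply: leq_trans J0q _; rewrite /k mul2n -addnn leq_addr. Qed.

Let n_gt0 : (0 < n)%N.
Proof. by case: i0 => i; case: n. Qed.

Let c_gt0 : 0 < c.
Proof. by rewrite divr_gt0// curvature_gt0. Qed.

Let c1_gt0 : 0 < c1.
Proof. by apply: mulr_gt0; [exact: curvature_gt0|rewrite invr_gt0 ltr0n]. Qed.

Let A2_gt0 : 0 < A2.
Proof. exact: addr_gt0. Qed.

Let C1_ge0 : 0 <= C1.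
Proof. by apply: divr_ge0; exact: ltW. Qed.

Let aL_gt0 : 0 < aL.
Proof. exact: mulr_gt0. Qed.

Let mone : measurable_fun setT one_weight.
Proof. exact: measurable_cst. Qed.

Let one01 x : 0 <= one_weight x <= 1.
Proof. by rewrite ler01 lexx. Qed.

Let mvar : measurable_fun setT var_weight.
Proof. by apply: (measurableT_comp measurable_logistic_var); exact: measurable_dot. Qed.

Let var01 x : 0 <= var_weight x <= 1.
Proof. by rewrite logistic_var_ge0 logistic_var_le1. Qed.

Let Q_lo u : sparse k u -> c * sqnorm u <= bilin Q u u.
Proof. exact: (pop_gram_lower a0_gt0 a1_gt0 a2_gt0 Xbd moments beta0_sparse beta0_norm). Qed.

Let Q_up u : sparse k u -> bilin Q u u <= A2 * sqnorm u.
Proof. exact: (pop_gram_upper a2_gt0 Xbd moments mvar var01). Qed.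

Let S_up u : sparse k u -> bilin S u u <= A2 * sqnorm u.
Proof. exact: (pop_gram_upper a2_gt0 Xbd moments mone one01). Qed.

Let QC i j : Q i j = Q j i. Proof. exact: pop_gramC. Qed.

Let llr1 v : (\int[P]_s (expR (llr beta0 v (Z i0 s)))%:E = 1)%E.
Proof. exact: llr_exp_mean. Qed.

Let llr2 v : sparse k v -> a3 ^+ 2 * k%:R * sqnorm v <= 4^-1 ->
  (\int[P]_s (expR (2^-1 * llr beta0 v (Z i0 s)))%:E <= (expR (- (c1 * sqnorm v)))%:E)%E.
Proof.
exact: (llr_half_exp_mean a0_gt0 a1_gt0 a2_gt0 Zlog Xbd moments beta0_sparse beta0_norm).
Qed.

Let slack_ge0 : 0 <= slack.
Proof.
apply: le_trans slack_hyp.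
have r20 := ltW r2_gt0; have A0 := ltW A2_gt0; have a0' := ltW aL_gt0.
have A10 : 0 <= A2 + 1 by rewrite addr_ge0.
have AC : 0 <= (A2 + 1) * C1 by exact: mulr_ge0.
have C0 : 0 <= C1 * r2 by exact: mulr_ge0.
have N0 : 0 <= N by [].
have k0 : 0 <= k%:R :> R by [].
have e16 : 0 <= 16 * ((A2 + 1) * C1) by apply: mulr_ge0.
apply: addr_ge0.
  apply: addr_ge0; first by apply: addr_ge0.
  apply: divr_ge0 => //; apply: mulr_ge0 => //; apply: mulr_ge0; last exact: sqr_ge0.
  apply: mulr_ge0; last exact: sqr_ge0.
  by apply: mulr_ge0; [apply: mulr_ge0|exact: sqr_ge0].
apply: divr_ge0; last by apply: mulr_ge0 => //; apply: divr_ge0.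
apply: mulr_ge0; last by apply: mulr_ge0 => //; apply: mulr_ge0.
by apply: mulr_ge0 => //; apply: mulr_ge0 => //; exact: sqr_ge0.
Qed.

Lemma bic_model_selection (M : nat) (W : 'I_p -> 'rV[R]_p) (D : 'I_n -> p.-tuple R * bool) :
  Num.sqrt (N * r2) + 1 < M%:R ->
  (forall j, j \notin J0 ->
    [/\ coord_space (finset.setU (finset.set1 j) J0) (W j), W j ord0 j = 1 &
        forall a, coord_space J0 a -> bilin Q a (W j) = 0]) ->
  (forall i j, `|tnth (D i).1 j| <= a3) ->
  (forall j l, `|\sum_i 1 * tnth (D i).1 j * tnth (D i).1 l - N * S j l| <= N * dev) ->
  (forall j l, `|\sum_i logistic_var (dot (D i).1 beta0) *
     tnth (D i).1 j * tnth (D i).1 l - N * Q j l| <= N * dev) ->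
  lr_bound D beta0 k M a3 Th aL (fun j => (Num.sqrt n%:R)^-1 *: unit_vec j) finset.setT ->
  lr_bound D beta0 k M a3 Th aL (fun j => (Num.sqrt n%:R)^-1 *: W j) (finset.setC J0) ->
  forall K : {set 'I_p}, (#|K| <= q)%N -> K != J0 -> bic gamma D J0 < bic gamma D K.
Proof.
move=> hM hW hX devS devQ lrE lrW K Kq KJ0.
have b0J : coord_space J0 beta0 by exact: coord_space_supp.
have l0 := le_max_loglik D b0J.
have KJk : (#|finset.setU K J0| <= k)%N.
  by rewrite /k mul2n -addnn cardsU; apply: leq_trans (leq_subr _ _) _; exact: leq_add.
have Kk : (#|K| <= k)%N.
  by apply: leq_trans KJk; apply: subset_leq_card; exact: finset.subsetUl.
have diff_sparse beta : coord_space K beta -> sparse k (beta - beta0).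
  move=> bK; apply: coord_space_sparse KJk _; apply: coord_spaceD.
    by apply: coord_spaceS bK; exact: finset.subsetUl.
  by apply: coord_spaceN; apply: coord_spaceS b0J; exact: finset.subsetUr.
have loc u : sparse k u -> r2 <= sqnorm u -> loglik D (beta0 + u) <= loglik D beta0 - drop.
  exact: (localisation hX n_gt0 a3_gt0 r2_gt0 Th_ge0 aL_gt0 r2_big hM lrE r2_small
    drop_ge0 drop_hyp).
rewrite /bic -/pen.
have [J0K|/fintype.subsetPn[j jJ0 jK]] := boolP (J0 \subset K).
  have cK : #|K| = (#|J0| + #|finset.setD K J0|)%N.
    by rewrite cardsD (finset.setIidPr J0K) subnKC// subset_leq_card.
  have D0 : 0 < #|finset.setD K J0|%:R :> R.
    rewrite ltr0n card_gt0; apply/negP; rewrite finset.setD_eq0 => KJ.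
    by move: KJ0; rewrite finset.eqEsubset KJ J0K.
  have le : max_loglik D K <= max_loglik D J0 + #|finset.setD K J0|%:R * (Th + slack).
    apply: max_loglik_le => beta bK.
    have [small|big] := leP (sqnorm (beta - beta0)) r2.
      exact: (true_model hX n_gt0 r2_gt0 aL_gt0 r2_big hM QC c_gt0 A2_gt0
        (mulr_ge0 (mulr_ge0 (ler0n _ 12) (sqr_ge0 _)) (sqrtr_ge0 _)) Q_lo Q_up S_up
        hW devS devQ dev_small lrW r2_small1 r2_small2 slack_hyp J0K KJ0 Kk bK small).
    (* Far from [beta0] the likelihood is below its value there, hence below that of the model J0,
       and the gain term is nonnegative. *)
    have := loc _ (diff_sparse _ bK) (ltW big); rewrite addrC subrK => h.
    apply: le_trans h _; rewrite lerBlDr; apply: le_trans l0 _.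
    by rewrite -addrA lerDl addr_ge0// mulr_ge0// addr_ge0.
  rewrite cK natrD; exact: bic_true_arith le D0 pen_hyp.
have le : max_loglik D K <= loglik D beta0 - drop.
  apply: max_loglik_le => beta bK.
  have := loc _ (diff_sparse _ bK); rewrite [beta0 + _]addrC subrK; apply.
  (* The missed coordinate alone puts every vector of the model at squared distance at least
     [bm ^+ 2] from [beta0]. *)
  apply: le_trans bm_r2 _; apply: le_trans (le_sqnorm _ j).
  rewrite !mxE bK// sub0r sqrrN -(real_normK (num_real (beta0 _ _))).
  by rewrite lerXn2r ?nnegrE// bm_beta.
have pen0 : 0 <= pen.
  by apply: ltW; apply: le_lt_trans pen_hyp; rewrite mulr_ge0// addr_ge0.
apply: bic_false_arith le l0 pen0 drop_pen _ _ => //.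
by rewrite ler_nat.
Qed.

Lemma selection_prob :
  ((1 - (2 * (expR (p%:R * (2 * expR (- ((1 - eta) * Th)) / (1 - expR (- aL)))) - 1) +
         4 * p%:R ^+ 2 * expR (- (4 * L))))%:E <=
   P [set s | argmin_bic gamma q (fun i => Z i s) = [set J0]])%E.
Proof.
(* The probability bound is free of [M], so any large enough cutoff will do. *)
have [M hM] : exists M : nat, Num.sqrt (N * r2) + 1 < M%:R.
  exists (Num.bound (Num.sqrt (N * r2) + 1)); apply: archi_boundP.
  by rewrite addr_ge0// sqrtr_ge0.
have Q_J0 u : coord_space J0 u -> c * sqnorm u <= bilin Q u u.
  move=> uJ; apply: Q_lo; apply: coord_space_sparse uJ.
  exact: beta0_sparse.
pose W j := sval (cid (residual_vector j QC c_gt0 Q_J0)).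
have hW j : j \notin J0 ->
    [/\ coord_space (finset.setU (finset.set1 j) J0) (W j), W j ord0 j = 1 &
        forall a, coord_space J0 a -> bilin Q a (W j) = 0].
  exact: (svalP (cid (residual_vector j QC c_gt0 Q_J0))).
pose wE j := (Num.sqrt n%:R)^-1 *: unit_vec j : 'rV[R]_p.
pose wW j := (Num.sqrt n%:R)^-1 *: W j.
have loE (K : {set 'I_p}) (e : 'I_p -> R) : K \subset finset.setT ->
    n%:R^-1 * \sum_(j in K) e j ^+ 2 <= sqnorm (comb wE K e).
  by move=> _; rewrite combZ sqnormZ sqnorm_comb_unit (rho_sqr n_gt0).
(* The residuals need not be Euclidean orthogonal, but the coordinates of a combination inside [K]
   are its coefficients. *)
have loW (K : {set 'I_p}) (e : 'I_p -> R) : K \subset finset.setC J0 ->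
    n%:R^-1 * \sum_(j in K) e j ^+ 2 <= sqnorm (comb wW K e).
  move=> KJ; rewrite combZ sqnormZ (rho_sqr n_gt0) ler_wpM2l ?invr_ge0//.
  rewrite /sqnorm [leRHS](bigID (mem K))/=; apply: ler_wpDr.
    by apply: sumr_ge0 => j _; exact: sqr_ge0.
  by apply: ler_sum => j jK; rewrite (comb_in hW KJ).
pose E1 := lattice_event k M Z beta0 a3 Th c1 eta wE finset.setT.
pose E2 := lattice_event k M Z beta0 a3 Th c1 eta wW (finset.setC J0).
(* The unweighted Gram matrix bounds energies, and the one weighted by the variance bounds the cross
   term. *)
pose E3 := gram_event Z i0 a3 L one_weight.
pose E4 := gram_event Z i0 a3 L var_weight.
pose E5 := large_event Z a3.
have m1 : measurable E1 by exact: measurable_lattice_event.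
have m2 : measurable E2 by exact: measurable_lattice_event.
have m3 : measurable E3 by exact: measurable_gram_event.
have m4 : measurable E4 by exact: measurable_gram_event.
have m5 : measurable E5 by exact: measurable_large_event.
have p1 := @lattice_event_prob _ _ _ P n p k M Z i0 beta0 a3 Th c1 eta wE finset.setT
  Ziid c1_gt0 eta_gt0 eta_le llr1 llr2 loE.
have p2 := @lattice_event_prob _ _ _ P n p k M Z i0 beta0 a3 Th c1 eta wW (finset.setC J0)
  Ziid c1_gt0 eta_gt0 eta_le llr1 llr2 loW.
have p3 := @gram_event_prob _ _ _ P n p Z i0 a3 L one_weight Ziid a3_gt0 L_ge0 Xbd mone one01 L_small.
have p4 := @gram_event_prob _ _ _ P n p Z i0 a3 L var_weight Ziid a3_gt0 L_ge0 Xbd mvar var01 L_small.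
have p5 : P E5 = 0%E := large_event_prob Ziid Xbd.
pose B := E1 `|` (E2 `|` (E3 `|` (E4 `|` E5))).
have m45 := measurableU _ _ m4 m5; have m345 := measurableU _ _ m3 m45.
have m2345 := measurableU _ _ m2 m345.
have mB : measurable B := measurableU _ _ m1 m2345.
have PB : (P B <= (2 * (expR (p%:R * (2 * expR (- ((1 - eta) * Th)) / (1 - expR (- aL)))) - 1) +
    4 * p%:R ^+ 2 * expR (- (4 * L)))%:E)%E.
  have U (X Y : set T) (x y : R) : measurable X -> measurable Y ->
      (P X <= x%:E)%E -> (P Y <= y%:E)%E -> (P (X `|` Y) <= (x + y)%:E)%E.
    move=> mX mY Xx Yy; apply: le_trans (measureU2 _ mX mY) _.
    by rewrite EFinD; exact: leeD.
  have p5' : (P E5 <= 0%:E)%E by rewrite p5.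
  apply: le_trans (U _ _ _ _ m1 m2345 p1 (U _ _ _ _ m2 m345 p2
    (U _ _ _ _ m3 m45 p3 (U _ _ _ _ m4 m5 p4 p5')))) _.
  by rewrite lee_fin; exact: prob_arith.
have mS := measurable_selection Z gamma J0q.
apply: (@le_trans _ _ (P (~` B))).
  rewrite probability_setC// EFinB; apply: leeB => //.
apply: le_measure; rewrite ?inE//; first exact: measurableC.
move=> s nB /=; apply/argmin_bicP => //.
have n1 : ~ E1 s by move=> h; apply: nB; left.
have n2 : ~ E2 s by move=> h; apply: nB; right; left.
have n3 : ~ E3 s by move=> h; apply: nB; right; right; left.
have n4 : ~ E4 s by move=> h; apply: nB; right; right; right; left.
have n5 : ~ E5 s by move=> h; apply: nB; right; right; right; right.
apply: (bic_model_selection hM hW) => //.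
- exact: large_event_bound n5.
- exact: gram_event_dev n3.
- exact: gram_event_dev n4.
- exact: lattice_event_lr_bound n1.
- exact: lattice_event_lr_bound n2.
Qed.

End FixedSampleSize.

Section RateArithmetic.
Context {R : realType}.

Lemma r2_big_arith (Cr q L N : R) : 16 <= Cr -> 1 <= L -> 0 <= q -> 0 < N ->
  2 * q <= Cr * (q * L / N) / 8 * N.
Proof.
move=> h1 h2 q0 N0; rewrite [leRHS](_ : _ = q * (Cr * L) / 8); last by field; rewrite gt_eqF.
have h : 16 * 1 <= Cr * L by apply: ler_pM.
have := ler_wpM2l q0 h; lra.
Qed.

Lemma small_arith (a q r CX e : R) : 0 <= a -> q * r <= CX -> 6 * a * CX <= e ->
  a * (2 * q) * (3 * r) <= e.
Proof. by move=> a0 /(ler_wpM2l a0) h; lra. Qed.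

Lemma small_arith' (a C q r Cr X e : R) : 0 <= a -> 0 <= C -> q * r <= Cr * X ->
  6 * a * C * Cr * X <= e -> a * (2 * q) * (3 * (C * r)) <= e.
Proof. by move=> a0 c0 /(ler_wpM2l (mulr_ge0 a0 c0)) h; lra. Qed.

Lemma small_arith3 (a C q r Cr X e : R) : 0 <= a -> 0 <= C -> q * r <= Cr * X ->
  2 * a * C * Cr * X <= e -> a * (2 * q) * (C * r) <= e.
Proof. by move=> a0 c0 /(ler_wpM2l (mulr_ge0 a0 c0)) h; lra. Qed.

Lemma drop_arith (q Th CT L a aL : R) : 0 <= q -> Th <= CT * L -> 1 <= L -> 0 <= a ->
  0 <= aL ->
  2 * q * Th + 2 * q * a + (CT + 1) * (q * L) <=
  (3 * CT + 2 * a + 1) * (q * L) + 4 * aL * (q * L).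
Proof.
move=> q0 /(ler_wpM2l q0) h L1 a0 al0.
have := ler_wpM2l (mulr_ge0 q0 a0) L1.
have : 0 <= aL * (q * L) by rewrite !mulr_ge0// (le_trans _ L1).
lra.
Qed.

Lemma pen_arith (q x y g CT L : R) : 0 < q -> 2^-1 * x + g * y <= CT * L ->
  0 < q * L -> q * (x + 2 * g * y) < 2 * ((CT + 1) * (q * L)).
Proof. by move=> q0 /(ler_wpM2l (ltW q0)) h qL; lra. Qed.

Lemma slack_arith2 (u v1 v2 X L g : R) : 0 <= L -> u <= g / 8 * L ->
  (v1 + v2) * X <= g / 8 -> u + v1 * X * L + v2 * X * L <= g / 4 * L.
Proof. by move=> L0 h /(ler_wpM2r L0) h2; lra. Qed.

Lemma CT_arith (x y g : R) : 0 <= x -> 0 <= y -> 0 <= g ->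
  2^-1 * x + g * y <= (2^-1 + g) * (x + y).
Proof. by move=> x0 y0 g0; have := mulr_ge0 g0 x0; lra. Qed.

Lemma gap_arith (g L A y : R) : g * L <= A - y -> g / 2 * L + y <= A - g / 2 * L.
Proof. lra. Qed.

Lemma pen_arith2 (x y ga g L : R) : 0 < g * L ->
  2 * (2^-1 * x + ga * y - g / 2 * L + g / 4 * L) < x + 2 * ga * y.
Proof. lra. Qed.

Lemma square_arith (x y : R) : 0 <= x -> 2 * y + - (4 * (x + y)) <= - (2 * (x + y)).
Proof. lra. Qed.

Lemma exp_arith (e Th g L lp : R) : e * Th <= g / 4 * L -> g / 2 * L + lp <= Th ->
  lp + - ((1 - e) * Th) <= - (g / 4 * L).
Proof. by move=> h1 h2; lra. Qed.

End RateArithmetic.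

(** * Choice of the constants and the resulting failure probability *)

Section Rate.
Context {d : measure_display} {T : measurableType d} {R : realType}
  (P : probability T R) (n p q : nat)
  (Z : 'I_n -> {RV P >-> (p.-tuple R * bool)%type}) (i0 : 'I_n)
  (beta0 : 'rV[R]_p) (a0 a1 a2 a3 gamma g0 bm : R).
Let J0 := supp beta0.
Let k := (2 * q)%N.
Let A2 := 1 + a2.
Let c := curvature a0 a1 a2 / 4.
Let C1 := A2 / c.
Let c1 := curvature a0 a1 a2 / 256.
Let CT := 2^-1 + gamma.
Let L : R := ln n%:R + ln p%:R.
(** The second entry keeps the loss eta [Th] below g0 L / 4, since [Th] is at most CT L. *)
Let eta : R := Num.min 2^-1 (g0 / (4 * CT)).
Let aL := eta * c1.
(** The fraction makes the reserve aL n r2 / 4 cover 2 q [Th] (2 CT), the rounding cost (2 a3^2) and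
    the drop (CT + 1), all in units of q L; the 16 ensures k / n <= r2 / 8. *)
Let Cr := 4 * (3 * CT + 2 * a3 ^+ 2 + 1) / aL + 16.
Let eta2 := aL / (16 * ((A2 + 1) * C1)).
Let X : R := q%:R ^+ 3 * L / n%:R.

Context (a0_gt0 : 0 < a0) (a1_gt0 : 0 < a1) (a2_gt0 : 0 < a2) (a3_gt0 : 0 < a3).
Context (Ziid : iid Z) (Zlog : logistic_model (Z i0) beta0)
  (Xbd : forall j, {ae P, forall w, `|tnth (Z i0 w).1 j| <= a3})
  (moments : forall u : 'rV[R]_p, sparse k u -> norm2 u = 1 ->
    (a1%:E <= 'E_P[fun w => (dot (Z i0 w).1 u ^+ 2)%R])%E /\
    ('E_P[fun w => (`|dot (Z i0 w).1 u| ^+ 3)%R] <= a2%:E)%E)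
  (J0q : (#|J0| <= q)%N) (beta0_norm : norm2 beta0 <= a0).
Context (gamma_ge0 : 0 <= gamma) (g0_gt0 : 0 < g0) (p_gt0 : (0 < p)%N) (q_gt0 : (0 < q)%N)
  (gap : g0 * L <= 2^-1 * ln n%:R + gamma * ln p%:R - ln p%:R)
  (L_ge1 : 1 <= L) (L_big : aL + (A2 + 1) * C1 <= g0 / 8 * L)
  (X_small0 : X <= 16^-1)
  (X_small1 : 6 * a3 ^+ 2 * Cr * X <= 4^-1)
  (X_small2 : 6 * a3 ^+ 2 * C1 * Cr * X <= 4^-1)
  (X_small3 : 2 * a3 ^+ 2 * C1 * Cr * X <= eta2 ^+ 2)
  (X_small4 : 576 * a3 ^+ 4 * X <= 1)
  (X_small5 : (2304 * a3 ^+ 4 * C1 ^+ 2 * Cr / aL +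
     a3 ^+ 2 * C1 ^+ 2 * (A2 + 1) * Cr ^+ 2 / (2 * eta2)) * X <= g0 / 8)
  (bm_ge0 : 0 <= bm) (bm_beta : forall j, j \in J0 -> bm <= `|beta0 ord0 j|)
  (bm_r2 : Cr * (q%:R * L / n%:R) <= bm ^+ 2).

Let n_gt0 : (0 < n)%N.
Proof. by case: i0 => i; case: n. Qed.

Let lnn_ge0 : 0 <= ln n%:R :> R.
Proof. by rewrite ln_ge0// ler1n. Qed.

Let lnp_ge0 : 0 <= ln p%:R :> R.
Proof. by rewrite ln_ge0// ler1n. Qed.

Let L_ge0 : 0 <= L. Proof. exact: addr_ge0. Qed.

Let CT_gt0 : 0 < CT. Proof. by apply: ltr_wpDr => //; rewrite invr_gt0. Qed.

Let curv_gt0 : 0 < curvature a0 a1 a2. Proof. exact: curvature_gt0. Qed.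

Let c_gt0 : 0 < c. Proof. exact: divr_gt0. Qed.

Let A2_gt0 : 0 < A2. Proof. exact: addr_gt0. Qed.

Let C1_gt0 : 0 < C1. Proof. exact: divr_gt0. Qed.

Let eta_gt0 : 0 < eta.
Proof.
by rewrite lt_min invr_gt0 ltr0n/=; apply: divr_gt0 => //; apply: mulr_gt0.
Qed.

Let eta_le : eta <= 2^-1. Proof. by rewrite ge_min lexx. Qed.

Let etaCT : eta * CT <= g0 / 4.
Proof.
rewrite -ler_pdivlMr// -mulrA -invfM ge_min; apply/orP; right.
by rewrite lexx.
Qed.

Let aL_gt0 : 0 < aL.
Proof.
apply: mulr_gt0; first exact: eta_gt0.
by apply: mulr_gt0; [exact: curv_gt0|rewrite invr_gt0 ltr0n].
Qed.

Let Cr_ge16 : 16 <= Cr.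
Proof.
rewrite /Cr lerDr; apply: divr_ge0; last exact: ltW.
apply: mulr_ge0 => //; apply: addr_ge0 => //; apply: addr_ge0.
  by apply: mulr_ge0 => //; exact: ltW.
by apply: mulr_ge0 => //; exact: sqr_ge0.
Qed.

Let q1 : 1 <= q%:R :> R. Proof. by rewrite ler1n. Qed.

Let N_gt0 : 0 < n%:R :> R. Proof. by rewrite ltr0n. Qed.

Let Lq_le (m : nat) : (m <= 3)%N -> q%:R ^+ m * L / n%:R <= X.
Proof.
move=> m3; rewrite /X ler_wpM2r ?invr_ge0// ler_wpM2r//.
exact: ler_weXn2l.
Qed.

Let r2 : R := Cr * (q%:R * L / n%:R).
(** Half the penalty less g0 L / 2: this still exceeds log p by g0 L / 2, and a slack of g0 L / 4
    fits between it and half the penalty. *)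
Let Th : R := 2^-1 * ln n%:R + gamma * ln p%:R - g0 / 2 * L.

Let Th_le : Th <= CT * L.
Proof.
apply: (@le_trans _ _ (2^-1 * ln n%:R + gamma * ln p%:R)).
  by rewrite /Th gerBl mulr_ge0// divr_ge0// ltW.
exact: CT_arith.
Qed.

Let r2_gt0 : 0 < r2.
Proof.
apply: mulr_gt0; first by apply: lt_le_trans Cr_ge16; rewrite ltr0n.
apply: divr_gt0 => //; apply: mulr_gt0; last exact: lt_le_trans L_ge1.
exact: lt_le_trans q1.
Qed.

Let qr2 : q%:R * r2 <= Cr * X.
Proof.
rewrite /r2 mulrCA ler_wpM2l//; first by apply: le_trans Cr_ge16.
by have := Lq_le (isT : (2 <= 3)%N); rewrite expr2 -!mulrA.
Qed.

Lemma selection_prob_rate :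
  ((1 - (2 * (expR (2 / (1 - expR (- aL)) * expR (- (g0 / 4 * L))) - 1) +
         4 * expR (- (2 * L))))%:E <=
   P [set s | argmin_bic gamma q (fun i => Z i s) = [set J0]])%E.
Proof.
have Cr0 : 0 <= Cr by apply: le_trans Cr_ge16.
have kE : k%:R = 2 * q%:R :> R by rewrite natrM.
have L0 : 0 < L by exact: lt_le_trans L_ge1.
have q0 : 0 < q%:R :> R by exact: lt_le_trans q1.
have qL0 : 0 < q%:R * L by exact: mulr_gt0.
have a32 : 0 <= a3 ^+ 2 by exact: sqr_ge0.
have Th_lnp : g0 / 2 * L + ln p%:R <= Th.
  exact: gap_arith.
have Th0 : 0 <= Th.
  by apply: le_trans Th_lnp; rewrite addr_ge0// mulr_ge0// divr_ge0// ltW.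
have LN : L / n%:R <= X by have := Lq_le (isT : (0 <= 3)%N); rewrite expr0 mul1r.
have r2_big : k%:R / n%:R <= r2 / 8.
  rewrite kE ler_pdivrMr// /r2; apply: r2_big_arith => //.
have small1 : a3 ^+ 2 * k%:R * (3 * r2) <= 4^-1.
  by rewrite kE; apply: (small_arith a32 qr2); rewrite mulrA.
have small2 : a3 ^+ 2 * k%:R * (3 * (C1 * r2)) <= 4^-1.
  by rewrite kE; apply: (small_arith' a32 (ltW C1_gt0) qr2).
have small3 : a3 ^+ 2 * k%:R * (C1 * r2) <= eta2 ^+ 2.
  by rewrite kE; apply: (small_arith3 a32 (ltW C1_gt0) qr2).
have dev2 : gram_dev n a3 L ^+ 2 = 144 * a3 ^+ 4 * (L / n%:R).
  rewrite /gram_dev exprMn sqr_sqrtr; last by rewrite divr_ge0// ltW.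
  by move: (L / n%:R) => z; ring.
have dev0 : 0 <= gram_dev n a3 L.
  by apply: mulr_ge0; [apply: mulr_ge0|exact: sqrtr_ge0].
have dev_small : k%:R * gram_dev n a3 L <= 1.
  have kd : 0 <= k%:R * gram_dev n a3 L by apply: mulr_ge0.
  rewrite -(@ler_sqr R) ?nnegrE// [leLHS]exprMn dev2 expr1n.
  apply: le_trans X_small4; rewrite kE.
  rewrite [leLHS](_ : _ = 576 * a3 ^+ 4 * (q%:R ^+ 2 * L / n%:R)); last first.
    by move: L (n%:R) => l N; ring.
  apply: ler_wpM2l; last exact: Lq_le.
  by apply: mulr_ge0; [exact: ler0n|apply: exprn_ge0; exact: ltW].
(* Half the penalty per index is at most CT L, so this drop outweighs half the penalty of any model
   of size at most q. *)
have drop0 : 0 <= (CT + 1) * (q%:R * L).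
  by apply: mulr_ge0; [apply: addr_ge0 => //; exact: ltW|exact: ltW].
have drop_hyp : k%:R * Th + k%:R * a3 ^+ 2 + (CT + 1) * (q%:R * L) <= aL * (n%:R * (r2 / 4)).
  rewrite kE (_ : aL * _ = (3 * CT + 2 * a3 ^+ 2 + 1) * (q%:R * L) + 4 * aL * (q%:R * L)).
    exact: (drop_arith (ltW q0) Th_le L_ge1 a32 (ltW aL_gt0)).
  rewrite /r2 /Cr; move: CT L aL aL_gt0 (n%:R) (N_gt0) => ct l al al0 N N0.
  by field; rewrite !gt_eqF.
have drop_pen : q%:R * (ln n%:R + 2 * gamma * ln p%:R) < 2 * ((CT + 1) * (q%:R * L)).
  have h : 2^-1 * ln n%:R + gamma * ln p%:R <= CT * L.
    exact: CT_arith.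
  exact: (pen_arith q0 h qL0).
have AC0 : 0 < (A2 + 1) * C1 by apply: mulr_gt0 => //; exact: addr_gt0.
have slack_hyp : aL + (A2 + 1) * C1 +
    4 * n%:R * gram_dev n a3 L ^+ 2 * k%:R ^+ 2 * C1 ^+ 2 * r2 / aL +
    a3 ^+ 2 * k%:R * (C1 * r2) * (n%:R * ((A2 + 1) * (C1 * r2))) / (4 * eta2) <= g0 / 4 * L.
  rewrite dev2 kE.
  have eta20 : 0 < eta2 by apply: divr_gt0 => //; apply: mulr_gt0.
  rewrite (_ : 4 * n%:R * _ * _ * _ * _ / _ =
      2304 * a3 ^+ 4 * C1 ^+ 2 * Cr / aL * X * L); last first.
    rewrite /r2 /X; move: C1 Cr L aL aL_gt0 (n%:R) (N_gt0) => c' cr l al al0 N N0.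
    by field; rewrite !gt_eqF.
  rewrite (_ : a3 ^+ 2 * _ * _ * _ / _ =
      a3 ^+ 2 * C1 ^+ 2 * (A2 + 1) * Cr ^+ 2 / (2 * eta2) * X * L); last first.
    rewrite /r2 /X; move: C1 Cr L eta2 eta20 (n%:R) (N_gt0) => c' cr l et et0 N N0.
    by field; rewrite !gt_eqF.
  exact: (slack_arith2 L_ge0 L_big X_small5).
have pen_hyp : 2 * (Th + g0 / 4 * L) < ln n%:R + 2 * gamma * ln p%:R.
  have gL : 0 < g0 * L by exact: mulr_gt0.
  exact: pen_arith2.
have main := @selection_prob _ _ _ P n p q Z i0 beta0 a0 a1 a2 a3 gamma
  a0_gt0 a1_gt0 a2_gt0 a3_gt0 Ziid Zlog Xbd moments J0q beta0_norm eta L Th r2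
  ((CT + 1) * (q%:R * L)) (g0 / 4 * L) bm eta_gt0 eta_le L_ge0 (le_trans LN X_small0)
  Th0 r2_gt0 r2_big small1 small2 small3 dev_small drop0 drop_hyp drop_pen slack_hyp
  pen_hyp bm_ge0 bm_beta bm_r2.
apply: le_trans main; rewrite lee_fin lerD2l lerN2; apply: lerD.
  rewrite ler_pM2l// lerD2r ler_expR.
  rewrite [leLHS](_ : _ = 2 / (1 - expR (- aL)) * (p%:R * expR (- ((1 - eta) * Th)))); last first.
    by rewrite -/aL; ring.
  have al1 : 0 < 1 - expR (- aL) by rewrite subr_gt0 -expR0 ltr_expR oppr_lt0.
  rewrite ler_pM2l; last exact: divr_gt0.
  rewrite -{1}(@lnK R p%:R) ?posrE ?ltr0n// -expRD ler_expR.
  have h1 : eta * Th <= g0 / 4 * L.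
    apply: le_trans (ler_wpM2l (ltW eta_gt0) Th_le) _.
    by rewrite mulrA ler_wpM2r.
  exact: (exp_arith h1 Th_lnp).
rewrite -mulrA ler_pM2l// -{1}(@lnK R p%:R) ?posrE ?ltr0n// -expRM_natl -expRD ler_expR.
exact: square_arith.
Qed.

End Rate.

(** * Asymptotics *)

Section Asymptotics.
Context {R : realType}.

Lemma expR_decay (C s e : R) : 0 <= C -> 0 < s -> 0 < e ->
  exists A, forall x, A <= x -> C * expR (- (s * x)) <= e.
Proof.
move=> C0 s0 e0; exists (C / (e * s)) => x; rewrite ler_pdivrMr ?mulr_gt0// => h.
rewrite expRN ler_pdivrMr ?expR_gt0//; apply: le_trans h _.
rewrite mulrCA ler_pM2l// mulrC; apply: le_trans (expR_ge1Dx _).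
by rewrite lerDr.
Qed.

Lemma near_ln_ge (A : R) : \forall n \near \oo, A <= ln n%:R.
Proof.
near=> n; have h : expR A <= n%:R by near: n; exact: nbhs_infty_ger.
by rewrite -[A]expRK ler_ln ?posrE ?expR_gt0// (lt_le_trans (expR_gt0 A)).
Unshelve. all: by end_near. Qed.

Lemma near_expR_small (C s e : R) : 0 <= C -> 0 < s -> 0 < e ->
  \forall n \near \oo, C * expR (- (s * ln n%:R)) <= e.
Proof.
move=> C0 s0 e0; have [A hA] := expR_decay C0 s0 e0.
by apply: filterS (near_ln_ge A) => n; exact: hA.
Qed.

Lemma powR_expR (n : nat) (a : R) : (0 < n)%N -> n%:R `^ a = expR (a * ln n%:R).
Proof. by move=> n0; rewrite /powR pnatr_eq0 gtn_eqF. Qed.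

Lemma beta_min_le p (beta : 'rV[R]_p) (b : R) : (b%:E <= beta_min beta)%E ->
  forall j, j \in supp beta -> b <= `|beta ord0 j|.
Proof.
move=> h j jb; rewrite -lee_fin; apply: le_trans h _.
exact: (bigmin_le_cond +oo%E (fun j => (`|beta ord0 j|)%:E) jb).
Qed.

(* The condition gamma > 1 - 1 / (2 kappa) makes the penalty per parameter,
   log n + 2 gamma log p, exceed twice the log p cost of a union bound over
   the candidate parameters by a fixed fraction of log (n p). *)
Lemma penalty_gap (kappa : \bar R) (gamma : R) : (0 < kappa)%E ->
  (1 - (2%:E * kappa)^-1 < gamma%:E)%E ->
  exists2 g0 : R, 0 < g0 & forall n p : nat, (0 < n)%N -> (0 < p)%N ->
    (forall r : R, kappa = r%:E -> p%:R <= n%:R `^ r) ->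
    g0 * (ln n%:R + ln p%:R) <= 2^-1 * ln n%:R + gamma * ln p%:R - ln p%:R.
Proof.
have ln0' (n : nat) : (0 < n)%N -> 0 <= ln n%:R :> R by move=> n0; rewrite ln_ge0// ler1n.
case: kappa => [r| |//].
  rewrite lte_fin => r0; have r2 : 2 * r != 0 by rewrite mulf_neq0// gt_eqF.
  rewrite -EFinM inver (negbTE r2) -EFinB lte_fin => hg.
  (* Capping gamma at 1 makes the coefficient 1 - min (gamma, 1) of log p nonnegative, so that log p
     <= r log n may be inserted. *)
  pose D := 2^-1 - (1 - Num.min gamma 1) * r.
  have D0 : 0 < D.
    rewrite /D subr_gt0; have [g1|g1] := leP gamma 1; last first.
      by rewrite subrr mul0r invr_gt0.
    have -> : 2^-1 = (2 * r)^-1 * r by field; rewrite gt_eqF.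
    rewrite ltr_pM2r//; lra.
  (* The gap is at least D log n, while L is at most (1 + r) log n. *)
  exists (D / (1 + r)) => [|n p n0 p0 /(_ r erefl) pn].
    by rewrite divr_gt0// addr_gt0.
  have lp : ln p%:R <= r * ln n%:R.
    rewrite -ln_powR ler_ln// posrE ?ltr0n//.
    by rewrite powR_gt0// ltr0n.
  have x0 := ln0' _ n0; have y0 := ln0' _ p0.
  apply: (@le_trans _ _ (D * ln n%:R)).
    rewrite mulrAC ler_pdivrMr ?addr_gt0// -mulrA ler_pM2l// mulrDr mulr1.
    by rewrite lerD2l mulrC.
  have m1 : 0 <= 1 - Num.min gamma 1 by rewrite subr_ge0 ge_min lexx orbT.
  have := ler_wpM2l m1 lp.
  have mg : Num.min gamma 1 <= gamma by rewrite ge_min lexx.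
  have := ler_wpM2r y0 mg.
  rewrite /D; move: (Num.min gamma 1) (ln n%:R) (ln p%:R) => g x y; lra.
move=> _; rewrite mulry gtr0_sg// mul1e invey sube0 lte_fin => g1.
exists (Num.min 2^-1 (gamma - 1)) => [|n p n0 p0 _].
  by rewrite lt_min invr_gt0 ltr0n subr_gt0.
have x0 := ln0' _ n0; have y0 := ln0' _ p0.
have h1 : Num.min 2^-1 (gamma - 1) <= 2^-1 by rewrite ge_min lexx.
have h2 : Num.min 2^-1 (gamma - 1) <= gamma - 1 by rewrite ge_min lexx orbT.
have := ler_wpM2r x0 h1; have := ler_wpM2r y0 h2.
move: (Num.min _ _) (ln n%:R) (ln p%:R) => g x y; lra.
Qed.

(** For u <= 1/2 one has exp u - 1 <= u + 2 u^2 <= 2 u, so each summand is at most e / 2. *)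
Lemma failure_small (u v e : R) : 0 <= u -> u <= 2^-1 -> u <= e / 8 -> v <= e / 8 ->
  2 * (expR u - 1) + 4 * v <= e.
Proof.
move=> u0 u2 ue ve; have := @expR_quadratic R u; rewrite ger0_norm// => /(_ u2) h.
nra.
Qed.

End Asymptotics.

Theorem corollary2p1 (R : realType)
  (d : nat -> measure_display) (T : forall n, measurableType (d n))
  (P : forall n, probability (T n) R)
  (p q : nat -> nat)
  (Z : forall n, 'I_n -> {RV (P n) >-> ((p n).-tuple R * bool)%type})
  (beta0 : forall n, 'rV[R]_(p n))
  (kappa : \bar R) (tau psi phi a0 a1 a2 a3 gamma : R) :
  (forall n, (0 < n)%N -> iid (Z n)) ->
  (forall n, (0 < n)%N -> forall i, logistic_model (Z n i) (beta0 n)) ->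
  (forall n, (0 < n)%N -> (1 <= q n)%N) ->
  p n @[n --> \oo] --> \oo ->
  (0 < kappa)%E ->
  (forall r : R, kappa = r%:E ->
     forall n, (0 < n)%N -> (p n)%:R <= n%:R `^ r) ->
  0 < tau < 1 ->
  (forall n, (0 < n)%N -> ln (p n)%:R <= n%:R `^ tau) ->
  0 <= psi < 3^-1 * (1 - tau) ->
  (forall n, (0 < n)%N -> (q n)%:R <= n%:R `^ psi) ->
  0 <= phi < 1 - psi - tau ->
  (forall n, (0 < n)%N ->
     ((n%:R `^ (- (phi / 2)))%:E <= beta_min (beta0 n))%E) ->
  0 < a0 -> 0 < a1 -> 0 < a2 -> 0 < a3 ->
  (forall n (hn : (0 < n)%N) (u : 'rV[R]_(p n)),
     sparse (2 * q n) u -> norm2 u = 1 ->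
     (a1%:E <= 'E_(P n)[fun w => (dot (Z n (Ordinal hn) w).1 u ^+ 2)%R])%E /\
     ('E_(P n)[fun w => (`|dot (Z n (Ordinal hn) w).1 u| ^+ 3)%R] <= a2%:E)%E) ->
  (forall n (hn : (0 < n)%N) (j : 'I_(p n)),
     {ae P n, forall w, `|tnth (Z n (Ordinal hn) w).1 j| <= a3}) ->
  (forall n, (0 < n)%N -> (#|supp (beta0 n)| <= q n)%N) ->
  (forall n, (0 < n)%N -> norm2 (beta0 n) <= a0) ->
  0 <= gamma ->
  (1 - (2%:E * kappa)^-1 < gamma%:E)%E ->
  P n [set w | argmin_bic gamma (q n) (fun i => Z n i w) = [set supp (beta0 n)]]
    @[n --> \oo] --> 1%E.
Proof.
move=> Ziid Zlog q_gt0 p_infty kappa0 p_kappa /andP[tau0 tau1] lnp_tau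
  /andP[psi0 psi1] q_psi /andP[phi0 phi1] bmin a00 a10 a20 a30 moments Xbd J0q
  b0norm gamma0 gamma_kappa.
have [g0 g00 gap] := penalty_gap kappa0 gamma_kappa.
pose A2 := 1 + a2; pose c := curvature a0 a1 a2 / 4; pose C1 := A2 / c.
pose c1 := curvature a0 a1 a2 / 256; pose CT := 2^-1 + gamma.
pose eta := Num.min 2^-1 (g0 / (4 * CT)); pose aL := eta * c1.
pose Cr := 4 * (3 * CT + 2 * a3 ^+ 2 + 1) / aL + 16.
pose eta2 := aL / (16 * ((A2 + 1) * C1)).
pose L n : R := ln n%:R + ln (p n)%:R.
pose X n : R := (q n)%:R ^+ 3 * L n / n%:R.
pose CL := tau^-1 + 1.
have curv0 : 0 < curvature a0 a1 a2 by exact: curvature_gt0.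
have CT0 : 0 < CT by apply: ltr_wpDr => //; rewrite invr_gt0.
have eta0 : 0 < eta.
  by rewrite lt_min invr_gt0 ltr0n/=; apply: divr_gt0 => //; apply: mulr_gt0.
have aL0 : 0 < aL.
  apply: mulr_gt0; first exact: eta0.
  by apply: mulr_gt0; [exact: curv0|rewrite invr_gt0 ltr0n].
have C10 : 0 < C1 by apply: divr_gt0; [exact: addr_gt0|exact: divr_gt0].
have eta20 : 0 < eta2.
  by apply: divr_gt0 => //; apply: mulr_gt0 => //; apply: mulr_gt0 => //; rewrite !addr_gt0.
have CL0 : 0 < CL by rewrite addr_gt0 ?invr_gt0.
(* Since log n <= n^tau / tau, both logarithms are of order n^tau. *)
have Lle n : (0 < n)%N -> L n <= CL * expR (tau * ln n%:R).
  move=> n0; rewrite /L /CL mulrDl mul1r; apply: lerD; last by rewrite -powR_expR// lnp_tau.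
  rewrite -ler_pdivrMl ?invr_gt0// invrK; apply: le_trans (expR_ge1Dx _).
  by rewrite lerDr.
have nE n : (0 < n)%N -> n%:R^-1 = expR (- ln n%:R) :> R.
  by move=> n0; rewrite expRN lnK// posrE ltr0n.
(* With m = 3 the exponent 1 - 3 psi - tau is positive, which controls all error terms; with m = 1
   it exceeds phi, so [beta_min] dominates the localisation radius. *)
have qL_le m n : (0 < n)%N -> (0 < p n)%N ->
    (q n)%:R ^+ m * L n / n%:R <= CL * expR (- ((1 - m%:R * psi - tau) * ln n%:R)).
  move=> n0 p0; have L0 : 0 <= L n by rewrite addr_ge0// ln_ge0// ler1n.
  have h1 : (q n)%:R ^+ m <= expR (m%:R * psi * ln n%:R) :> R.
    rewrite -mulrA expRM_natl lerXn2r ?nnegrE ?expR_ge0//.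
    by rewrite -powR_expR// q_psi.
  rewrite (_ : CL * _ = expR (m%:R * psi * ln n%:R) * (CL * expR (tau * ln n%:R)) *
      expR (- ln n%:R)); last first.
    by rewrite mulrCA -!mulrA -!expRD; congr (_ * expR _); ring.
  rewrite nE//; apply: ler_pM => //; rewrite ?expR_ge0 ?mulr_ge0 ?exprn_ge0//.
  by apply: ler_pM => //; exact: Lle.
have p_ge1 : \forall n \near \oo, (0 < p n)%N 
  by exact: (p_infty _ (nbhs_infty_gt 0%N)).
have Cr0 : 0 <= Cr.
  apply: addr_ge0 => //; apply: divr_ge0; last exact: ltW.
  apply: mulr_ge0 => //; apply: addr_ge0 => //; apply: addr_ge0; last first.
    by apply: mulr_ge0 => //; exact: sqr_ge0.
  by apply: mulr_ge0 => //; exact: ltW.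
have X_small (C e : R) : 0 <= C -> 0 < e -> \forall n \near \oo, C * X n <= e.
  move=> C0 e0; near=> n.
  have n0 : (0 < n)%N by near: n; exact: nbhs_infty_gt.
  have p0 : (0 < p n)%N by near: n.
  apply: le_trans (ler_wpM2l C0 (qL_le 3 n n0 p0)) _; rewrite mulrA.
  near: n; apply: near_expR_small => //; first by rewrite mulr_ge0// ltW.
  by move: psi1; lra.
have Y_small : \forall n \near \oo,
    Cr * ((q n)%:R * L n / n%:R) <= (n%:R `^ (- (phi / 2))) ^+ 2.
  near=> n.
  have n0 : (0 < n)%N by near: n; exact: nbhs_infty_gt.
  have p0 : (0 < p n)%N by near: n.
  have := ler_wpM2l Cr0 (qL_le 1 n n0 p0); rewrite expr1 mul1r => h.
  apply: le_trans h _; rewrite powR_expR// -expRM_natl.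
  rewrite (_ : 2 * _ = - (phi * ln n%:R)); last by field.
  rewrite (_ : - ((1 - psi - tau) * _) =
      - ((1 - psi - tau - phi) * ln n%:R) + - (phi * ln n%:R)); last by ring.
  rewrite expRD !mulrA -[leRHS]mul1r ler_wpM2r ?expR_ge0//.
  near: n; apply: near_expR_small => //; first by rewrite mulr_ge0// ltW.
  by move: phi1; lra.
have L_big (A : R) : \forall n \near \oo, A <= L n.
  near=> n; have p0 : (0 < p n)%N by near: n.
  rewrite /L; apply: (@le_trans _ _ (ln n%:R)); first by near: n; exact: near_ln_ge.
  by rewrite lerDl ln_ge0// ler1n.
have Lexp (C s e : R) : 0 <= C -> 0 < s -> 0 < e ->
    \forall n \near \oo, C * expR (- (s * L n)) <= e.
  move=> C0 s0 e0; have [A hA] := expR_decay C0 s0 e0.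
  by apply: filterS (L_big A) => n; exact: hA.
pose K := 2 / (1 - expR (- aL)).
have K0 : 0 <= K.
  by rewrite divr_ge0// subr_ge0 -expR0 ler_expR oppr_le0 ltW.
have fin n : (0 < n)%N -> P n [set w | argmin_bic gamma (q n) (fun i => Z n i w) =
    [set supp (beta0 n)]] \is a fin_num.
  by move=> n0; apply: fin_num_measure; apply: measurable_selection; exact: J0q.
have a32 : 0 <= a3 ^+ 2 by exact: sqr_ge0.
have a34 : 0 <= a3 ^+ 4 by rewrite exprn_ge0// ltW.
have C1' := ltW C10; have A21 : 0 <= A2 + 1 by rewrite !addr_ge0// ltW.
pose Q1 := 6 * a3 ^+ 2 * Cr.
pose Q2 := 6 * a3 ^+ 2 * C1 * Cr.
pose Q3 := 2 * a3 ^+ 2 * C1 * Cr.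
pose Q4 := 576 * a3 ^+ 4.
pose Q5 := 2304 * a3 ^+ 4 * C1 ^+ 2 * Cr / aL +
  a3 ^+ 2 * C1 ^+ 2 * (A2 + 1) * Cr ^+ 2 / (2 * eta2).
have Q1_ge0 : 0 <= Q1 by apply: mulr_ge0 => //; apply: mulr_ge0.
have Q2_ge0 : 0 <= Q2 by apply: mulr_ge0 => //; apply: mulr_ge0 => //; apply: mulr_ge0.
have Q3_ge0 : 0 <= Q3 by apply: mulr_ge0 => //; apply: mulr_ge0 => //; apply: mulr_ge0.
have Q4_ge0 : 0 <= Q4 by apply: mulr_ge0; [exact: ler0n|exact: a34].
have Q5_ge0 : 0 <= Q5.
  apply: addr_ge0.
    apply: divr_ge0; last exact: ltW.
    apply: mulr_ge0; last exact: Cr0.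
    apply: mulr_ge0; last exact: sqr_ge0.
    by apply: mulr_ge0; [exact: ler0n|exact: a34].
  apply: divr_ge0; last by apply: mulr_ge0 => //; exact: ltW.
  apply: mulr_ge0; last exact: sqr_ge0.
  by apply: mulr_ge0 => //; apply: mulr_ge0 => //; exact: sqr_ge0.
have g8 : 0 < g0 / 8 by exact: divr_gt0.
have g4 : 0 < g0 / 4 by exact: divr_gt0.
have i16 : 0 < 16^-1 :> R by rewrite invr_gt0 ltr0n.
have i4 : 0 < 4^-1 :> R by rewrite invr_gt0 ltr0n.
have i2 : 0 < 2^-1 :> R by rewrite invr_gt0 ltr0n.
apply/fine_cvgP; split.
  by near=> n; apply: fin; near: n; exact: nbhs_infty_gt.
apply/cvgrPdist_le => e e0; have e8 : 0 < e / 8 by exact: divr_gt0.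
near=> n.
have n0 : (0 < n)%N by near: n; exact: nbhs_infty_gt.
have p0 : (0 < p n)%N by near: n.
have L1 : 1 <= L n by near: n; exact: L_big.
have Lb : aL + (A2 + 1) * C1 <= g0 / 8 * L n.
  by rewrite [leRHS]mulrC -ler_pdivrMr//; near: n; exact: L_big.
have s0 : X n <= 16^-1.
  by rewrite -[X n]mul1r; near: n; exact: X_small.
have s1 : Q1 * X n <= 4^-1 by near: n; exact: X_small.
have s2 : Q2 * X n <= 4^-1 by near: n; exact: X_small.
have s3 : Q3 * X n <= eta2 ^+ 2 by near: n; apply: X_small => //; exact: exprn_gt0.
have s4 : Q4 * X n <= 1 by near: n; exact: X_small.
have s5 : Q5 * X n <= g0 / 8 by near: n; exact: X_small.
have sY : Cr * ((q n)%:R * L n / n%:R) <= (n%:R `^ (- (phi / 2))) ^+ 2 by near: n.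
have u1 : K * expR (- (g0 / 4 * L n)) <= 2^-1 by near: n; exact: Lexp.
have u2 : K * expR (- (g0 / 4 * L n)) <= e / 8 by near: n; exact: Lexp.
have v1 : expR (- (2 * L n)) <= e / 8.
  by rewrite -[leLHS]mul1r; near: n; exact: Lexp.
have u0 : 0 <= K * expR (- (g0 / 4 * L n)) by rewrite mulr_ge0 ?expR_ge0.
have gapn := gap n (p n) n0 p0 (fun r rE => p_kappa r rE n n0).
have rate := @selection_prob_rate _ _ R (P n) n (p n) (q n) (Z n) (Ordinal n0) (beta0 n)
  a0 a1 a2 a3 gamma g0 (n%:R `^ (- (phi / 2))) a00 a10 a20 a30 (Ziid n n0)
  (Zlog n n0 _) (Xbd n n0) (moments n n0) (J0q n n0) (b0norm n n0) gamma0 g00 p0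
  (q_gt0 n n0) gapn L1 Lb s0 s1 s2 s3 s4 s5 (powR_ge0 _ _) (beta_min_le (bmin n n0)) sY.
have le1 : (P n [set w | argmin_bic gamma (q n) (fun i => Z n i w) =
    [set supp (beta0 n)]] <= 1)%E.
  by apply: probability_le1; apply: measurable_selection; exact: J0q.
rewrite /= -(fineK (fin n n0)) in rate le1.
rewrite lee_fin in rate; rewrite lee_fin in le1.
rewrite ger0_norm ?subr_ge0// lerBlDr -lerBlDl.
apply: le_trans rate; rewrite lerD2l lerN2.
exact: (failure_small u0 u1 u2 v1).
Unshelve. all: by end_near. Qed.
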